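(* Let $B$ be a norming region. For every $x\in S$, $$\bar{\mathbb P}^{(x,\mathrm{blue})}_B=\mathbb P^x_B\otimes\bar\Gamma^{\mathrm{col}}=P_h^x\otimes\bar\Gamma^{\mathrm{deco}}.$$ Moreover, for every finite set $\mathbf x\subset[0,1]\times S$ with distinct first components (for which $\mathbb P^{\mathbf x}_B$ is defined), $$\bar{\mathbb P}^{\mathrm{col}_h(\mathbf x)}_B=\mathbb P^{\mathbf x}_B\otimes\bar\Gamma^{\mathrm{col}}.$$
   Context: $S$ countable, $p=(p_{x,y})$ stochastic on $S$, $(d_x)_{x\in S}$ offspring distributions on $\mathbb N_0$, $m_x=\sum_m m\,d_x(m)$, $q_{x,y}=m_xp_{x,y}$, $Q=(q_{x,y})$, Green's function $g=\sum_{n\ge0}Q^n$ assumed finite entrywise. BMC$(d,p)$ in labelled form: for a finite $\mathbf x\subset[0,1]\times S$ with distinct labels, $\mathbb P^{\mathbf x}$ is the law of the random forest (set of triples (predecessor label or $\emptyset$, label, location)) with generation 0 given by $\{(\emptyset,i,x):(i,x)\in\mathbf x\}$ and where each individual at $z$ independently gets a $d_z$-distributed number of children at independent $p(z,\cdot)$-locations with independent uniform labels in $[0,1]$; $\mathbb P^x$ starts from one individual at $x$ with a uniform label. $\mathcal H_B(\mathfrak t)$ is the set of individuals located in $B$ with no strict iterated predecessor located in $B$. A norming region is a finite $B\subset S$ with $\sum_{y\in B}g(x,y)>0$ for all $x$; $h(x)=\mathbb E^x[\#\mathcal H_B]$. The $B$-size-biased law is $d\mathbb P^{\mathbf x}_B/d\mathbb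 P^{\mathbf x}=\#\mathcal H_B/\mathbb E^{\mathbf x}[\#\mathcal H_B]$, $\mathbb P^x_B$ likewise. $P_h^x$: Markov chain from $x$ with substochastic transitions $p^h_{x,y}=\mathbf 1_{B^c}(x)q_{x,y}h(y)/h(x)$, absorbed at a cemetery $\partial$; viewed as quasi-path $[w]$ (class modulo time shift of $w\in(S\cup\{\partial\})^{\mathbb Z}$ with $w_n=X_n$, $n\ge0$, $w_n=\partial$, $n<0$). $d^{\mathrm{s.b.}}_x(n)=n\,d_x(n)/m_x$. Decoration $\bar\Gamma^{\mathrm{deco}}([w],\cdot)$ (for $w$ with $w_n\in S$ exactly when $t_\partial\le n<t^\partial$): create blue spine individuals with independent uniform labels $i_k$ at $w_k$, $k\in\mathbb Z\cap[t_\partial,t^\partial)$, with predecessor $i_{k-1}$ (none if $k=t_\partial$); to a spine individual at $x\notin B$ attach independently, with probability $d^{\mathrm{s.b.}}_x(n)$, $n-1$ white children at independent $p(x,\cdot)$-locations, each rooting an independent white BMC$(d,p)$; a spine individual at $x\in B$ roots an independent white BMC$(d,p)$. Colouring $\bar\Gamma^{\mathrm{col}}(\mathfrak t,\cdot)$ for a forest $\mathfrak t$ with $\mathcal H_B(\mathfrak t)\ne\emptyset$: choose an element of $\mathcal H_B(\mathfrak t)$ uniformly at random, colour it and all its iterated predecessors blue and all other individuals white. $B$-biased BMC: two-type BMC (white/blue); whites and blues located in $B$ reproduce as in BMC$(d,p)$ with white children; a blue at $x\notin B$ has $n$ children with ordered locations $y_1,\dots,y_n$ with probability $\frac1{h(x)}d_x(n)\prod_kp_{x,y_k}\sum_kh(y_k)$,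 then the $k$-th child is blue with probability $h(y_k)/\sum_lh(y_l)$, the others white; children get independent uniform labels. $\bar{\mathbb P}^{(x,\mathrm{blue})}_B$ is its law from one blue individual at $x$, and for a coloured initial set $\bar{\mathbf x}$, $\bar{\mathbb P}^{\bar{\mathbf x}}_B$ its law from $\bar{\mathbf x}$ (mixtures for random $\bar{\mathbf x}$). $\mathrm{col}_h(\mathbf x)$ is the law of the random colouring of $\mathbf x$ that colours one element $(i,x)$ blue, chosen with probability proportional to $h(x)$, and all others white. Notation: for a measure $\mu$ and a kernel $K$, $\mu\otimes K$ denotes the measure $A\mapsto\int K(a,A)\,\mu(da)$ on the target space. *)

(* Defs.v *)
From HB Require Import structures.
From mathcomp Require Import all_boot all_order all_algebra.
From mathcomp Require Import all_classical all_reals all_analysis.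
From Stdlib Require Import Relation_Operators.
Set Implicit Arguments. Unset Strict Implicit. Unset Printing Implicit Defensive.
Import Order.TTheory GRing.Theory Num.Theory.
Local Open Scope classical_set_scope.
Local Open Scope ring_scope.

Definition mean (R : realType) (S : countType) (d : S -> nat -> R) (x : S) : \bar R :=
  \esum_(n in [set: nat]) ((n%:R * d x n)%:E).

Definition qk (R : realType) (S : countType) (p : S -> S -> R) (d : S -> nat -> R)
  (x y : S) : \bar R := (mean d x * (p x y)%:E)%E.

Fixpoint Qpow (R : realType) (S : countType) (p : S -> S -> R) (d : S -> nat -> R)
  (n : nat) (x y : S) : \bar R :=
  match n with
  | 0 => ((x == y)%:R)%:E
  | n'.+1 => \esum_(z in [set: S]) (Qpow p d n' x z * qk p d z y)%E
  end.

Definition green (R : realType) (S : countType) (p : S -> S -> R) (d : S -> nat -> R)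
  (x y : S) : \bar R := \esum_(n in [set: nat]) Qpow p d n x y.

Definition stochastic (R : realType) (S : countType) (p : S -> S -> R) : Prop :=
  forall x, (forall y, 0 <= p x y) /\ \esum_(y in [set: S]) (p x y)%:E = 1%E.

Definition offspring_laws (R : realType) (S : countType) (d : S -> nat -> R) : Prop :=
  forall x, (forall n, 0 <= d x n) /\ \esum_(n in [set: nat]) (d x n)%:E = 1%E.

Definition norming_region (R : realType) (S : countType) (p : S -> S -> R)
  (d : S -> nat -> R) (B : seq S) : Prop :=
  forall x, (0 < \sum_(y <- undup B) green p d x y)%E.

Definition iid_uniform (R : realType) (dO : measure_display) (O : measurableType dO)
  (P : probability O R) (U : seq nat -> nat -> O -> R) : Prop :=
  (forall w k, measurable_fun setT (U w k)) /\
  forall (I : seq (seq nat * nat)) (A : seq nat * nat -> set R),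
    uniq I -> (forall i, measurable (A i)) ->
    P (\bigcap_(i in [set` I]) (U i.1 i.2 @^-1` A i)) =
    (\prod_(i <- I) lebesgue_measure (A i `&` `[0%R, 1%R]))%E.

(* sampling from a discrete (sub)probability pi on a countable type by a
   uniform variable u (inverse-CDF along the enumeration pickle);
   None = leftover mass (used for the cemetery) *)
Definition dweight (R : realType) (T : countType) (pi : T -> R) (n : nat) : R :=
  if @pickle_inv T n is Some t then pi t else 0.

Definition dcum (R : realType) (T : countType) (pi : T -> R) (n : nat) : R :=
  \sum_(i < n) dweight pi i.

Definition dsample (R : realType) (T : countType) (pi : T -> R) (u : R) : option T :=
  match pselect (exists n, dcum pi n <= u < dcum pi n.+1) with
  | left H => @pickle_inv T (proj1_sig (cid H))
  | right _ => None
  end.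

(* individual = (predecessor label or None, label, location); coloured *)
(* individual additionally carries a colour (true = blue)              *)

Definition Ind (R : realType) (S : countType) := (option R * R * S)%type.
Definition CInd (R : realType) (S : countType) := (Ind R S * bool)%type.

Definition pred_of (R : realType) (S : countType) (t : set (Ind R S)) (v w : Ind R S) : Prop :=
  t w /\ v.1.1 = Some w.1.2.

Definition strict_anc (R : realType) (S : countType) (t : set (Ind R S)) (v w : Ind R S) : Prop :=
  clos_trans _ (pred_of t) v w.

Definition HB (R : realType) (S : countType) (B : seq S) (t : set (Ind R S)) : set (Ind R S) :=
  [set v | t v /\ v.2 \in B /\ ~ (exists w, strict_anc t v w /\ w.2 \in B)].

Definition card_e (R : realType) (T : choiceType) (A : set T) : \bar R :=
  \esum_(v in A) 1%E.

Definition uncolour (R : realType) (S : countType) (t : set (CInd R S)) : set (Ind R S) :=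
  [set v.1 | v in t].

Definition colour_at (R : realType) (S : countType) (t : set (Ind R S)) (v : Ind R S)
  : set (CInd R S) :=
  [set c | t c.1 /\ c.2 = `[< c.1 = v \/ strict_anc t v c.1 >]].

Definition Gamma_col (R : realType) (S : countType) (B : seq S) (t : set (Ind R S))
  (A : set (set (CInd R S))) : \bar R :=
  if `[< (0 < card_e R (HB B t))%E /\ (card_e R (HB B t) < +oo)%E >] then
    (\esum_(v in HB B t) (\1_A (colour_at t v))%:E / card_e R (HB B t))%E
  else 0%E.

Definition atleast (T : Type) (k : nat) (A : set T) : Prop :=
  exists f : 'I_k -> T, injective f /\ forall i, A (f i).

Definition forest_gen (R : realType) (S : countType) : set (set (set (CInd R S))) :=
  [set E | exists (Op : set (option R)) (L : set R) (y : S) (b : bool) (k : nat),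
     measurable (Some @^-1` Op) /\ measurable L /\
     E = [set t | atleast k (t `&` [set c : CInd R S |
                     Op c.1.1.1 /\ L c.1.1.2 /\ c.1.2 = y /\ c.2 = b])]].

Definition forest_measurable (R : realType) (S : countType) (A : set (set (CInd R S))) : Prop :=
  <<s @forest_gen R S >> A.

(* word w (Ulam-Harris, first letter = index of root); uniforms:       *)
(*  U w 0 = label, U w 1 = reproduction, U w 2 = location (of w itself) *)


Definition child_loc (R : realType) (S : countType) (p : S -> S -> R) (dO : measure_display)
  (O : measurableType dO) (U : seq nat -> nat -> O -> R) (w : seq nat) (j : nat) (z : S)
  (om : O) : S :=
  odflt z (dsample (p z) (U (rcons w j) 2 om)).

(* law of (ordered children locations, index of blue child) of a blue at z outside B *)
Definition blue_weight (R : realType) (S : countType) (p : S -> S -> R) (d : S -> nat -> R)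
  (h : S -> R) (z : S) (yk : seq S * nat) : R :=
  if (yk.2 < size yk.1)%N then
    d z (size yk.1) * \prod_(y <- yk.1) p z y * h (nth z yk.1 yk.2) / h z
  else 0.

Definition kids (R : realType) (S : countType) (p : S -> S -> R) (d : S -> nat -> R)
  (B : seq S) (h : S -> R) (dO : measure_display) (O : measurableType dO)
  (U : seq nat -> nat -> O -> R) (w : seq nat) (s : S * bool) (om : O) : seq (S * bool) :=
  let z := s.1 in
  if s.2 && (z \notin B) then
    match dsample (blue_weight p d h z) (U w 1 om) with
    | Some yk => [seq (nth z yk.1 j, j == yk.2) | j <- iota 0 (size yk.1)]
    | None => [::]
    end
  else [seq (child_loc p U w j z om, false) | j <- iota 0 (odflt 0 (dsample (d z) (U w 1 om)))].

Fixpoint node (R : realType) (S : countType) (p : S -> S -> R) (d : S -> nat -> R)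
  (B : seq S) (h : S -> R) (dO : measure_display) (O : measurableType dO)
  (U : seq nat -> nat -> O -> R) (w : seq nat) (s : S * bool) (u : seq nat) (om : O)
  : option (S * bool) :=
  match u with
  | [::] => Some s
  | i :: u' =>
      match onth (kids p d B h U w s om) i with
      | Some s' => node p d B h U (rcons w i) s' u' om
      | None => None
      end
  end.

Definition bmc_forest (R : realType) (S : countType) (p : S -> S -> R) (d : S -> nat -> R)
  (B : seq S) (h : S -> R) (dO : measure_display) (O : measurableType dO)
  (U : seq nat -> nat -> O -> R) (rs : seq (R * (S * bool))) (om : O) : set (CInd R S) :=
  let lab (w : seq nat) : R :=
    match w with
    | [:: i] => if onth rs i is Some r then r.1 else 0
    | _ => U w 0 om
    end in
  [set c | exists (i : nat) (u : seq nat) (r : R * (S * bool)),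
     onth rs i = Some r /\
     node p d B h U [:: i] r.2 u om = Some (c.1.2, c.2) /\
     c.1.1.2 = lab (i :: u) /\
     c.1.1.1 = (if u is [::] then None else Some (lab (take (size u) (i :: u))))].

Definition bmc_x (R : realType) (S : countType) (p : S -> S -> R) (d : S -> nat -> R)
  (B : seq S) (dO : measure_display) (O : measurableType dO)
  (U : seq nat -> nat -> O -> R) (x : S) (om : O) : set (Ind R S) :=
  uncolour (bmc_forest p d B (fun _ => 0) U [:: (U [::] 0 om, (x, false))] om).

Definition bmc_xs (R : realType) (S : countType) (p : S -> S -> R) (d : S -> nat -> R)
  (B : seq S) (dO : measure_display) (O : measurableType dO)
  (U : seq nat -> nat -> O -> R) (xs : seq (R * S)) (om : O) : set (Ind R S) :=
  uncolour (bmc_forest p d B (fun _ => 0) U [seq (r.1, (r.2, false)) | r <- xs] om).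

Definition hfun (R : realType) (S : countType) (p : S -> S -> R) (d : S -> nat -> R)
  (B : seq S) (dO : measure_display) (O : measurableType dO) (P : probability O R)
  (U : seq nat -> nat -> O -> R) (x : S) : \bar R :=
  (\int[P]_om card_e R (HB B (bmc_x p d B U x om)))%E.

Definition hR (R : realType) (S : countType) (p : S -> S -> R) (d : S -> nat -> R)
  (B : seq S) (dO : measure_display) (O : measurableType dO) (P : probability O R)
  (U : seq nat -> nat -> O -> R) (x : S) : R := fine (hfun p d B P U x).

(* (mu_B (x) Gamma^col)(A) where mu = law of F under P and mu_B its B-size-biased law:
   int  #H_B(t) Gamma^col(t,A) mu(dt) / int #H_B(t) mu(dt) *)
Definition sizebiased_col (R : realType) (S : countType) (B : seq S)
  (dO : measure_display) (O : measurableType dO) (P : probability O R)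
  (F : O -> set (Ind R S)) (A : set (set (CInd R S))) : \bar R :=
  ((\int[P]_om (card_e R (HB B (F om)) * Gamma_col B (F om) A))
   / (\int[P]_om card_e R (HB B (F om))))%E.

Definition claw (R : realType) (S : countType) (dO : measure_display) (O : measurableType dO)
  (P : probability O R) (F : O -> set (CInd R S)) (A : set (set (CInd R S))) : \bar R :=
  P (F @^-1` A).

Definition biased_x (R : realType) (S : countType) (p : S -> S -> R) (d : S -> nat -> R)
  (B : seq S) (dO : measure_display) (O : measurableType dO) (P : probability O R)
  (U : seq nat -> nat -> O -> R) (x : S) (om : O) : set (CInd R S) :=
  bmc_forest p d B (hR p d B P U) U [:: (U [::] 0 om, (x, true))] om.

Definition colh_weight (R : realType) (S : countType) (h : S -> R) (xs : seq (R * S)) (i : nat) : R :=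
  if onth xs i is Some r then h r.2 / \sum_(r' <- xs) h r'.2 else 0.

Definition biased_colh (R : realType) (S : countType) (p : S -> S -> R) (d : S -> nat -> R)
  (B : seq S) (dO : measure_display) (O : measurableType dO) (P : probability O R)
  (U : seq nat -> nat -> O -> R) (xs : seq (R * S)) (om : O) : set (CInd R S) :=
  let i0 := odflt 0 (dsample (colh_weight (hR p d B P U) xs) (U [::] 1 om)) in
  bmc_forest p d B (hR p d B P U) U
    [seq (r.2.1, (r.2.2, r.1 == i0)) | r <- zip (iota 0 (size xs)) xs] om.

(* h-transformed substochastic chain, killed at the cemetery (None);
   step k uses U [:: k] 3 *)
Definition ph_kernel (R : realType) (S : countType) (p : S -> S -> R) (d : S -> nat -> R)
  (B : seq S) (h : S -> R) (z y : S) : R :=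
  if z \in B then 0 else fine (qk p d z y) * h y / h z.

Fixpoint hchain (R : realType) (S : countType) (p : S -> S -> R) (d : S -> nat -> R)
  (B : seq S) (h : S -> R) (dO : measure_display) (O : measurableType dO)
  (U : seq nat -> nat -> O -> R) (x : S) (k : nat) (om : O) : option S :=
  match k with
  | 0 => Some x
  | k'.+1 => match hchain p d B h U x k' om with
             | Some z => dsample (ph_kernel p d B h z) (U [:: k'] 3 om)
             | None => None
             end
  end.

Definition sb_law (R : realType) (S : countType) (d : S -> nat -> R) (z : S) (n : nat) : R :=
  n%:R * d z n / fine (mean d z).

Definition spine_nkids (R : realType) (S : countType) (d : S -> nat -> R) (B : seq S)
  (dO : measure_display) (O : measurableType dO) (U : seq nat -> nat -> O -> R)
  (k : nat) (z : S) (om : O) : nat :=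
  if z \in B then odflt 0 (dsample (d z) (U [:: k] 1 om))
  else (odflt 1 (dsample (sb_law d z) (U [:: k] 1 om))).-1.

(* decorated forest: spine individual k has word [:: k] and label U [:: k] 0;
   its j-th white child has word [:: k; j], location via U [:: k; j] 2,
   and roots an independent white BMC (words k :: j :: _) *)
Definition deco_forest (R : realType) (S : countType) (p : S -> S -> R) (d : S -> nat -> R)
  (B : seq S) (dO : measure_display) (O : measurableType dO) (P : probability O R)
  (U : seq nat -> nat -> O -> R) (x : S) (om : O) : set (CInd R S) :=
  let h := hR p d B P U in
  [set c | (exists k z, hchain p d B h U x k om = Some z /\
              c = ((if k is k'.+1 then Some (U [:: k'] 0 om) else None, U [:: k] 0 om, z), true))
        \/ (exists k z j u,
              hchain p d B h U x k om = Some z /\ (j < spine_nkids d B U k z om)%N /\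
              node p d B h U [:: k; j] (child_loc p U [:: k] j z om, false) u om
                = Some (c.1.2, c.2) /\
              c.1.1.2 = U [:: k, j & u] 0 om /\
              c.1.1.1 = Some (U (take (size u).+1 [:: k, j & u]) 0 om))].

(* Main.v *)
From HB Require Import structures.
From mathcomp Require Import all_boot all_order all_algebra.
From mathcomp Require Import all_classical all_reals all_analysis measurable_realfun.
From mathcomp Require Import ring.
From Stdlib Require Import Relation_Operators.
Require Import Defs.
Set Implicit Arguments. Unset Strict Implicit. Unset Printing Implicit Defensive.
Import Order.TTheory GRing.Theory Num.Theory.
Local Open Scope classical_set_scope.
Local Open Scope ring_scope.

(** The law of a random forest is determined by the probabilities that, for finitely many
    measurable sets of individuals, the forest has at least k_i members in the i-th one. Off the
    null event where two labels coincide, these counts are increasing limits over the generations,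
    and for the first n generations they depend only on a random list over a countable type. The
    law of that list is an iterated sum given by the branching property.

    On this level, summing over the words u the event that u addresses an element of H_B, with the
    ancestral line of u coloured blue, gives h(z) times the biased BMC: h is the sum over u of the
    probabilities that u belongs to H_B, it is harmonic off B and equals 1 on B, and a
    blue individual reproduces with the corresponding Doob-transformed weights. The integral of
    the number of elements of H_B against the colouring kernel is exactly such a sum over u.
    The biased BMC and the decorated path have the same offspring law up to the order of the
    children, and the counts do not see that order. *)

(** Four obstacles shape the argument. Labels form a continuum, but a finite family of generators
    sees only finitely many bits of each label; keeping these bits alone makes every expectation a
    countable sum, and independence is needed only between disjoint blocks of uniforms. The address
    of the chosen element of H_B is not truncated together with the tree: the search goes on below
    generation [n] while recording stops, so the size-bias identity is exact for every [n] and no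
    error term has to be controlled in the limit. The biased process is defined through the integral
    [hR], about which nothing is known at the start; the proof works with the series [hh], finite
    because the Green's function is and positive because [B] is norming, and the size-bias identity
    on the whole space shows afterwards that [hR] equals [hh]. Finally, [Gamma_col] is 0 where H_B
    is infinite, and this is harmless because the finite expectation of its cardinality makes that
    event null. *)

(** * Nonnegative extended reals *)

(* A semiring in which arbitrary sums exist and commute, so that summability side
   conditions disappear. *)
Record ennr (R : realType) := Ennr { enn_val :> \bar R ; enn_ge0 : (0 <= enn_val)%E }.

HB.instance Definition _ (R : realType) := [isSub for @enn_val R].
HB.instance Definition _ (R : realType) := [Choice of ennr R by <:].

Section Ennr.
Variable R : realType.
Implicit Types x y z : ennr R.

Lemma enn_eq x y : (x : \bar R) = y -> x = y.
Proof. exact: val_inj. Qed.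

Definition enn0 : ennr R := Ennr (lexx 0%E).
Definition enn1 : ennr R := @Ennr R 1%E (@lee01 R).
Definition ennD x y : ennr R := Ennr (adde_ge0 (enn_ge0 x) (enn_ge0 y)).
Definition ennM x y : ennr R := Ennr (mule_ge0 (enn_ge0 x) (enn_ge0 y)).

Fact ennDA : associative ennD.
Proof. by move=> x y z; apply: enn_eq; rewrite /= addeA. Qed.
Fact ennDC : commutative ennD.
Proof. by move=> x y; apply: enn_eq; rewrite /= addeC. Qed.
Fact enn0D : left_id enn0 ennD.
Proof. by move=> x; apply: enn_eq; rewrite /= add0e. Qed.
Fact ennMA : associative ennM.
Proof. by move=> x y z; apply: enn_eq; rewrite /= muleA. Qed.
Fact ennMC : commutative ennM.
Proof. by move=> x y; apply: enn_eq; rewrite /= muleC. Qed.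
Fact enn1M : left_id enn1 ennM.
Proof. by move=> x; apply: enn_eq; rewrite /= mul1e. Qed.
Fact ennMDl : left_distributive ennM ennD.
Proof. by move=> x y z; apply: enn_eq; rewrite /= ge0_muleDl ?enn_ge0. Qed.
Fact enn0M : left_zero enn0 ennM.
Proof. by move=> x; apply: enn_eq; rewrite /= mul0e. Qed.

HB.instance Definition _ := GRing.isNmodule.Build (ennr R) ennDA ennDC enn0D.
HB.instance Definition _ := GRing.Nmodule_isComPzSemiRing.Build (ennr R)
  ennMA ennMC enn1M ennMDl enn0M.

Lemma enn_valD x y : ((x + y)%R : \bar R) = (enn_val x + enn_val y)%E. Proof. by []. Qed.
Lemma enn_valM x y : ((x * y)%R : \bar R) = (enn_val x * enn_val y)%E. Proof. by []. Qed.
Lemma enn_val0 : enn_val (0 : ennr R) = 0%E. Proof. by []. Qed.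
Lemma enn_val1 : enn_val (1 : ennr R) = 1%E. Proof. by []. Qed.

(** Cancelling a finite summand is what replaces subtraction in this semiring. *)
Lemma enn_addIr z x y : (enn_val z < +oo)%E -> x + z = y + z -> x = y.
Proof.
move=> fz /(congr1 (@enn_val R)); rewrite !enn_valD => e; apply: enn_eq.
have fz' : enn_val z \is a fin_num by rewrite ge0_fin_numE// enn_ge0.
by rewrite -(addeK (enn_val x) fz') e addeK.
Qed.

Lemma enn_val_sum (I : Type) (s : seq I) (Q : pred I) (F : I -> ennr R) :
  enn_val (\sum_(i <- s | Q i) F i) = (\sum_(i <- s | Q i) enn_val (F i))%E.
Proof. exact: (big_morph (@enn_val R) enn_valD). Qed.

Fact toE_subproof (r : R) : (0 <= (Num.max r 0)%:E)%E.
Proof. by rewrite lee_fin le_max lexx orbT. Qed.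

(* Negative reals are sent to [0]. *)
Definition toE (r : R) : ennr R := Ennr (toE_subproof r).

Lemma toE_val r : 0 <= r -> enn_val (toE r) = r%:E.
Proof. by move=> r0; rewrite /= max_l. Qed.

Lemma toEM r s : 0 <= r -> 0 <= s -> toE (r * s) = toE r * toE s.
Proof.
by move=> r0 s0; apply: enn_eq; rewrite enn_valM !toE_val ?mulr_ge0.
Qed.

Lemma toE1 : toE 1 = 1.
Proof. by apply: enn_eq; rewrite toE_val. Qed.

Lemma toE0 : toE 0 = 0.
Proof. by apply: enn_eq; rewrite toE_val. Qed.

Definition ESum (T : choiceType) (F : T -> ennr R) : ennr R :=
  Ennr (@esum_ge0 R T setT (fun t => enn_val (F t)) (fun t _ => enn_ge0 (F t))).

Lemma ESum_val (T : choiceType) (F : T -> ennr R) :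
  enn_val (ESum F) = \esum_(t in [set: T]) enn_val (F t).
Proof. by []. Qed.

Lemma eq_ESum (T : choiceType) (F G : T -> ennr R) : F =1 G -> ESum F = ESum G.
Proof. by move=> FG; congr ESum; exact/funext. Qed.

Lemma ESum0 (T : choiceType) : ESum (fun _ : T => 0) = 0.
Proof. by apply: enn_eq; rewrite ESum_val /= esum1. Qed.

Lemma ESumD (T : choiceType) (F G : T -> ennr R) :
  ESum (fun t => F t + G t) = ESum F + ESum G.
Proof.
by apply: enn_eq; rewrite /= -esumD // => *; exact: enn_ge0.
Qed.

Lemma ESum_sum (T : choiceType) I (s : seq I) (Q : pred I) (F : T -> I -> ennr R) :
  ESum (fun t => \sum_(i <- s | Q i) F t i) = \sum_(i <- s | Q i) ESum (F^~ i).
Proof.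
elim: s => [|i s IH].
  by rewrite big_nil -[RHS](ESum0 T); apply: eq_ESum => t; rewrite big_nil.
rewrite big_cons -IH; case: ifP => Qi.
  by rewrite -ESumD; apply: eq_ESum => t; rewrite big_cons Qi.
by apply: eq_ESum => t; rewrite big_cons Qi.
Qed.

Lemma ESum_pair (T1 T2 : choiceType) (F : T1 -> T2 -> ennr R) :
  ESum (fun t => ESum (F t)) = ESum (fun p => F p.1 p.2).
Proof.
apply: enn_eq; rewrite /= esum_esum; last by move=> *; exact: enn_ge0.
by congr esum; apply/seteqP; split => -[].
Qed.

Lemma ESum_reindex (T T' : choiceType) (e : T -> T') (F : T' -> ennr R) :
  bijective e -> ESum F = ESum (F \o e).
Proof.
move=> be; apply: enn_eq; rewrite /= (@reindex_esum _ _ _ setT setT e) //.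
split => //; first by move=> ? ? _ _; apply: bij_inj.
by case: be => g ge eg t _; exists (g t).
Qed.

Lemma ESum_swap (T1 T2 : choiceType) (F : T1 -> T2 -> ennr R) :
  ESum (fun t => ESum (F t)) = ESum (fun s => ESum (F^~ s)).
Proof.
rewrite !ESum_pair (@ESum_reindex _ _ (fun t : T2 * T1 => (t.2, t.1))) //.
by exists (fun t => (t.2, t.1)); case.
Qed.

Lemma ESum_ge (T : choiceType) (F : T -> ennr R) (t : T) :
  (enn_val (F t) <= enn_val (ESum F))%E.
Proof.
rewrite /=; apply: esum_ge; exists [set t]; first by split.
by rewrite fsbig_set1.
Qed.

(** A real factor commutes with the supremum of the finite partial sums. For [c = +oo] both sides
    are 0 if every term vanishes and infinite otherwise, by the convention that infinity times 0 is
    0. *)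
Lemma ESum_mull (T : choiceType) (c : ennr R) (F : T -> ennr R) :
  ESum (fun t => c * F t) = c * ESum F.
Proof.
apply: enn_eq; case: c => c c0 /=.
case: c c0 => [r| |//] c0.
  rewrite /esum -ereal_supZl; first last.
  - by move: c0; rewrite lee_fin.
  - by apply/set0P; exists (\sum_(i \in set0) enn_val (F i)); exists set0 => //; split.
  congr ereal_sup; apply/seteqP; split => [_ [A ? <-]|_ [_ [A ? <-] <-]].
    exists (\sum_(i \in A) enn_val (F i)); first by exists A.
    by rewrite ge0_mule_fsumr// => ?; exact: enn_ge0.
  by exists A => //; rewrite ge0_mule_fsumr// => ?; exact: enn_ge0.
have [F0|/existsNP[t Ft]] := pselect (forall t, F t = 0).
  by rewrite !esum1 ?mule0// => t _; rewrite F0 ?mule0 //.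
have Ft0 : (0 < enn_val (F t))%E.
  by rewrite lt_neqAle enn_ge0 andbT eq_sym; apply/eqP => Ft0; apply: Ft; exact: enn_eq.
have -> : (+oo * (\esum_(t in [set: T]) enn_val (F t))%R = +oo)%E.
  by rewrite gt0_mulye //; apply: lt_le_trans Ft0 (ESum_ge F t).
apply/eqP; rewrite -leye_eq.
by have := ESum_ge (fun t => Ennr c0 * F t) t; rewrite /= gt0_mulye.
Qed.

Lemma ESum_mulr (T : choiceType) (c : ennr R) (F : T -> ennr R) :
  ESum (fun t => F t * c) = ESum F * c.
Proof. by rewrite mulrC -ESum_mull; apply: eq_ESum => t; rewrite mulrC. Qed.

Lemma ESum_single (T : choiceType) (t0 : T) (F : T -> ennr R) :
  (forall t, t != t0 -> F t = 0) -> ESum F = F t0.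
Proof.
move=> F0; apply: enn_eq; rewrite /=.
rewrite -[RHS](@esum_set1 _ _ t0 (fun t => enn_val (F t))) ?enn_ge0//.
rewrite [RHS]esum_mkcond; apply: eq_esum => t _; case: ifPn => //.
by rewrite notin_setE /= => /eqP /F0 ->.
Qed.

Lemma ESum_delta (T : choiceType) (t0 : T) (F : T -> ennr R) :
  ESum (fun t => (t == t0)%:R * F t) = F t0.
Proof.
by rewrite (@ESum_single _ t0) ?eqxx ?mul1r// => t /negPf ->; rewrite mul0r.
Qed.

Lemma ESum_fiber (T T' : choiceType) (e : T -> T') (F : T -> ennr R) (g : T' -> ennr R) :
  ESum (fun t => F t * g (e t)) = ESum (fun s => ESum (fun t => F t * (e t == s)%:R) * g s).
Proof.
under [RHS]eq_ESum => s do rewrite -ESum_mulr.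
rewrite ESum_swap; apply: eq_ESum => t.
rewrite (@ESum_single _ (e t)) ?eqxx ?mulr1// => s; rewrite eq_sym => /negPf ->.
by rewrite mulr0 mul0r.
Qed.

(** Reindexing along maps that are inverse to each other only on the supports, such as deleting and
    reinserting a list entry at a given position. *)
Lemma ESum_supp (T T' : choiceType) (e : T -> T') (g : T' -> T) (Q : pred T) (Q' : pred T')
    (F : T -> ennr R) (F' : T' -> ennr R) :
  (forall t, Q t -> Q' (e t) /\ g (e t) = t) -> (forall t, Q' t -> Q (g t) /\ e (g t) = t) ->
  (forall t, Q t -> F t = F' (e t)) -> (forall t, ~~ Q t -> F t = 0) ->
  (forall t, ~~ Q' t -> F' t = 0) ->
  ESum F = ESum F'.
Proof.
move=> h1 h2 h3 h4 h5; apply: enn_eq; rewrite /=.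
transitivity (\esum_(t in [set t | Q t]) enn_val (F t)).
  rewrite [RHS]esum_mkcond; apply: eq_esum => t _; case: ifPn => //.
  by rewrite notin_setE /= => /negP /h4 ->.
transitivity (\esum_(t in [set t | Q' t]) enn_val (F' t)); last first.
  rewrite esum_mkcond; apply: eq_esum => t _; case: ifPn => //.
  by rewrite notin_setE /= => /negP /h5 ->.
rewrite (@reindex_esum _ _ _ [set t | Q t] [set t | Q' t] e).
  by apply: eq_esum => t /= Qt; rewrite h3.
split.
- by move=> t /= /h1 [].
- move=> s t; rewrite !inE => Qs Qt est.
  by rewrite -(h1 _ Qs).2 est (h1 _ Qt).2.
- by move=> t /= Qt; exists (g t) => /=; have [] := h2 _ Qt.
Qed.

Lemma ESum_option (T : choiceType) (F : option T -> ennr R) :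
  ESum F = F None + ESum (fun t => F (Some t)).
Proof.
rewrite (eq_ESum (G := fun o => (o == None)%:R * F o + (if o is Some t then F o else 0))).
  rewrite ESumD ESum_delta; congr (_ + _); apply: enn_eq; rewrite /=.
  transitivity (\esum_(o in [set Some t | t in [set: T]]) enn_val (F o)).
    rewrite [RHS]esum_mkcond; apply: eq_esum => o _; case: ifPn.
      by rewrite inE => -[t _ <-].
    by rewrite notin_setE; case: o => // t h; exfalso; apply: h; exists t.
  by rewrite esum_image// => s t _ _ [].
by case=> [t|]; rewrite ?mul0r ?add0r ?mul1r ?addr0.
Qed.

End Ennr.

(** * Events determined by disjoint families of uniforms *)

Section PiLambda.
Variables (R : realType) (X : Type) (G : set (set X)).

(** Additivity is demanded only on the generated sigma-algebra, so that set functions obtained by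
    intersecting, scaling or summing probabilities qualify without being packaged as measures. *)
Definition sigma_additive_on (m : set X -> ennr R) :=
  m set0 = 0 /\ forall F : (set X)^nat, (forall n, <<s G >> (F n)) -> trivIset setT F ->
    m (\bigcup_n F n) = ESum (fun n => m (F n)).

Lemma sigma_additive_setU (m : set X -> ennr R) A B : sigma_additive_on m ->
  <<s G >> A -> <<s G >> B -> A `&` B = set0 -> m (A `|` B) = m A + m B.
Proof.
move=> [m0 mU] GA GB AB.
rewrite -bigcup2E mU.
- rewrite (eq_ESum (G := fun n => (n == 0)%:R * m A + (n == 1)%:R * m B)).
    by rewrite ESumD (ESum_delta _ (fun=> m A)) (ESum_delta _ (fun=> m B)).
  by case => [|[|n]] /=; rewrite ?mul1r ?mul0r ?addr0 ?add0r.
- case=> [|[|n]] //=.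
  by case: (smallest_sigma_algebra setT G).
- apply/trivIsetP => -[|[|i]] [|[|j]] _ _ //=; rewrite ?set0I ?setI0//.
  by rewrite setIC.
Qed.

(** Dynkin's argument: the sets of agreement form a lambda-system. Stability under complements is
    the step that uses finite total mass, since the common value on a set has to be cancelled from
    the common total. *)
Lemma pi_lambda_unique (m1 m2 : set X -> ennr R) : setI_closed G ->
  sigma_additive_on m1 -> sigma_additive_on m2 ->
  (enn_val (m1 setT) < +oo)%E -> m1 setT = m2 setT ->
  (forall A, G A -> m1 A = m2 A) -> forall A, <<s G >> A -> m1 A = m2 A.
Proof.
move=> GI a1 a2 fin mT mG A GA.
pose sG := smallest_sigma_algebra setT G.
suff: [set A | <<s G >> A /\ m1 A = m2 A] A by case.
apply: (@lambda_system_subset _ _ GI setT) GA => //; last first.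
  by move=> B GB; split; [exact: sub_sigma_algebra|exact: mG].
apply/dynkin_lambda_system; split.
- split => //; by case: sG => h0 hC _; have := hC _ h0; rewrite setD0.
- move=> B [GB eB].
  have GC : <<s G >> (~` B) by rewrite -setTD; case: sG => _ hC _; exact: hC.
  split => //.
  have := mT; rewrite -(setUv B) (sigma_additive_setU a1)// ?(sigma_additive_setU a2)// ?setICr//.
  rewrite eB => e.
  have : (enn_val (m2 B) < +oo)%E.
    rewrite -eB; apply: le_lt_trans fin; rewrite -(setUv B) (sigma_additive_setU a1)// ?setICr//.
    by rewrite enn_valD leeDl // enn_ge0.
  by move=> f2; apply: (@enn_addIr _ (m2 B)) => //; rewrite addrC e addrC.
- move=> F tF GF; split.
    by case: sG => _ _; apply => n; have [] := GF n.
  rewrite a1.2 ?a2.2//; first by apply: eq_ESum => n; have [] := GF n.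
  all: by move=> n; have [] := GF n.
Qed.

End PiLambda.

Section Law.
Variables (R : realType) (dO : measure_display) (O : measurableType dO)
  (P : probability O R) (U : seq nat -> nat -> O -> R).
Hypothesis iid : iid_uniform P U.

Definition pr (E : set O) : ennr R := Ennr (measure_ge0 P E).

Lemma pr0 : pr set0 = 0.
Proof. by apply: enn_eq; rewrite /= measure0. Qed.

Lemma prT : pr setT = 1.
Proof. by apply: enn_eq; rewrite /= probability_setT. Qed.

Lemma pr_lty E : measurable E -> (enn_val (pr E) < +oo)%E.
Proof. by move=> mE; rewrite /= (le_lt_trans (probability_le1 P mE))// ltry. Qed.

Lemma pr_bigcup (T : countType) (E : T -> set O) :
  (forall t, measurable (E t)) -> trivIset setT E ->
  pr (\bigcup_t E t) = ESum (fun t => pr (E t)).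
Proof.
move=> mE tE.
pose F n := if @pickle_inv T n is Some t then E t else set0.
have -> : \bigcup_t E t = \bigcup_n F n.
  apply/seteqP; split => [w [t _ Et]|w [n _]].
    by exists (pickle t) => //; rewrite /F pickleK_inv.
  by rewrite /F; case: pickle_inv => // t Et; exists t.
apply: enn_eq; rewrite /= measure_bigcup.
- transitivity (\esum_(n in [set: nat]) P (F n)).
    rewrite -nneseries_esumT//; apply: eq_eseriesl => n; exact: in_setT.
  transitivity (\esum_(n in (@pickle T) @` setT) P (F n)).
    rewrite [RHS]esum_mkcond; apply: eq_esum => n _; case: ifPn => //.
    rewrite notin_setE /F; case e : pickle_inv => [t|]; last by rewrite measure0.
    move=> h; exfalso; apply: h; exists t => //.
    by have := @pickle_invK T n; rewrite /oapp e.
  rewrite esum_image; last by move=> s t _ _; exact: (pcan_inj pickleK).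
  by apply: eq_esum => t _; rewrite /F pickleK_inv.
- by move=> n _; rewrite /F; case: pickle_inv.
- apply/trivIsetP => i j _ _ ij; rewrite /F.
  case e : pickle_inv => [s|]; last by rewrite set0I.
  case e' : pickle_inv => [t|]; last by rewrite setI0.
  move/trivIsetP: tE; apply => //; apply/eqP => st; move/eqP: ij; apply.
  have := @pickle_invK T i; have := @pickle_invK T j.
  by rewrite /oapp e e' st => <- <-.
Qed.

Lemma pr_additive (G : set (set O)) (E : set O) :
  G `<=` measurable -> measurable E -> sigma_additive_on G (fun A => pr (E `&` A)).
Proof.
move=> Gm mE.
have sm : <<s G >> `<=` measurable.
  by apply: smallest_sub => //; exact: sigma_algebra_measurable.
split; first by rewrite setI0 pr0.
move=> F GF tF; rewrite setI_bigcupr pr_bigcup//.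
- by move=> n; apply: measurableI => //; exact: sm.
- exact: trivIset_setIl.
Qed.

(* The pair [(w, l)] stands for the uniform variable [U w l]. *)
Definition idx := (seq nat * nat)%type.

Definition sig_gen (I : set idx) : set (set O) :=
  [set E | exists (i : idx) (A : set R), [/\ I i, measurable A & E = U i.1 i.2 @^-1` A]].

Definition sig (I : set idx) : set (set O) := <<s sig_gen I >>.

Let sigA I := smallest_sigma_algebra setT (sig_gen I).

Lemma sig0 I : sig I set0. Proof. by case: (sigA I). Qed.
Lemma sigC I E : sig I E -> sig I (~` E).
Proof. by move=> h; rewrite -setTD; case: (sigA I) => _ hC _; exact: hC. Qed.
Lemma sigT I : sig I setT. Proof. by rewrite -setC0; apply: sigC; exact: sig0. Qed.
Lemma sig_bigcup_nat I (F : (set O)^nat) : (forall n, sig I (F n)) -> sig I (\bigcup_n F n).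
Proof. by case: (sigA I) => _ _ hU /hU. Qed.

Lemma sig_bigcup I (T : countType) (D : T -> Prop) (F : T -> set O) :
  (forall t, D t -> sig I (F t)) -> sig I [set w | exists t, D t /\ F t w].
Proof.
move=> h.
have -> : [set w | exists t, D t /\ F t w] =
    \bigcup_n (if @pickle_inv T n is Some t then if `[< D t >] then F t else set0 else set0).
  apply/seteqP; split => [w [t [Dt Ft]]|w [n _]].
    exists (pickle t) => //=; rewrite pickleK_inv.
    by case: asboolP.
  by case: pickle_inv => // t; case: asboolP => // Dt Ft; exists t.
apply: sig_bigcup_nat => n; case: pickle_inv => [t|]; last exact: sig0.
by case: asboolP => [/h//|_]; exact: sig0.
Qed.

Lemma sigU I E F : sig I E -> sig I F -> sig I (E `|` F).
Proof.
move=> hE hF; rewrite -bigcup2E; apply: sig_bigcup_nat => -[|[|n]] //=; exact: sig0.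
Qed.

Lemma sigI I E F : sig I E -> sig I F -> sig I (E `&` F).
Proof. by move=> hE hF; rewrite -[E `&` F]setCK setCI; apply: sigC; apply: sigU; exact: sigC. Qed.

Lemma sig_prop I (Q : Prop) : sig I [set _ | Q].
Proof.
have [q|q] := pselect Q.
  by have -> : [set _ : O | Q] = setT; [by apply/seteqP; split|exact: sigT].
have -> : [set _ : O | Q] = set0 by apply/seteqP; split.
exact: sig0.
Qed.

Lemma sig_bigcap I (T : countType) (D : T -> Prop) (F : T -> set O) :
  (forall t, D t -> sig I (F t)) -> sig I [set w | forall t, D t -> F t w].
Proof.
move=> h.
have -> : [set w | forall t, D t -> F t w] = ~` [set w | exists t, D t /\ (~` F t) w].
  apply/seteqP; split => [w hw [t [Dt]]|w hw t Dt]; first by apply; exact: hw.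
  by apply: contrapT => hF; apply: hw; exists t.
by apply: sigC; apply: sig_bigcup => t /h /sigC.
Qed.

Lemma sigS I J E : I `<=` J -> sig I E -> sig J E.
Proof.
move=> IJ; apply: smallest_sub; first exact: smallest_sigma_algebra.
move=> F [i [A [Ii mA ->]]]; apply: sub_sigma_algebra.
by exists i, A; split => //; exact: IJ.
Qed.

Lemma sig_U I (i : idx) A : I i -> measurable A -> sig I (U i.1 i.2 @^-1` A).
Proof. by move=> Ii mA; apply: sub_sigma_algebra; exists i, A. Qed.

Lemma sig_gen_measurable I : sig_gen I `<=` measurable.
Proof.
move=> F [i [A [Ii mA ->]]]; rewrite -[X in measurable X]setTI.
exact: (iid.1 i.1 i.2).
Qed.

Lemma sig_measurable I E : sig I E -> measurable E.
Proof.
apply: smallest_sub; last exact: sig_gen_measurable.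
exact: sigma_algebra_measurable.
Qed.

(** Cylinders form a pi-system generating [sig I], and they are exactly the events whose
    probabilities [iid_uniform] prescribes. *)
Definition cyl (I : set idx) : set (set O) :=
  [set E | exists (s : seq idx) (A : idx -> set R),
    [/\ uniq s, (forall i, i \in s -> I i), (forall i, measurable (A i))
      & E = \bigcap_(i in [set` s]) (U i.1 i.2 @^-1` A i)]].

Lemma cylI I : setI_closed (cyl I).
Proof.
move=> _ _ [s1 [A1 [u1 I1 m1 ->]]] [s2 [A2 [u2 I2 m2 ->]]].
exists (undup (s1 ++ s2)).
(* An index that occurs in one list only gets the full set from the other, hence no extra
   constraint. *)
exists (fun i => (if i \in s1 then A1 i else setT) `&` (if i \in s2 then A2 i else setT)).
split.
- exact: undup_uniq.
- by move=> i; rewrite mem_undup mem_cat => /orP[/I1|/I2].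
- by move=> i; apply: measurableI; case: ifP.
- apply/seteqP; split => [w [h1 h2] i /= _|w h].
    by split; case: ifP => // si; [exact: h1|exact: h2].
  split => i /= si; have := h i; rewrite /= mem_undup mem_cat si ?orbT => /(_ isT).
    by case.
  by case.
Qed.

Lemma sig_cyl I : sig I = <<s cyl I >>.
Proof.
apply/seteqP; split; apply: smallest_sub; try exact: smallest_sigma_algebra.
  move=> _ [i [A [Ii mA ->]]]; apply: sub_sigma_algebra.
  exists [:: i], (fun=> A); split => //.
    by move=> j; rewrite inE => /eqP ->.
  apply/seteqP; split => [w Aw j /=|w /(_ i) /=]; rewrite inE ?eqxx; last exact.
  by move=> /eqP ->.
move=> _ [s [A [us sI mA ->]]].
have -> : \bigcap_(i in [set` s]) U i.1 i.2 @^-1` A i =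
  [set w | forall i : idx, i \in s -> (U i.1 i.2 @^-1` A i) w] by [].
by apply: sig_bigcap => i si; apply: sig_U => //; exact: sI.
Qed.

Lemma cyl_measurable I : cyl I `<=` measurable.
Proof.
by move=> E cE; apply: (@sig_measurable I); rewrite sig_cyl; exact: sub_sigma_algebra.
Qed.

Lemma cyl_indep I J E F : (forall i, I i -> ~ J i) -> cyl I E -> cyl J F ->
  pr (E `&` F) = pr E * pr F.
Proof.
move=> IJ [s1 [A1 [u1 I1 m1 ->]]] [s2 [A2 [u2 I2 m2 ->]]].
have dis : forall i, i \in s1 -> i \in s2 -> False by move=> i /I1 /IJ h /I2.
pose A i := if i \in s1 then A1 i else A2 i.
have -> : (\bigcap_(i in [set` s1]) (U i.1 i.2 @^-1` A1 i)) `&`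
    (\bigcap_(i in [set` s2]) (U i.1 i.2 @^-1` A2 i)) =
    \bigcap_(i in [set` s1 ++ s2]) (U i.1 i.2 @^-1` A i).
  apply/seteqP; split => [w [h1 h2] i /=|w h].
    rewrite mem_cat /A; case: ifPn => [si _|_ /= si]; [exact: h1|exact: h2].
  split => i /= si; have := h i; rewrite /= mem_cat si ?orbT /A => /(_ isT).
    by rewrite si.
  by case: ifPn => // /dis /(_ si).
apply: enn_eq; rewrite enn_valM /= !iid.2//.
- rewrite big_cat /=; congr (_ * _)%E; apply: eq_big_seq => i si; rewrite /A ?si//.
  by case: ifPn => // /dis /(_ si).
- rewrite cat_uniq u1 u2 andbT /=; apply/hasPn => i /= s2i; apply/negP => s1i; exact: dis s1i s2i.
- by move=> i; rewrite /A; case: ifP.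
Qed.

(** The product formula on cylinders is extended one argument at a time by [pi_lambda_unique]: first
    [F] varies with a cylinder fixed, then [E] varies with an arbitrary [F] fixed. *)
Lemma sig_indep I J E F : (forall i, I i -> ~ J i) -> sig I E -> sig J F ->
  pr (E `&` F) = pr E * pr F.
Proof.
move=> IJ sE sF.
have step E' F' : cyl I E' -> sig J F' -> pr (E' `&` F') = pr E' * pr F'.
  move=> cE'; rewrite sig_cyl.
  have mE' : measurable E' by exact: cyl_measurable cE'.
  apply: (@pi_lambda_unique _ _ _ (fun A => pr (E' `&` A)) (fun A => pr E' * pr A)).
  - exact: cylI.
  - by apply: pr_additive => //; exact: cyl_measurable.
  - have [a0 aU] := pr_additive (@cyl_measurable J) (@measurableT _ O).
    split; first by rewrite pr0 mulr0.
    move=> F0 h1 h2; rewrite ESum_mull; congr (_ * _); have := aU F0 h1 h2; rewrite setTI => ->.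
    by apply: eq_ESum => n; rewrite setTI.
  - by rewrite setIT; exact: pr_lty.
  - by rewrite setIT prT mulr1.
  - by move=> A cA; exact: cyl_indep cE' cA.
have mF : measurable F by exact: sig_measurable sF.
move: E sE; rewrite sig_cyl.
apply: (@pi_lambda_unique _ _ _ (fun A => pr (A `&` F)) (fun A => pr A * pr F)).
- exact: cylI.
- have [a0 aU] := pr_additive (@cyl_measurable I) mF.
  split; first by rewrite set0I pr0.
  move=> F0 h1 h2; rewrite setIC aU//.
  by apply: eq_ESum => n; rewrite setIC.
- have [a0 aU] := pr_additive (@cyl_measurable I) (@measurableT _ O).
  split; first by rewrite pr0 mul0r.
  move=> F0 h1 h2; rewrite ESum_mulr; congr (_ * _); have := aU F0 h1 h2; rewrite setTI => ->.
  by apply: eq_ESum => n; rewrite setTI.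
- by rewrite setTI; exact: pr_lty.
- by rewrite setTI prT mul1r.
- by move=> A cA; exact: step.
Qed.

(** Discrete variables determined by the uniforms with index in [I]. Since [T] is countable, looking
    at fibres is enough, and [I] keeps track of what is independent of what. *)
Definition dm (I : set idx) (T : countType) (X : O -> T) :=
  forall t, sig I (X @^-1` [set t]).

(** The expectation of [f] at [X], written as a sum over values, so that [f] needs neither
    measurability nor integrability. *)
Definition Ex (T : countType) (X : O -> T) (f : T -> ennr R) : ennr R :=
  ESum (fun t => pr (X @^-1` [set t]) * f t).

Lemma dmS I J (T : countType) (X : O -> T) : I `<=` J -> dm I X -> dm J X.
Proof. by move=> IJ h t; apply: sigS IJ _. Qed.

Lemma dm_prop I (T : countType) (X : O -> T) (Q : T -> Prop) :
  dm I X -> sig I [set w | Q (X w)].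
Proof.
move=> h.
have -> : [set w | Q (X w)] = [set w | exists t, Q t /\ (X @^-1` [set t]) w].
  by apply/seteqP; split => [w Qw|w [t [Qt e]]] /=; [exists (X w)|rewrite (e : X w = t)].
by apply: sig_bigcup => t _; exact: h.
Qed.

Lemma dm_comp I (T T' : countType) (X : O -> T) (g : T -> T') :
  dm I X -> dm I (fun w => g (X w)).
Proof. by move=> h t; apply: (dm_prop (fun s => g s = t)). Qed.

Lemma dm_cst I (T : countType) (t : T) : dm I (fun=> t).
Proof. by move=> s; rewrite (_ : _ @^-1` _ = [set _ | t = s])//; exact: sig_prop. Qed.

(** The condition on [Y t] is asked only for attained values [t]: a list of children has the
    properties in [kid_ok] only when it is an actual realisation. *)
Lemma dm_bind I (T T' : countType) (X : O -> T) (Y : T -> O -> T') :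
  dm I X -> (forall t, (exists w, X w = t) -> dm I (Y t)) -> dm I (fun w => Y (X w) w).
Proof.
move=> hX hY t.
have -> : (fun w => Y (X w) w) @^-1` [set t] =
    [set w | exists s, (exists w, X w = s) /\ (X @^-1` [set s] `&` Y s @^-1` [set t]) w].
  apply/seteqP; split => [w <-|w [s [_ [/= <- <-]]]] //.
  by exists (X w); split; [exists w|].
by apply: sig_bigcup => s es; apply: sigI; [exact: hX|exact: hY].
Qed.

Lemma dm_pair I (T T' : countType) (X : O -> T) (Y : O -> T') :
  dm I X -> dm I Y -> dm I (fun w => (X w, Y w)).
Proof.
move=> hX hY; apply: (dm_bind (Y := fun t w => (t, Y w))) => // t _.
exact: (dm_comp (fun s => (t, s))).
Qed.

Lemma dm_measurable I (T : countType) (X : O -> T) t : dm I X -> measurable (X @^-1` [set t]).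
Proof. by move=> h; exact: sig_measurable (h t). Qed.

Lemma trivIset_fiber (T : countType) (X : O -> T) : trivIset setT (fun t => X @^-1` [set t]).
Proof.
apply/trivIsetP => s t _ _ /eqP st; by rewrite -subset0 => w [/= ws wt]; apply: st; rewrite -ws -wt.
Qed.

Lemma pr_fiber I J (T : countType) (X : O -> T) E : dm I X -> sig J E ->
  pr E = ESum (fun t => pr (E `&` X @^-1` [set t])).
Proof.
move=> hX /sig_measurable mE; rewrite -pr_bigcup.
- congr pr; rewrite -setI_bigcupr; apply/seteqP; split => [w Ew|w []] //.
  by split => //; exists (X w).
- by move=> t; apply: measurableI => //; exact: dm_measurable hX.
- exact: trivIset_setIl (@trivIset_fiber _ X).
Qed.

Lemma Ex_comp I (T T' : countType) (X : O -> T) (g : T -> T') f :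
  dm I X -> Ex (fun w => g (X w)) f = Ex X (fun t => f (g t)).
Proof.
move=> hX; rewrite /Ex (ESum_fiber g (fun t => pr (X @^-1` [set t])) f); apply: eq_ESum => s; congr (_ * _).
rewrite (pr_fiber hX (dm_comp g hX s)); apply: eq_ESum => t.
have [<-|gt] := eqVneq (g t) s; rewrite ?mulr1 ?mulr0.
  by congr pr; apply/seteqP; split => [w []|w /= <-].
rewrite -pr0; congr pr; rewrite -subset0 => w [/= e1 e2]; move/eqP: gt; apply.
by rewrite -e2.
Qed.

Lemma pr_dm I (T : countType) (X : O -> T) (Q : T -> Prop) :
  dm I X -> pr [set w | Q (X w)] = Ex X (fun t => (`[< Q t >])%:R).
Proof.
move=> hX; rewrite (pr_fiber hX (dm_prop Q hX)); apply: eq_ESum => t.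
case: asboolP => Qt; rewrite ?mulr1 ?mulr0.
  by congr pr; apply/seteqP; split => [w []|w /= e] //; split => //=; rewrite e.
by rewrite -pr0; congr pr; rewrite -subset0 => w [/= q e]; apply: Qt; rewrite -e.
Qed.

Lemma Ex_cst (T : countType) (t : T) f : Ex (fun=> t) f = f t.
Proof.
rewrite /Ex (ESum_single (t0 := t)).
  by have -> : (fun=> t) @^-1` [set t] = [set: O];
    [apply/seteqP; split|rewrite prT mul1r].
move=> s /eqP st.
have -> : (fun=> t) @^-1` [set s] = set0 :> set O.
  by rewrite -subset0 => w /= e; apply: st.
by rewrite pr0 mul0r.
Qed.

Lemma eq_Ex (T : countType) (X : O -> T) f g :
  (forall w, f (X w) = g (X w)) -> Ex X f = Ex X g.
Proof.
move=> fg; apply: eq_ESum => t.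
have [[w <-]|ne] := pselect (exists w, X w = t); first by rewrite fg.
have -> : X @^-1` [set t] = set0 by rewrite -subset0 => w e; apply: ne; exists w.
by rewrite pr0 !mul0r.
Qed.

Lemma Ex_ext (T : countType) (X Y : O -> T) f : X =1 Y -> Ex X f = Ex Y f.
Proof. by move=> /funext ->. Qed.

Lemma Ex_bind I (J : set idx) (T T' : countType) (X : O -> T) (Y : T -> O -> T') f :
  (forall i, I i -> ~ J i) -> dm I X ->
  (forall t, (exists w, X w = t) -> dm J (Y t)) ->
  Ex (fun w => Y (X w) w) f = Ex X (fun t => Ex (Y t) f).
Proof.
move=> IJ hX hY; rewrite /Ex.
under [RHS]eq_ESum => t do rewrite -ESum_mull.
rewrite ESum_swap; apply: eq_ESum => s.
have hB : dm (I `|` J) (fun w => Y (X w) w).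
  apply: dm_bind; first by apply: dmS hX; exact: subsetUl.
  by move=> t et; apply: dmS (hY t et); exact: subsetUr.
rewrite (pr_fiber hX (hB s)) -ESum_mulr; apply: eq_ESum => t; rewrite mulrA; congr (_ * _).
have [et|ne] := pselect (exists w, X w = t).
  rewrite -(sig_indep IJ (hX t) (hY t et s)); congr pr.
  by apply/seteqP; split => w /= [] <- <-.
have -> : X @^-1` [set t] = set0 by rewrite -subset0 => w e; apply: ne; exists w.
by rewrite setI0 pr0 mul0r.
Qed.

Lemma Ex_pair I J (T T' : countType) (X : O -> T) (Y : O -> T') f :
  (forall i, I i -> ~ J i) -> dm I X -> dm J Y ->
  Ex (fun w => (X w, Y w)) f = Ex X (fun s => Ex Y (fun t => f (s, t))).
Proof.
move=> IJ hX hY.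
rewrite (Ex_bind (Y := fun t w => (t, Y w)) f IJ hX); last first.
  by move=> t _; exact: (dm_comp (fun s => (t, s))).
by apply: eq_ESum => t; rewrite (Ex_comp (fun s => (t, s)) f hY).
Qed.

Lemma Ex_mull (T : countType) (X : O -> T) c f : Ex X (fun t => c * f t) = c * Ex X f.
Proof. by rewrite -ESum_mull; apply: eq_ESum => t; rewrite mulrCA. Qed.

Lemma Ex1 I (T : countType) (X : O -> T) : dm I X -> Ex X (fun=> 1) = 1.
Proof.
move=> hX; rewrite -[RHS]prT -[setT]/[set w | (fun=> True) (X w)] (pr_dm _ hX).
by apply: eq_ESum => t; rewrite asboolT.
Qed.

Lemma dm_U (i : idx) (T : countType) (g : R -> T) :
  (forall t, measurable (g @^-1` [set t])) -> dm [set i] (fun w => g (U i.1 i.2 w)).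
Proof. by move=> mg t; exact: (@sig_U _ i (g @^-1` [set t])). Qed.

Lemma pr_U (i : idx) A : measurable A ->
  enn_val (pr (U i.1 i.2 @^-1` A)) = lebesgue_measure (A `&` `[0%R, 1%R]).
Proof.
move=> mA; have := iid.2 [:: i] (fun=> A); rewrite big_seq1 => <- //.
rewrite /=; congr (P _); apply/seteqP; split => [w Aw j /=|w /(_ i) /=].
  by rewrite inE => /eqP ->.
by rewrite inE eqxx; exact.
Qed.

(** * Inverse-CDF sampling on a countable type *)

Section Dsample.
Variables (T : countType) (pi : T -> R).
Hypotheses (pi0 : forall t, 0 <= pi t) (pi1 : (enn_val (ESum (fun t => toE (pi t))) <= 1)%E).

Lemma dweight_ge0 n : 0 <= dweight pi n.
Proof. by rewrite /dweight; case: pickle_inv. Qed.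

Lemma dcumS n : dcum pi n.+1 = dcum pi n + dweight pi n.
Proof. by rewrite /dcum big_ord_recr. Qed.

Lemma dcum_le m n : (m <= n)%N -> dcum pi m <= dcum pi n.
Proof.
move=> /subnK <-; elim: (n - m)%N => // k IH.
by rewrite addSn dcumS (le_trans IH)// lerDl dweight_ge0.
Qed.

Lemma dcum_ge0 n : 0 <= dcum pi n.
Proof. by rewrite -[0](_ : dcum pi 0 = 0) ?dcum_le// /dcum big_ord0. Qed.

Lemma dcum_le1 n : dcum pi n <= 1.
Proof.
rewrite -lee_fin; apply: le_trans pi1.
have -> : (dcum pi n)%:E = (\sum_(i < n) (dweight pi i)%:E)%E by rewrite sumEFin.
pose F (n : nat) : ennr R := toE (dweight pi n).
apply: (@le_trans _ _ (enn_val (ESum F))).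
  rewrite ESum_val -nneseries_esumT; last by move=> k; exact: enn_ge0.
  rewrite -(big_mkord xpredT (fun i => (dweight pi i)%:E)).
  rewrite (eq_bigr (fun i => enn_val (F i))); last by move=> i _; rewrite toE_val ?dweight_ge0.
  by apply: nneseries_lim_ge => k _ _; exact: enn_ge0.
rewrite le_eqVlt; apply/orP; left; apply/eqP => /=.
transitivity (\esum_(k in (@pickle T) @` setT) enn_val (F k)).
  rewrite [RHS]esum_mkcond; apply: eq_esum => k _; case: ifPn => //.
  rewrite notin_setE /F /dweight; case e : pickle_inv => [t|]; last by rewrite /= maxxx.
  move=> h; exfalso; apply: h; exists t => //.
  by have := @pickle_invK T k; rewrite /oapp e.
rewrite esum_image; last by move=> s t _ _; exact: (pcan_inj pickleK).
by apply: eq_esum => t _; rewrite /F /dweight pickleK_inv.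
Qed.

Lemma dsampleE u t : (dsample pi u = Some t) <->
  (dcum pi (pickle t) <= u < dcum pi (pickle t).+1).
Proof.
have uni m n : dcum pi m <= u < dcum pi m.+1 -> dcum pi n <= u < dcum pi n.+1 -> m = n.
  move=> /andP[m1 m2] /andP[n1 n2]; apply/eqP; rewrite eqn_leq; apply/andP; split.
    by rewrite leqNgt; apply/negP => /dcum_le h; have := lt_le_trans n2 (le_trans h m1); rewrite ltxx.
  by rewrite leqNgt; apply/negP => /dcum_le h; have := lt_le_trans m2 (le_trans h n1); rewrite ltxx.
rewrite /dsample; case: pselect => [H|H]; last first.
  by split => // h; exfalso; apply: H; exists (pickle t).
case: (cid H) => n hn /=; split.
  move=> e; suff -> : pickle t = n by [].
  by have := @pickle_invK T n; rewrite /oapp e.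
by move=> /(uni _ _ hn) ->; rewrite pickleK_inv.
Qed.

Lemma dsample_fiber t : dsample pi @^-1` [set Some t] =
  `[dcum pi (pickle t), dcum pi (pickle t).+1[%classic.
Proof.
by apply/seteqP; split => u /=; rewrite in_itv /= => /dsampleE.
Qed.

Lemma measurable_dsample o : measurable (dsample pi @^-1` [set o]).
Proof.
have mS t : measurable (dsample pi @^-1` [set Some t]).
  by rewrite dsample_fiber; exact: measurable_itv.
case: o => [t|]; first exact: mS.
have -> : dsample pi @^-1` [set None] = ~` \bigcup_n (if @pickle_inv T n is Some t then
    dsample pi @^-1` [set Some t] else set0).
  apply/seteqP; split => [u /= e [n _]|u /=].
    by case: pickle_inv => //= t; rewrite e.
  case e : dsample => [t|//] h; exfalso; apply: h; exists (pickle t) => //=.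
  by rewrite pickleK_inv.
by apply: measurableC; apply: bigcupT_measurable => n; case: pickle_inv.
Qed.

Lemma dm_dsample (i : idx) : dm [set i] (fun w => dsample pi (U i.1 i.2 w)).
Proof. apply: dm_U; exact: measurable_dsample. Qed.

(** The fibre is an interval of length [pi t], and total mass at most 1 keeps it inside the unit
    interval, where the uniform law is Lebesgue measure. *)
Lemma pr_dsample (i : idx) t :
  pr ((fun w => dsample pi (U i.1 i.2 w)) @^-1` [set Some t]) = toE (pi t).
Proof.
apply: enn_eq; rewrite -[X in pr X]/(U i.1 i.2 @^-1` (dsample pi @^-1` [set Some t])).
rewrite pr_U; last exact: measurable_dsample.
rewrite dsample_fiber toE_val//.
have -> : (`[dcum pi (pickle t), dcum pi (pickle t).+1[ `&` `[0%R, 1%R])%classic =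
    `[dcum pi (pickle t), dcum pi (pickle t).+1[%classic.
  apply/seteqP; split => [u []|u] //= h; split => //; move: h; rewrite !in_itv /=.
  move=> /andP[h1 h2]; rewrite (le_trans (dcum_ge0 _) h1)/=.
  exact: le_trans (ltW h2) (dcum_le1 _).
rewrite lebesgue_measure_itv /= lte_fin dcumS /dweight pickleK_inv.
rewrite ltrDl; case: ifP => h; first by rewrite -EFinB addrC addKr.
by congr EFin; apply/eqP; rewrite eq_le pi0 /= leNgt h.
Qed.

(** The probabilities of all outcomes add up to 1; if the proper outcomes already use up the mass 1,
    it can be cancelled. *)
Lemma pr_dsample_None (i : idx) : enn_val (ESum (fun t => toE (pi t))) = 1%E ->
  pr ((fun w => dsample pi (U i.1 i.2 w)) @^-1` [set None]) = 0.
Proof.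
move=> e1; have := Ex1 (dm_dsample (i := i)); rewrite /Ex ESum_option.
under eq_ESum => t do rewrite pr_dsample mulr1.
move/(congr1 (@enn_val R)); rewrite enn_valD mulr1 e1 enn_val1 => h.
apply: (@enn_addIr _ 1); first by rewrite enn_val1 ltry.
by apply: enn_eq; rewrite !enn_valD h enn_val0 add0e.
Qed.

Lemma Ex_dsample (i : idx) f :
  f None = 0 \/ enn_val (ESum (fun t => toE (pi t))) = 1%E ->
  Ex (fun w => dsample pi (U i.1 i.2 w)) f = ESum (fun t => toE (pi t) * f (Some t)).
Proof.
move=> h; rewrite /Ex ESum_option.
under eq_ESum => t do rewrite pr_dsample.
case: h => [->|/(pr_dsample_None i) ->]; first by rewrite mulr0 add0r.
by rewrite mul0r add0r.
Qed.

End Dsample.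

(** * Random trees, generation by generation *)

Section Convolution.
Variable A : countType.
Local Notation Fn := ((seq A -> ennr R) -> ennr R).

(* Integration of [f] over the concatenation of independent random lists with laws [Gs]. *)
Fixpoint convl (Gs : seq Fn) (f : seq A -> ennr R) : ennr R :=
  if Gs is G :: Gs' then G (fun l => convl Gs' (fun l' => f (l ++ l'))) else f [::].

(** [None] is absorbing: a search that fails in one branch fails for the whole tree, and [oapp f 0]
    then contributes 0. *)
Definition ocat (x y : option (seq A)) : option (seq A) :=
  if x is Some l then (if y is Some l' then Some (l ++ l') else None) else None.

Definition oflat (s : seq (option (seq A))) : option (seq A) := foldr ocat (Some [::]) s.

Lemma oflat_Some (C : Type) (F : C -> seq A) (s : seq C) :
  oflat [seq Some (F c) | c <- s] = Some (flatten [seq F c | c <- s]).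
Proof. by elim: s => //= c s ->. Qed.

Lemma dm_flatten (C : eqType) I (cs : seq C) (Y : C -> O -> seq A) :
  (forall c, c \in cs -> dm I (Y c)) -> dm I (fun om => flatten [seq Y c om | c <- cs]).
Proof.
elim: cs => [|c cs IH] h /=; first exact: dm_cst.
apply: (dm_comp (fun q => q.1 ++ q.2) (X := fun om => (Y c om, flatten [seq Y c om | c <- cs]))).
apply: dm_pair; first by apply: h; rewrite mem_head.
by apply: IH => c' c'cs; apply: h; rewrite inE c'cs orbT.
Qed.

Lemma dm_oflat (C : eqType) I (cs : seq C) (Y : C -> O -> option (seq A)) :
  (forall c, c \in cs -> dm I (Y c)) -> dm I (fun om => oflat [seq Y c om | c <- cs]).
Proof.
elim: cs => [|c cs IH] h /=; first exact: dm_cst.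
apply: (dm_comp (fun q => ocat q.1 q.2) (X := fun om => (Y c om, oflat [seq Y c om | c <- cs]))).
apply: dm_pair; first by apply: h; rewrite mem_head.
by apply: IH => c' c'cs; apply: h; rewrite inE c'cs orbT.
Qed.

(** Each list reads its own block of uniforms, so the first is independent of the concatenation of
    the others and can be integrated separately. *)
Lemma Ex_oflat (C : eqType) (I : C -> set idx) (cs : seq C) (Y : C -> O -> option (seq A))
    (G : C -> Fn) f : uniq cs ->
  (forall c c', c \in cs -> c' \in cs -> c != c' -> forall i, I c i -> ~ I c' i) ->
  (forall c, c \in cs -> dm (I c) (Y c)) ->
  (forall c g, c \in cs -> Ex (Y c) (oapp g 0) = G c g) ->
  Ex (fun om => oflat [seq Y c om | c <- cs]) (oapp f 0) = convl [seq G c | c <- cs] f.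
Proof.
elim: cs f => [|c cs IH] f /=; first by rewrite Ex_cst.
move=> /andP[ccs ucs] dis hY hG.
pose Z om := oflat [seq Y c om | c <- cs].
have cin : c \in c :: cs by rewrite mem_head.
have hin c' : c' \in cs -> c' \in c :: cs by rewrite inE => ->; rewrite orbT.
have dZ : dm [set i | exists c', c' \in cs /\ I c' i] Z.
  by apply: dm_oflat => c' c'cs; apply: dmS (hY _ (hin _ c'cs)) => i ?; exists c'.
have dis' i : I c i -> ~ [set i | exists c', c' \in cs /\ I c' i] i.
  move=> Ici [c' [c'cs Ic'i]]; apply: (dis c c' _ _ _ i) => //; first exact: hin.
  by apply: contraNneq ccs => ->.
have dP : dm setT (fun om => (Y c om, Z om)).
  by apply: dm_pair; [apply: dmS (hY _ cin)|apply: dmS dZ].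
rewrite (Ex_comp (fun q => ocat q.1 q.2) _ dP) (Ex_pair _ dis' (hY _ cin) dZ) /=.
rewrite -(hG c) //; apply: eq_ESum => -[l|]; congr (_ * _) => /=.
  rewrite -IH //.
  - by apply: eq_ESum => -[l'|].
  - by move=> c1 c2 /hin ? /hin ?; exact: dis.
  - by move=> c' /hin; exact: hY.
  - by move=> c' g /hin; exact: hG.
rewrite -[RHS](ESum0 _ (option (seq A))); apply: eq_ESum => l'; exact: mulr0.
Qed.

End Convolution.

(** [F] treats the distinguished child at position [i], which is blue or leads to the target, and
    [G] its siblings. *)
Fixpoint slot (A B : Type) (F G : A -> B) (i : nat) (s : seq A) {struct s} : seq B :=
  if s is x :: s' then
    if i is i'.+1 then G x :: slot F G i' s' else F x :: map G s'
  else [::].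

Lemma map_slot (A B C : Type) (g : B -> C) (F G : A -> B) i s :
  map g (slot F G i s) = slot (g \o F) (g \o G) i s.
Proof.
elim: s i => //= x s IH [|i] /=; last by rewrite IH.
by rewrite -map_comp.
Qed.

Lemma slot_map (A B C : Type) (g : C -> A) (F G : A -> B) i s :
  slot F G i (map g s) = slot (F \o g) (G \o g) i s.
Proof.
elim: s i => //= x s IH [|i] /=; last by rewrite IH.
by rewrite -map_comp.
Qed.

Lemma slot_uniq (A : eqType) (B : Type) (F G : A -> B) i x0 s : uniq s -> (i < size s)%N ->
  slot F G i s = [seq (if x == nth x0 s i then F x else G x) | x <- s].
Proof.
elim: s i => //= x s IH [|i] /= /andP[xs us] si.
  rewrite eqxx; congr (_ :: _); apply/eq_in_map => y ys.
  by case: eqP => // yx; rewrite -yx ys in xs.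
rewrite IH //; congr (_ :: _); case: eqP => // xe.
by rewrite xe mem_nth in xs.
Qed.

Section Tree.
Variable S : countType.
Local Notation W := (seq nat).
Local Notation St := (S * bool)%type.

Section Kid.
Variable kid : W -> St -> O -> seq (W * St).

(** The mechanism [kid] stays abstract because the biased tree ([kidb]), the decorated path ([kidd])
    and the recoloured white tree ([kidT]) all pass through the same analysis. The root counts as
    the first of the [n] generations. *)
Fixpoint gen n w (s : St) om : seq (W * St) :=
  if n is n'.+1 then (w, s) :: flatten [seq gen n' c.1 c.2 om | c <- kid w s om] else [::].

Variables (reg : W -> set W) (par : W -> option W) (vld : W -> St -> Prop).

(* The reproduction of [w] uses the variables [Kx w]; the subtree above [w] uses [Cx w] when the
   label of [w] is random and [Ix w] when it is given. The location of [w] belongs to its parent. *)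
Definition Kx w : set idx :=
  [set i | (i.1 = w /\ i.2 <> 0 /\ i.2 <> 2) \/ (par i.1 = Some w /\ i.2 = 2)].
Definition Cx w : set idx := [set i | reg w i.1 /\ i <> (w, 2)].
Definition Ix w : set idx := [set i | Cx w i /\ i <> (w, 0)].

(* The words of the subtree above [w] lie in [reg w]; siblings have disjoint regions, which is
   the branching property. *)
Record reg_ok := RegOk {
  reg_refl : forall w, reg w w;
  reg_par : forall v w, par v = Some w -> reg w v /\ v <> w;
  reg_sub : forall v w u, par v = Some w -> reg v u -> reg w u /\ u <> w;
  reg_disj : forall v v' w u, par v = Some w -> par v' = Some w -> reg v u -> reg v' u ->
    v = v' }.

(** Everything is restricted to valid pairs: on the decorated path the colour must fit the word
    ([vldd]), and [kidd] has the wrong index sets otherwise. *)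
Record kid_ok := KidOk {
  kid_vld : forall w s om c, vld w s -> c \in kid w s om -> vld c.1 c.2;
  kid_par : forall w s om c, vld w s -> c \in kid w s om -> par c.1 = Some w;
  kid_uniq : forall w s om, vld w s -> uniq (unzip1 (kid w s om));
  kid_dm : forall w s, vld w s -> dm (Kx w) (kid w s) }.

Hypotheses (rok : reg_ok) (kok : kid_ok).

(** The only uniform attached to the word [v] that the parent reads is the location [(v, 2)], and
    [Cx v] leaves out exactly this one. *)
Lemma Kx_Cx w v i : par v = Some w -> Kx w i -> ~ Cx v i.
Proof.
case: i => i l pv [[/= -> _] [/= rv _]|[/= pi ->] [/= ri]].
  by have [_] := reg_sub rok pv rv; exact.
by apply; rewrite (reg_disj rok pi pv (reg_refl rok i) ri).
Qed.

Lemma Cx_disj w v v' i : par v = Some w -> par v' = Some w -> v <> v' -> Cx v i -> ~ Cx v' i.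
Proof. by move=> pv pv' vv' [rv _] [rv' _]; apply: vv'; exact: (reg_disj rok pv pv' rv rv'). Qed.

Lemma Cx_Ix w v : par v = Some w -> Cx v `<=` Ix w.
Proof.
move=> pv i [ri _]; have [rw iw] := reg_sub rok pv ri.
by split; [split=> // e|move=> e]; apply: iw; rewrite e.
Qed.

Lemma Kx_Ix w : Kx w `<=` Ix w.
Proof.
move=> [i l] [[/= -> [l0 l2]]|[/= pi ->]].
  by split; [split; [exact: (reg_refl rok)|case]|case].
by have [ri iw] := reg_par rok pi; split; [split => //; case|case].
Qed.

Lemma kid_uniq' w s om : vld w s -> uniq (kid w s om).
Proof. by move=> v; exact: map_uniq (kid_uniq kok om v). Qed.

Lemma kid_neq w s om c c' : vld w s -> c \in kid w s om -> c' \in kid w s om ->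
  c != c' -> c.1 <> c'.1.
Proof.
move=> v cin c'in /eqP cc' e; apply: cc'.
have := kid_uniq kok om v; move: cin c'in.
elim: (kid w s om) => // x r IH; rewrite !inE /= => h1 h2 /andP[h3 /IH h4].
case/orP: h1 => [/eqP h1|h1]; case/orP: h2 => [/eqP h2|h2].
- by rewrite h1 h2.
- by rewrite -h1 e map_f in h3.
- by rewrite -h2 -e map_f in h3.
- exact: h4.
Qed.

Section Marks.
Variables (K : countType) (kap : R -> K).
Hypothesis mkap : forall k, measurable (kap @^-1` [set k]).
Local Notation ityp := (option K * K * St)%type.

(* [kap] sorts the labels into countably many classes. An individual is recorded as (class of the
   predecessor's label, class of its own label, (location, colour)), which is all that a generator
   of the sigma-algebra on forests can see. *)
Fixpoint typed_gen n w a m (s : St) om : seq ityp :=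
  if n is n'.+1 then
    (a, m, s) :: flatten [seq typed_gen n' c.1 (Some m) (kap (U c.1 0 om)) c.2 om | c <- kid w s om]
  else [::].

Definition label_law (f : K -> ennr R) : ennr R := Ex (fun om => kap (U [::] 0 om)) f.

Lemma dm_kap w l : dm [set (w, l)] (fun om => kap (U w l om)).
Proof. exact: (dm_U (i := (w, l))). Qed.

Lemma Ex_kap w l f : Ex (fun om => kap (U w l om)) f = label_law f.
Proof.
apply: eq_ESum => k; congr (_ * _); apply: enn_eq.
rewrite (@pr_U (w, l) (kap @^-1` [set k])) // (@pr_U ([::], 0) (kap @^-1` [set k])) //.
Qed.

Definition TLc n a m s (cs : seq (W * St)) om : seq ityp :=
  (a, m, s) :: flatten [seq typed_gen n c.1 (Some m) (kap (U c.1 0 om)) c.2 om | c <- cs].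

Lemma dm_childx (T : countType) w (Y : K -> O -> T) :
  (forall k, dm (Ix w) (Y k)) -> dm (Cx w) (fun om => Y (kap (U w 0 om)) om).
Proof.
move=> h; apply: (dm_bind (X := fun om => kap (U w 0 om))).
  by apply: dmS (@dm_kap w 0) => i ->; split => //; exact: (reg_refl rok).
by move=> k _; apply: dmS (h k) => i [].
Qed.

Lemma dm_typed_gen n w a m s : vld w s -> dm (Ix w) (typed_gen n w a m s).
Proof.
elim: n w a m s => [|n IH] w a m s v /=; first exact: dm_cst.
apply: (dm_bind (X := kid w s) (Y := TLc n a m s)).
  by apply: dmS (kid_dm kok v); exact: Kx_Ix.
move=> cs [om ocs]; apply: (dm_comp (cons (a, m, s))); apply: dm_flatten => c ccs.
rewrite -ocs in ccs; apply: dmS (Cx_Ix (kid_par kok v ccs)) _.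
apply: (dm_childx (Y := fun k => typed_gen n c.1 (Some m) k c.2)) => k.
exact: IH (kid_vld kok v ccs).
Qed.

Lemma dm_TLc n w a m s om : vld w s -> dm (~` Kx w) (TLc n a m s (kid w s om)).
Proof.
move=> v; apply: (dm_comp (cons (a, m, s))); apply: dm_flatten => c ccs.
apply: (@dmS (Cx c.1)); first by move=> i Ci Ki; exact: Kx_Cx (kid_par kok v ccs) Ki Ci.
apply: (dm_childx (Y := fun k => typed_gen n c.1 (Some m) k c.2)) => k.
exact: dm_typed_gen (kid_vld kok v ccs).
Qed.

Lemma Ex_child (T : countType) w (Y : K -> O -> T) (G : K -> ennr R) g :
  (forall k, dm (Ix w) (Y k)) -> (forall k, Ex (Y k) g = G k) ->
  Ex (fun om => Y (kap (U w 0 om)) om) g = label_law G.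
Proof.
move=> dY hY; rewrite (Ex_bind (J := Ix w) (I := [set (w, 0)])) //.
- by rewrite -(Ex_kap w 0); apply: eq_ESum => k; rewrite hY.
- by move=> i -> [].
- exact: dm_kap.
Qed.

Lemma Ex_kids (cs : seq (W * St)) w s om (Y : W * St -> O -> option (seq ityp)) G f :
  vld w s -> cs = kid w s om ->
  (forall c, c \in cs -> dm (Cx c.1) (Y c)) ->
  (forall c g, c \in cs -> Ex (Y c) (oapp g 0) = G c g) ->
  Ex (fun om => oflat [seq Y c om | c <- cs]) (oapp f 0) = convl [seq G c | c <- cs] f.
Proof.
move=> v ecs dY hG; apply: (Ex_oflat (I := fun c => Cx c.1)) => //.
  by rewrite ecs; exact: kid_uniq'.
move=> c c'; rewrite ecs => cin c'in cc' i; apply: (@Cx_disj w).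
- exact: (kid_par kok v cin).
- exact: (kid_par kok v c'in).
- exact: (kid_neq v cin c'in cc').
Qed.

Variable off : St -> (seq St -> ennr R) -> ennr R.
Hypothesis kid_off : forall w s g, vld w s -> Ex (fun om => map snd (kid w s om)) g = off s g.

(* [off] is the law of the list of children of one individual, as a functional. *)
Fixpoint gen_law n a m s (f : seq ityp -> ennr R) : ennr R :=
  if n is n'.+1 then
    off s (fun ks => convl [seq (fun g => label_law (fun m' => gen_law n' (Some m) m' k g)) | k <- ks]
      (fun l => f ((a, m, s) :: l)))
  else f [::].

Lemma Ex_TLchild n w a s :
  (forall m f, Ex (typed_gen n w a m s) f = gen_law n a m s f) -> vld w s -> forall g,
  Ex (fun om => Some (typed_gen n w a (kap (U w 0 om)) s om)) (oapp g 0) =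
    label_law (fun m' => gen_law n a m' s g).
Proof.
move=> IH v g.
rewrite (Ex_child (Y := fun k om => Some (typed_gen n w a k s om)) (G := fun k => gen_law n a k s g)) //.
  by move=> k; apply: dm_comp; exact: dm_typed_gen.
by move=> k; rewrite (Ex_comp _ _ (dm_typed_gen n _ _ v)) IH.
Qed.

(** The branching property. Conditioning on the children, which depend on [Kx w] only, leaves
    subtrees that read the disjoint blocks [Cx] of the siblings, so they are integrated one after
    the other by [convl]. *)
Theorem Ex_typed_gen n w a m s f : vld w s -> Ex (typed_gen n w a m s) f = gen_law n a m s f.
Proof.
elim: n w a m s f => [|n IH] w a m s f v /=; first by rewrite Ex_cst.
rewrite (Ex_bind (X := kid w s) (I := Kx w) (J := ~` Kx w) (Y := TLc n a m s)); last first.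
- by move=> cs [om <-]; exact: dm_TLc.
- exact: kid_dm.
- by move=> i Ki; apply.
rewrite -(kid_off _ v) (Ex_comp _ _ (kid_dm kok v)).
apply: eq_Ex => om; rewrite -map_comp.
(* [Ex_kids] is phrased for searches that may fail. Here nothing fails, so each subtree is wrapped
   in [Some]. *)
pose Y c om := Some (typed_gen n c.1 (Some m) (kap (U c.1 0 om)) c.2 om).
have dY c : c \in kid w s om -> dm (Cx c.1) (Y c).
  move=> cin; apply: dm_comp; apply: (dm_childx (Y := fun k => typed_gen n c.1 (Some m) k c.2)) => k.
  exact: dm_typed_gen (kid_vld kok v cin).
rewrite -(@Ex_kids (kid w s om) w s om Y _ _ v erefl dY); last first.
  move=> c g cin; rewrite /Y /=; have vc := kid_vld kok v cin.
  by apply: Ex_TLchild => // m' f'; exact: IH.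
pose Z om' := flatten [seq typed_gen n c.1 (Some m) (kap (U c.1 0 om')) c.2 om' | c <- kid w s om].
have dZ : dm setT Z.
  apply: dm_flatten => c cin; apply: (@dmS (Cx c.1)) => //.
  apply: (dm_childx (Y := fun k => typed_gen n c.1 (Some m) k c.2)) => k.
  exact: dm_typed_gen (kid_vld kok v cin).
have -> : (fun om0 => oflat [seq Y c om0 | c <- kid w s om]) = (fun om0 => Some (Z om0)).
  by apply/funext => om0; rewrite /Y oflat_Some.
by rewrite (Ex_comp _ _ dZ) /TLc (Ex_comp (cons (a, m, s)) _ dZ).
Qed.

End Marks.
End Kid.

(* Linear functionals that commute with countable sums, i.e. integrals over countable types. *)
Definition sum_linear (X : Type) (G : (X -> ennr R) -> ennr R) : Prop :=
  forall (T : countType) (c : T -> ennr R) (F : T -> X -> ennr R),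
    G (fun l => ESum (fun t => c t * F t l)) = ESum (fun t => c t * G (F t)).

Lemma sum_linear_mass (X : countType) (g : X -> ennr R) : sum_linear (fun f => ESum (fun x => g x * f x)).
Proof.
move=> T c F; under eq_ESum => x do rewrite -ESum_mull.
rewrite ESum_swap; apply: eq_ESum => t.
by rewrite -ESum_mull; apply: eq_ESum => x; rewrite mulrCA.
Qed.

Lemma sum_linear_comp (X Y : Type) (e : X -> Y) (G : (X -> ennr R) -> ennr R) :
  sum_linear G -> sum_linear (fun f => G (fun x => f (e x))).
Proof. by move=> h T c F; rewrite (h _ c (fun t x => F t (e x))). Qed.

Lemma sum_linear_ESum (X : Type) (T : countType) (c : T -> ennr R) (G : T -> (X -> ennr R) -> ennr R) :
  (forall t, sum_linear (G t)) -> sum_linear (fun f => ESum (fun t => c t * G t f)).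
Proof.
move=> h T' c' F; under eq_ESum => t do rewrite (h t) -ESum_mull.
rewrite ESum_swap; apply: eq_ESum => t.
by rewrite -ESum_mull; apply: eq_ESum => x; rewrite mulrCA.
Qed.

Lemma sum_linear_bind (X Y : Type) (G : (X -> ennr R) -> ennr R) (H : X -> (Y -> ennr R) -> ennr R) :
  sum_linear G -> (forall x, sum_linear (H x)) -> sum_linear (fun f => G (fun x => H x f)).
Proof.
move=> hG hH T c F; have := hG T c (fun t x => H x (F t)); rewrite /= => <-.
by congr G; apply/funext => x; rewrite hH.
Qed.

Lemma sum_linear_eval (X : Type) (x : X) : sum_linear (fun f => f x).
Proof. by []. Qed.

(** Fubini: over a countable type, a sum-linear functional is the sum of its values on indicators of
    points with weights [f y], so the other functional can be moved inside. *)
Lemma sum_linear_swap (X Y : countType) (G : (X -> ennr R) -> ennr R) (H : (Y -> ennr R) -> ennr R)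
    (F : X -> Y -> ennr R) : sum_linear G -> sum_linear H ->
  G (fun x => H (fun y => F x y)) = H (fun y => G (fun x => F x y)).
Proof.
move=> hG hH.
have E (f : Y -> ennr R) : H f = ESum (fun y => f y * H (fun y' => (y == y')%:R)).
  rewrite -hH; congr H; apply/funext => y.
  rewrite -[LHS](ESum_delta y f); apply: eq_ESum => t.
  by rewrite mulrC.
rewrite [RHS]E; under eq_ESum => y do rewrite mulrC.
rewrite -hG; congr G; apply/funext => x; rewrite E.
by apply: eq_ESum => y; rewrite mulrC.
Qed.

(** * Symmetry and multilinearity of [convl] *)

Section ConvlTheory.
Variable A : countType.
Local Notation Fn := ((seq A -> ennr R) -> ennr R).

Lemma convl_cat (Gs Hs : seq Fn) f :
  convl (Gs ++ Hs) f = convl Gs (fun l => convl Hs (fun l' => f (l ++ l'))).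
Proof.
elim: Gs f => [|G Gs IH] f //=; congr G; apply/funext => l; rewrite IH.
by congr convl; apply/funext => l'; congr convl; apply/funext => l''; rewrite catA.
Qed.

Lemma sum_linear_convl (C : Type) (G : C -> Fn) cs : (forall c, sum_linear (G c)) ->
  sum_linear (convl [seq G c | c <- cs]).
Proof.
move=> hG; elim: cs => [|c cs IH] /=; first exact: sum_linear_eval.
apply: sum_linear_bind => // l; exact: (sum_linear_comp (fun l' => l ++ l')).
Qed.

(** Fubini lets two adjacent blocks of factors trade places, which only permutes the list handed to
    [f]; such exchanges generate all permutations. *)
Lemma convl_perm (C : eqType) (G : C -> Fn) f cs cs' : (forall c, sum_linear (G c)) ->
  (forall l l', perm_eq l l' -> f l = f l') -> perm_eq cs cs' ->
  convl [seq G c | c <- cs] f = convl [seq G c | c <- cs'] f.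
Proof.
move=> hG fp cc'.
apply: (@catCA_perm_ind C (fun t => convl [seq G c | c <- cs] f = convl [seq G c | c <- t] f)
  _ cs cs' cc' erefl) => s1 s2 s3 ->.
rewrite !map_cat !convl_cat.
transitivity (convl [seq G c | c <- s1] (fun l1 => convl [seq G c | c <- s2] (fun l2 =>
    convl [seq G c | c <- s3] (fun l3 => f (l1 ++ l2 ++ l3))))).
  by congr convl; apply/funext => l; rewrite convl_cat.
rewrite (@sum_linear_swap _ _ (convl [seq G c | c <- s1]) (convl [seq G c | c <- s2])
  (fun l1 l2 => convl [seq G c | c <- s3] (fun l3 => f (l1 ++ l2 ++ l3)))
  (sum_linear_convl s1 hG) (sum_linear_convl s2 hG)).
congr convl; apply/funext => l2; rewrite convl_cat; congr convl; apply/funext => l1.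
by congr convl; apply/funext => l3; apply: fp; rewrite perm_catCA.
Qed.

(** Agreement on permutation-invariant functions suffices, because fixing some of the concatenated
    lists leaves an invariant function of the remaining ones. *)
Lemma eq_convl_pinv (C : Type) (G H : C -> Fn) f cs :
  (forall c g, (forall l l', perm_eq l l' -> g l = g l') -> G c g = H c g) ->
  (forall l l', perm_eq l l' -> f l = f l') ->
  convl [seq G c | c <- cs] f = convl [seq H c | c <- cs] f.
Proof.
move=> GH; elim: cs f => //= c cs IH f fp; rewrite GH.
  congr (H c); apply/funext => l; apply: IH => l1 l2 l12.
  by apply: fp; rewrite perm_cat2l.
move=> l l' ll'; congr convl; apply/funext => l''.
by apply: fp; rewrite perm_cat2r.
Qed.

(** Linearity of [convl] in one factor. Without [i < size cs] the slot would be empty and the sum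
    would not appear at all. *)
Lemma convl_slot_ESum (C : Type) (T : countType) (c : T -> ennr R) (F : T -> C -> Fn) (G : C -> Fn) i cs f :
  (forall k, sum_linear (G k)) -> (i < size cs)%N ->
  convl (slot (fun k g => ESum (fun t => c t * F t k g)) G i cs) f =
    ESum (fun t => c t * convl (slot (F t) G i cs) f).
Proof.
move=> hG; elim: cs i f => // k cs IH [|i] f //= si.
under eq_fun => l do rewrite IH //.
by rewrite hG.
Qed.

Lemma convl_slot_mul (C : Type) (c : C -> ennr R) (F G : C -> Fn) i x0 cs f :
  (forall k, sum_linear (G k)) -> (i < size cs)%N ->
  convl (slot (fun k g => c k * F k g) G i cs) f = c (nth x0 cs i) * convl (slot F G i cs) f.
Proof.
move=> hG; elim: cs i f => // k cs IH [|i] f //= si.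
under eq_fun => l do rewrite IH //.
(* Sum-linearity over a one-point type is homogeneity. *)
have := hG k unit (fun _ => c (nth x0 cs i)) (fun _ l => convl (slot F G i cs) (fun l' => f (l ++ l'))).
have E1 (u : unit -> ennr R) : ESum u = u tt by rewrite (ESum_single (t0 := tt)) //; case.
by rewrite E1 => <-; congr (G k); apply/funext => l; rewrite E1.
Qed.

End ConvlTheory.

Section Marks.
Variables (K : countType) (kap : R -> K).
Hypothesis mkap : forall k, measurable (kap @^-1` [set k]).
Local Notation ityp := (option K * K * St)%type.
Local Notation label_law := (label_law kap).
Local Notation gen_law := (gen_law kap).

Lemma sum_linear_label_law : sum_linear label_law. Proof. exact: sum_linear_mass. Qed.

Lemma sum_linear_gen_law off n a m s : (forall s, sum_linear (off s)) -> sum_linear (gen_law off n a m s).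
Proof.
move=> ho; elim: n a m s => [|n IH] a m s /=; first exact: sum_linear_eval.
apply: sum_linear_bind => // ks; apply: (sum_linear_comp (cons (a, m, s))).
apply: sum_linear_convl => k; apply: sum_linear_bind => [|m']; [exact: sum_linear_label_law|exact: IH].
Qed.

(** The two offspring laws agree only up to the order of siblings, so [convl_perm] is needed in
    every generation: it shows that what is integrated over the list of children is again
    invariant. *)
Lemma gen_law_pinv off off' n a m s f :
  (forall s, sum_linear (off s)) ->
  (forall s g, (forall l l', perm_eq l l' -> g l = g l') -> off s g = off' s g) ->
  (forall l l', perm_eq l l' -> f l = f l') ->
  gen_law off n a m s f = gen_law off' n a m s f.
Proof.
move=> ho hoo; elim: n a m s f => // n IH a m s f fp /=.
have fp' l l' : perm_eq l l' -> f ((a, m, s) :: l) = f ((a, m, s) :: l').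
  by move=> ll'; apply: fp; rewrite perm_cons.
rewrite hoo; last first.
  move=> l l' ll'; apply: convl_perm => // k; apply: sum_linear_bind; first exact: sum_linear_label_law.
  by move=> m'; exact: sum_linear_gen_law.
congr (off' s); apply/funext => ks; apply: eq_convl_pinv => // k g gp.
by apply: eq_ESum => m'; rewrite IH.
Qed.

End Marks.

Lemma ESum_nat (F : nat -> ennr R) : ESum F = F 0%N + ESum (fun n => F n.+1).
Proof.
rewrite (@ESum_reindex _ _ _ (fun o : option nat => if o is Some n then n.+1 else 0%N)).
  by rewrite ESum_option.
by exists (fun n => if n is n'.+1 then Some n' else None); case.
Qed.

Lemma ESum_seq (T : countType) (F : seq T -> ennr R) :
  ESum F = F [::] + ESum (fun y => ESum (fun ys => F (y :: ys))).
Proof.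
rewrite (@ESum_reindex _ _ _ (fun o : option (T * seq T) => if o is Some q then q.1 :: q.2 else [::])).
  by rewrite ESum_option ESum_pair.
by exists (fun n => if n is x :: s then Some (x, s) else None); [case=> // -[]|case].
Qed.

Lemma ESum_nth (T : Type) (x0 : T) (s : seq T) (F : T -> ennr R) :
  ESum (fun i => (i < size s)%N%:R * F (nth x0 s i)) = \sum_(x <- s) F x.
Proof.
elim: s => [|x s IH].
  by rewrite big_nil -[RHS](ESum0 _ nat); apply: eq_ESum => i; rewrite mul0r.
by rewrite big_cons -IH ESum_nat /= mul1r.
Qed.

(** * The offspring laws of the three trees *)

Section Model.
Variables (p : S -> S -> R) (d : S -> nat -> R) (B : seq S).
Hypotheses (hp : stochastic p) (hd : offspring_laws d).

Definition pE z y : ennr R := toE (p z y).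
Definition dE z n : ennr R := toE (d z n).
Definition pathE z (ys : seq S) : ennr R := \prod_(y <- ys) pE z y.
Definition wt z (ys : seq S) : ennr R := dE z (size ys) * pathE z ys.
Definition mE z : ennr R := ESum (fun n => n%:R * dE z n).

Lemma p_ge0 z y : 0 <= p z y. Proof. by have [h _] := hp z. Qed.
Lemma d_ge0 z n : 0 <= d z n. Proof. by have [h _] := hd z. Qed.

Lemma pE_sum z : ESum (pE z) = 1.
Proof.
apply: enn_eq; rewrite enn_val1 -(hp z).2; apply: eq_esum => y _.
by rewrite toE_val ?p_ge0.
Qed.

Lemma dE_sum z : ESum (dE z) = 1.
Proof.
apply: enn_eq; rewrite enn_val1 -(hd z).2; apply: eq_esum => y _.
by rewrite toE_val ?d_ge0.
Qed.

Lemma enn_natr n : enn_val (n%:R : ennr R) = n%:R%:E.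
Proof.
elim: n => // n IH.
by rewrite -[n.+1]addn1 natrD enn_valD IH natrD EFinD.
Qed.

Lemma toE_nat n : toE n%:R = n%:R :> ennr R.
Proof. by apply: enn_eq; rewrite enn_natr toE_val. Qed.

Lemma mE_mean z : enn_val (mE z) = mean d z.
Proof.
by apply: eq_esum => n _; rewrite enn_valM enn_natr toE_val ?d_ge0.
Qed.

Lemma pathE_toE z ys : toE (\prod_(y <- ys) p z y) = pathE z ys.
Proof.
rewrite /pathE; elim: ys => [|y ys IH]; first by rewrite !big_nil toE1.
rewrite !big_cons toEM ?p_ge0 ?IH //.
by apply: prodr_ge0 => *; exact: p_ge0.
Qed.

(** Integration over [n] independent locations with law [p z], drawn one after the other. *)
Fixpoint LF z n (g : seq S -> ennr R) : ennr R :=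
  if n is n'.+1 then ESum (fun y => pE z y * LF z n' (fun ys => g (y :: ys))) else g [::].

Lemma LF_ESum z n g : LF z n g = ESum (fun ys => (size ys == n)%:R * pathE z ys * g ys).
Proof.
elim: n g => [|n IH] g /=.
  rewrite (@ESum_single _ _ [::]) /pathE ?big_nil ?mul1r //.
  by case=> // y ys _; rewrite /= !mul0r.
rewrite ESum_seq /= !mul0r add0r; apply: eq_ESum => y.
rewrite IH -ESum_mull; apply: eq_ESum => ys.
by rewrite /pathE big_cons eqSS !mulrA; congr (_ * _ * _); rewrite mulrC.
Qed.

Lemma LF1 z n : LF z n (fun=> 1) = 1.
Proof. by elim: n => //= n ->; under eq_ESum do rewrite mulr1; exact: pE_sum. Qed.

Lemma ESum_LF z (c : nat -> ennr R) g :
  ESum (fun n => c n * LF z n g) = ESum (fun ys => c (size ys) * pathE z ys * g ys).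
Proof.
under eq_ESum => n do rewrite LF_ESum -ESum_mull.
rewrite ESum_swap; apply: eq_ESum => ys.
rewrite (@ESum_single _ _ (size ys)) ?eqxx ?mul1r ?mulrA //.
by move=> n; rewrite eq_sym => /negPf ->; rewrite !mul0r mulr0.
Qed.

Lemma ESum_path z (c : nat -> ennr R) : ESum (fun ys => c (size ys) * pathE z ys) = ESum c.
Proof.
have := ESum_LF z c (fun=> 1).
under eq_ESum do rewrite LF1 mulr1.
by under [RHS]eq_ESum do rewrite mulr1.
Qed.

(** A list with a marked position is the same as the list of the other entries, the marked entry and
    the position. The weight ignores the position, hence the factor [(size ys).+1], which is the
    source of the size-biased offspring law. *)
Lemma ESum_insert z (F : seq S -> S -> ennr R) :
  ESum (fun q : seq S * nat => (q.2 < size q.1)%N%:R * wt z q.1 *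
     F (take q.2 q.1 ++ drop q.2.+1 q.1) (nth z q.1 q.2)) =
  ESum (fun ys => ESum (fun y => (size ys).+1%:R * dE z (size ys).+1 * pathE z ys * pE z y * F ys y)).
Proof.
rewrite -(ESum_pair (fun ys i => (i < size ys)%N%:R * wt z ys *
     F (take i ys ++ drop i.+1 ys) (nth z ys i))) ESum_swap.
transitivity (ESum (fun i => ESum (fun q : seq S * S => (i < (size q.1).+1)%N%:R *
    (dE z (size q.1).+1 * pathE z q.1 * pE z q.2 * F q.1 q.2)))).
  apply: eq_ESum => i.
  apply: (@ESum_supp _ _ _ (fun ys => (take i ys ++ drop i.+1 ys, nth z ys i))
    (fun q => take i q.1 ++ q.2 :: drop i q.1) (fun ys => (i < size ys)%N)
    (fun q => (i < (size q.1).+1)%N)) => /=.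
  - move=> ys si; have sti : size (take i ys) = i by rewrite size_takel // ltnW.
    split; first by rewrite size_cat sti ltnS leq_addr.
    rewrite take_size_cat // drop_size_cat // -[in RHS](cat_take_drop i ys).
    by rewrite -(drop_nth z).
  - move=> [ys y] /=; rewrite ltnS => si; have sti : size (take i ys) = i by rewrite size_takel.
    split; first by rewrite size_cat /= sti addnS ltnS leq_addr.
    rewrite take_size_cat // nth_cat sti ltnn subnn /= drop_cat sti.
    by rewrite ltnNge leqnSn /= subSnn /= drop0 cat_take_drop.
  - move=> ys si; have sti : size (take i ys) = i by rewrite size_takel // ltnW.
    have sz : (size (take i ys ++ drop i.+1 ys)).+1 = size ys.
      by rewrite size_cat sti size_drop -addnS subnSK // subnKC // ltnW.
    rewrite sz si !mul1r /wt; congr (_ * _); rewrite -!mulrA; congr (_ * _).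
    rewrite /pathE -[in LHS](cat_take_drop i ys) (drop_nth z) // !big_cat big_cons /=.
    by rewrite -!mulrA; congr (_ * _); rewrite mulrC.
  - by move=> ys /negPf ->; rewrite !mul0r.
  - by move=> q /negPf ->; rewrite !mul0r.
rewrite ESum_swap -(ESum_pair (fun ys y => ESum (fun i => (i < (size ys).+1)%N%:R *
    (dE z (size ys).+1 * pathE z ys * pE z y * F ys y)))).
apply: eq_ESum => ys; apply: eq_ESum => y; rewrite ESum_mulr !mulrA.
do 4![congr (_ * _)].
(* Counts the possible positions of the marked entry. *)
have := @ESum_nth nat 0%N (iota 0 (size ys).+1) (fun=> 1).
rewrite size_iota; under eq_ESum do rewrite mulr1; move=> ->.
by rewrite big_const_seq count_predT size_iota iter_addr addr0.
Qed.

Definition wkid (w : W) z om : seq (W * St) :=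
  [seq (rcons w j, (child_loc p U w j z om, false)) |
    j <- iota 0 (odflt 0%N (dsample (d z) (U w 1 om)))].

Lemma pE_le1 z : (enn_val (ESum (fun y => toE (p z y))) <= 1)%E.
Proof. by rewrite (pE_sum z). Qed.
Lemma dE_le1 z : (enn_val (ESum (fun y => toE (d z y))) <= 1)%E.
Proof. by rewrite (dE_sum z). Qed.

Lemma dm_loc w j z : dm [set (rcons w j, 2)] (child_loc p U w j z).
Proof.
apply: (dm_comp (odflt z)).
exact: (@dm_dsample _ (p z) (p_ge0 z) (rcons w j, 2)).
Qed.

Lemma Ex_loc w j z g : Ex (child_loc p U w j z) g = ESum (fun y => pE z y * g y).
Proof.
rewrite (Ex_comp (odflt z) _ (@dm_dsample _ (p z) (p_ge0 z) (rcons w j, 2))).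
rewrite (Ex_dsample (p_ge0 z) (pE_le1 z) (rcons w j, 2)) //.
by right; rewrite (pE_sum z).
Qed.

Definition locs w z i n om : seq S := [seq child_loc p U w j z om | j <- iota i n].

Lemma dm_locs w z i n : dm [set x | exists j, x = (rcons w j, 2) /\ (i <= j)%N] (locs w z i n).
Proof.
elim: n i => [|n IH] i; first exact: dm_cst.
apply: (dm_comp (fun q => q.1 :: q.2) (X := fun om => (child_loc p U w i z om, locs w z i.+1 n om))).
apply: dm_pair; first by apply: dmS (@dm_loc w i z) => x ->; exists i.
by apply: dmS (IH i.+1) => x [j [-> ij]]; exists j; split => //; exact: ltnW.
Qed.

Lemma Ex_locs w z i n g : Ex (locs w z i n) g = LF z n g.
Proof.
elim: n i g => [|n IH] i g; first by rewrite Ex_cst.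
have dl := @dm_locs w z i.+1 n; have dc := @dm_loc w i z.
rewrite (Ex_comp (fun q => q.1 :: q.2) (X := fun om => (child_loc p U w i z om, locs w z i.+1 n om)) g
  (I := setT)); last by apply: dm_pair; [apply: dmS dc|apply: dmS dl].
rewrite (Ex_pair _ _ dc dl); last first.
  by move=> x -> [j [[/rcons_inj [<-]]]]; rewrite ltnn.
by rewrite Ex_loc /=; apply: eq_ESum => y; rewrite IH.
Qed.

Definition Kw (w : W) : set idx :=
  [set i | i = (w, 1) \/ exists j, i = (rcons w j, 2)].

Lemma rcons_neq (w : W) j : rcons w j <> w.
Proof. by move/(congr1 size); rewrite size_rcons => /esym /n_Sn. Qed.

Lemma Ex_Nlocs (N : O -> nat) w z g (c : nat -> ennr R) :
  dm [set (w, 1)] N -> (forall f, Ex N f = ESum (fun n => c n * f n)) ->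
  dm (Kw w) (fun om => locs w z 0 (N om) om) /\
  Ex (fun om => locs w z 0 (N om) om) g = ESum (fun ys => c (size ys) * pathE z ys * g ys).
Proof.
move=> dN eN.
have dl n : dm [set x | exists j, x = (rcons w j, 2) /\ (0 <= j)%N] (locs w z 0 n) by exact: dm_locs.
split.
  apply: (dm_bind (X := N)); first by apply: dmS dN => i ->; left.
  by move=> n _; apply: dmS (dl n) => i [j [-> _]]; right; exists j.
rewrite (Ex_bind _ _ dN (fun n _ => dl n)); last first.
  by move=> i -> [j [[e _] _]]; exact: (@rcons_neq w j).
by rewrite eN -ESum_LF; apply: eq_ESum => n; rewrite Ex_locs.
Qed.

Lemma dm_wN w z : dm [set (w, 1)] (fun om => odflt 0%N (dsample (d z) (U w 1 om))).
Proof.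
apply: (dm_comp (odflt 0%N)).
exact: (@dm_dsample _ (d z) (d_ge0 z) (w, 1)).
Qed.

Lemma Ex_wN w z f : Ex (fun om => odflt 0%N (dsample (d z) (U w 1 om))) f =
  ESum (fun n => dE z n * f n).
Proof.
rewrite (Ex_comp (odflt 0%N) _ (@dm_dsample _ (d z) (d_ge0 z) (w, 1))).
rewrite (Ex_dsample (d_ge0 z) (dE_le1 z) (w, 1)) //.
by right; rewrite (dE_sum z).
Qed.

Definition offw z (g : seq St -> ennr R) : ennr R :=
  ESum (fun ys => wt z ys * g [seq (y, false) | y <- ys]).

Lemma wkid_zip w z om : wkid w z om =
  (let k := locs w z 0 (odflt 0%N (dsample (d z) (U w 1 om))) om in
   [seq (rcons w x.1, (x.2, false)) | x <- zip (iota 0 (size k)) k]).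
Proof.
rewrite /= /wkid /locs size_map size_iota.
by elim: (iota 0 _) => //= j s ->.
Qed.

Lemma dm_wkid w z : dm (Kw w) (wkid w z).
Proof.
have [h _] := @Ex_Nlocs _ w z (fun=> 0) _ (dm_wN z) (Ex_wN w z).
have -> : wkid w z = fun om => (fun k => [seq (rcons w x.1, (x.2, false)) | x <- zip (iota 0 (size k)) k])
   (locs w z 0 (odflt 0%N (dsample (d z) (U w 1 om))) om).
  by apply/funext => om; rewrite wkid_zip.
exact: (dm_comp (fun k => [seq (rcons w x.1, (x.2, false)) | x <- zip (iota 0 (size k)) k]) h).
Qed.

Lemma wkid_snd w z om : map snd (wkid w z om) =
  [seq (y, false) | y <- locs w z 0 (odflt 0%N (dsample (d z) (U w 1 om))) om].
Proof. by rewrite /wkid /locs -!map_comp; exact: eq_map. Qed.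

Lemma Ex_wkid w z g : Ex (fun om => map snd (wkid w z om)) g = offw z g.
Proof.
have [h1 h2] := @Ex_Nlocs _ w z (fun ys => g [seq (y, false) | y <- ys]) _ (dm_wN z) (Ex_wN w z).
have -> : (fun om => map snd (wkid w z om)) = (fun om => [seq (y, false) |
    y <- locs w z 0 (odflt 0%N (dsample (d z) (U w 1 om))) om]).
  by apply/funext => om; exact: wkid_snd.
by rewrite (Ex_comp (fun ys => [seq (y, false) | y <- ys]) g h1) h2.
Qed.

Lemma sum_linear_offw z : sum_linear (offw z).
Proof. by apply: sum_linear_ESum => ys; exact: sum_linear_eval. Qed.

Lemma sum_linear_ESumw (X : Type) (T : countType) (c : T -> ennr R) (e : T -> X) :
  sum_linear (fun f : X -> ennr R => ESum (fun t => c t * f (e t))).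
Proof. by apply: sum_linear_ESum => t; exact: sum_linear_eval. Qed.

Lemma slot_iota (A C : Type) (F G : A -> C) i x0 s :
  [seq (if j == i then F (nth x0 s j) else G (nth x0 s j)) | j <- iota 0 (size s)] = slot F G i s.
Proof.
elim: s i => //= x s IH [|i] /=.
  congr (_ :: _); rewrite (iotaDl 1 0) -map_comp.
  rewrite -[in RHS](@mkseq_nth _ x0 s) /mkseq -map_comp; exact: eq_map.
congr (_ :: _); rewrite -IH (iotaDl 1 0) -map_comp; exact: eq_map.
Qed.

(* Suffix [b]: the biased BMC, where the word of a child extends that of its parent. *)
Definition parb (v : W) : option W := if (size v <= 1)%N then None else Some (take (size v).-1 v).
Definition regb (w : W) : set W := [set v | prefix w v].
Definition vldb (w : W) (s : St) : Prop := w <> [::].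

Lemma parb_rcons w j : w <> [::] -> parb (rcons w j) = Some w.
Proof.
move=> w0; rewrite /parb size_rcons ltnS leqn0 size_eq0.
by case: eqP => // _; rewrite -cats1 /= take_size_cat.
Qed.

Lemma parbP v w : parb v = Some w -> w <> [::] /\ exists j, v = rcons w j.
Proof.
rewrite /parb; case: leqP => // sv [<-].
case/lastP: v sv => // v j; rewrite size_rcons ltnS => sv.
rewrite -cats1 take_size_cat //; split; last by exists j; rewrite cats1.
by move=> v0; rewrite v0 in sv.
Qed.

Lemma prefix_rcons_inj (w u : W) j j' :
  prefix (rcons w j) u -> prefix (rcons w j') u -> j = j'.
Proof.
rewrite -!cats1 => /prefixP[u1 ->] /prefixP[u2]; rewrite -!catA => /eqP.
by rewrite eqseq_cat // eqxx /= => /eqP [].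
Qed.

Lemma regb_ok : reg_ok regb parb.
Proof.
split.
- by move=> w; exact: prefix_refl.
- by move=> v w /parbP[_ [j ->]]; split; [exact: prefix_rcons|exact: rcons_neq].
- move=> v w u /parbP[_ [j ->]] /= ru; split.
    by apply: prefix_trans ru; exact: prefix_rcons.
  by move=> uw; move/size_prefix: ru; rewrite uw size_rcons ltnn.
- move=> v v' w u /parbP[_ [j ->]] /parbP[_ [j' ->]] r r'.
  by rewrite (prefix_rcons_inj r r').
Qed.

Lemma Kw_Kxb w : w <> [::] -> Kw w `<=` Kx parb w.
Proof.
move=> w0 i [->|[j ->]]; first by left.
by right => /=; split => //; exact: parb_rcons.
Qed.

(* Probability that the descendant with address [u] of an individual at [z] belongs to H_B. *)
Fixpoint hu (u : W) (z : S) : ennr R :=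
  match u with
  | [::] => (z \in B)%:R
  | i :: u' => if z \in B then 0 else
      ESum (fun ys => wt z ys * ((i < size ys)%N%:R * hu u' (nth z ys i)))
  end.

(** The first letter of a nonempty address selects a child, and the rest is an address in the
    subtree of this child. *)
Lemma hu_harm z : z \notin B -> ESum (fun u => hu u z) =
  ESum (fun ys => wt z ys * \sum_(y <- ys) ESum (fun u => hu u y)).
Proof.
move=> zB; rewrite [LHS]ESum_seq /= (negPf zB) add0r.
under eq_ESum => i do rewrite ESum_swap.
rewrite ESum_swap; apply: eq_ESum => ys; rewrite -(ESum_nth z) -ESum_mull.
by apply: eq_ESum => i; rewrite ESum_mull ESum_mull.
Qed.

Lemma hu_B z : z \in B -> ESum (fun u => hu u z) = 1.
Proof.
move=> zB; rewrite [LHS]ESum_seq /= zB -[RHS]addr0; congr (_ + _).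
rewrite -[RHS](ESum0 _ nat); apply: eq_ESum => i.
by rewrite -[RHS](ESum0 _ W).
Qed.

(** * Offspring laws transformed by [h] *)

Section Hfun.
Variable h : S -> R.
Hypotheses (h_gt0 : forall z, 0 < h z)
  (h_hu : forall z, toE (h z) = ESum (fun u => hu u z))
  (mE_fin : forall z, (enn_val (mE z) < +oo)%E).

Lemma h_harm z : z \notin B ->
  ESum (fun ys => wt z ys * \sum_(y <- ys) toE (h y)) = toE (h z).
Proof.
move=> zB; rewrite h_hu hu_harm //; apply: eq_ESum => ys; congr (_ * _).
by apply: eq_bigr => y _; rewrite h_hu.
Qed.

Definition hE z : ennr R := toE (h z).
Definition hiE z : ennr R := toE (h z)^-1.

Lemma hEK z : hE z * hiE z = 1.
Proof.
rewrite /hE /hiE -toEM ?divff ?toE1 ?gt_eqF //; first exact: ltW.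
by rewrite invr_ge0 ltW.
Qed.

Lemma blue_weight_ge0 z yk : 0 <= blue_weight p d h z yk.
Proof.
rewrite /blue_weight; case: ifP => // _.
apply: divr_ge0; last exact: ltW.
apply: mulr_ge0; last exact: ltW.
apply: mulr_ge0; first exact: d_ge0.
by apply: prodr_ge0 => *; exact: p_ge0.
Qed.

Lemma blue_weightE z yk : toE (blue_weight p d h z yk) =
  (yk.2 < size yk.1)%N%:R * wt z yk.1 * (hE (nth z yk.1 yk.2) * hiE z).
Proof.
rewrite /blue_weight; case: ifP => _; last by rewrite toE0 !mul0r.
have pr0 : 0 <= \prod_(y <- yk.1) p z y by apply: prodr_ge0 => *; exact: p_ge0.
have hi0 : 0 <= (h z)^-1 by rewrite invr_ge0 ltW.
have hz0 : 0 <= h (nth z yk.1 yk.2) by exact: ltW.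
rewrite !toEM ?mulr_ge0 ?d_ge0 // pathE_toE mul1r /wt /dE -/(hE _) -/(hiE _).
by rewrite -!mulrA.
Qed.

(** Harmonicity of [h] off [B] is precisely the statement that the weights of a blue individual have
    total mass 1. *)
Lemma blue_sum z : z \notin B -> ESum (fun yk => toE (blue_weight p d h z yk)) = 1.
Proof.
move=> zB; under eq_ESum => yk do rewrite blue_weightE.
rewrite -(ESum_pair (fun ys i => (i < size ys)%N%:R * wt z ys * (hE (nth z ys i) * hiE z))).
transitivity (hE z * hiE z); last exact: hEK.
rewrite [X in _ = X * _](esym (h_harm zB)) -ESum_mulr; apply: eq_ESum => ys.
rewrite -(ESum_nth z ys (fun y => toE (h y))) -ESum_mull -ESum_mulr.
by apply: eq_ESum => i; set c := _%:R; rewrite /hE; ring.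
Qed.

Definition offb (s : St) (g : seq St -> ennr R) : ennr R :=
  if s.2 && (s.1 \notin B) then
    ESum (fun yk : seq S * nat => toE (blue_weight p d h s.1 yk) *
      g (slot (fun y => (y, true)) (fun y => (y, false)) yk.2 yk.1))
  else offw s.1 g.

Lemma sum_linear_offb s : sum_linear (offb s).
Proof.
rewrite /offb; case: (s.2 && (s.1 \notin B)); last exact: sum_linear_offw.
exact: (sum_linear_ESumw (fun yk => toE (blue_weight p d h s.1 yk))
  (fun yk => slot (fun y => (y, true)) (fun y => (y, false)) yk.2 yk.1)).
Qed.

Definition kidb (w : W) (s : St) om : seq (W * St) :=
  let k := kids p d B h U w s om in
  [seq (rcons w x.1, x.2) | x <- zip (iota 0 (size k)) k].

Lemma kidb_white w s om : s.2 && (s.1 \notin B) = false -> kidb w s om = wkid w s.1 om.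
Proof.
move=> e; rewrite /kidb /kids e /= /wkid size_map size_iota.
by elim: (iota 0 _) => //= j r ->.
Qed.

Lemma kidb_snd w s om : map snd (kidb w s om) = kids p d B h U w s om.
Proof.
rewrite /kidb -map_comp -[RHS](@unzip2_zip _ _ (iota 0 (size (kids p d B h U w s om)))).
  by rewrite /unzip2; exact: eq_map.
by rewrite size_iota.
Qed.

Lemma kidb_fst w s om : unzip1 (kidb w s om) =
  [seq rcons w j | j <- iota 0 (size (kids p d B h U w s om))].
Proof.
rewrite /kidb /unzip1 -map_comp; set k := kids _ _ _ _ _ _ _ _.
rewrite -[in RHS](@unzip1_zip _ _ (iota 0 (size k)) k) ?size_iota //.
by rewrite /unzip1 -map_comp; exact: eq_map.
Qed.

Lemma kidb_onth w s om c : c \in kidb w s om <->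
  exists j, c.1 = rcons w j /\ onth (kids p d B h U w s om) j = Some c.2.
Proof.
rewrite /kidb; set k := kids _ _ _ _ _ _ _ _; split.
  case/mapP => -[j s'] /= jin ->; exists j; split => //=.
  have szz : size (zip (iota 0 (size k)) k) = size k by rewrite size_zip size_iota minnn.
  have [i si e] := nthP (0%N, s) jin; rewrite szz in si.
  move: e; rewrite nth_zip ?size_iota // nth_iota // add0n => -[<- <-].
  by rewrite (onthE k i) (nth_map s).
move=> [j [c1 c2]]; apply/mapP; exists (j, c.2); last by rewrite [c]surjective_pairing c1.
have sj : (j < size k)%N by rewrite ltnNge; apply/negP => /onth_default; rewrite c2.
apply/(nthP (0%N, s)); exists j; first by rewrite size_zip size_iota minnn.
rewrite nth_zip ?size_iota // nth_iota // add0n; congr (_, _).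
by move: c2; rewrite (onthE k j) (nth_map s) // => -[].
Qed.

Lemma dm_kids w s : dm (Kw w) (kids p d B h U w s).
Proof.
case e : (s.2 && (s.1 \notin B)); last first.
  have -> : kids p d B h U w s = fun om => map snd (wkid w s.1 om).
    by apply/funext => om; rewrite -(kidb_white _ _ e) kidb_snd.
  exact: (dm_comp (map snd) (@dm_wkid w s.1)).
have zB : s.1 \notin B by case/andP: e.
apply: (@dmS [set (w, 1)]); first by move=> i ->; left.
rewrite /kids e.
apply: (dm_comp (fun o => match o with Some yk =>
  [seq (nth s.1 yk.1 j, j == yk.2) | j <- iota 0 (size yk.1)] | None => [::] end)
  (X := fun om => dsample (blue_weight p d h s.1) (U w 1 om))).
exact: (@dm_dsample _ _ (blue_weight_ge0 s.1) (w, 1)).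
Qed.

Lemma dm_kidb w s : dm (Kw w) (kidb w s).
Proof.
apply: (dm_comp (fun k => [seq (rcons w x.1, x.2) | x <- zip (iota 0 (size k)) k])
  (X := kids p d B h U w s)).
exact: dm_kids.
Qed.

Lemma kidb_off w s g : Ex (fun om => map snd (kidb w s om)) g = offb s g.
Proof.
rewrite /offb; case e : (s.2 && (s.1 \notin B)); last first.
  rewrite -(Ex_wkid w); apply: Ex_ext => om.
  by rewrite kidb_white.
have zB : s.1 \notin B by case/andP: e.
pose G (o : option (seq S * nat)) : seq St := match o with Some yk =>
    slot (fun y => (y, true)) (fun y => (y, false)) yk.2 yk.1 | None => [::] end.
have -> : (fun om => map snd (kidb w s om)) =
  (fun om => G (dsample (blue_weight p d h s.1) (U w 1 om))).
  apply/funext => om; rewrite kidb_snd /kids e.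
  case: dsample => // yk; rewrite /G -(slot_iota _ _ _ s.1); apply: eq_map => j.
  by case: (j == yk.2).
rewrite (Ex_comp G g (@dm_dsample _ _ (blue_weight_ge0 s.1) (w, 1))).
have le1 : (enn_val (ESum (fun t => toE (blue_weight p d h s.1 t))) <= 1)%E by rewrite blue_sum.
rewrite (Ex_dsample (blue_weight_ge0 s.1) le1 (w, 1)) //.
by right; rewrite blue_sum.
Qed.

Lemma kidb_ok : kid_ok kidb parb vldb.
Proof.
split.
- by move=> w s om c w0 /kidb_onth[j [-> _]]; rewrite /vldb; case: (w).
- by move=> w s om c w0 /kidb_onth[j [-> _]]; exact: parb_rcons.
- move=> w s om _; rewrite kidb_fst map_inj_uniq ?iota_uniq // => i j.
  by move/rcons_inj => [].
- by move=> w s w0; apply: dmS (@dm_kidb w s); exact: Kw_Kxb.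
Qed.

(** Harmonicity in many-to-one form: a sum over families with one distinguished child becomes, by
    [ESum_insert], a sum over the location of a single child weighted by the mean offspring
    number. *)
Lemma ph_harm z : z \notin B -> ESum (fun y => mE z * pE z y * hE y) = hE z.
Proof.
move=> zB; rewrite /hE -(h_harm zB).
transitivity (ESum (fun ys => ESum (fun y => (size ys).+1%:R * dE z (size ys).+1 * pathE z ys * pE z y * hE y))).
  rewrite ESum_swap; apply: eq_ESum => y.
  transitivity (ESum (fun ys => (size ys).+1%:R * dE z (size ys).+1 * pathE z ys) * (pE z y * hE y)).
    rewrite (ESum_path z (fun n => n.+1%:R * dE z n.+1)) -mulrA; congr (_ * _).
    by rewrite /mE ESum_nat mul0r add0r.
  by rewrite -ESum_mulr; apply: eq_ESum => ys; rewrite mulrA.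
rewrite -(ESum_insert z (fun _ y => hE y)).
rewrite -(ESum_pair (fun ys i => (i < size ys)%N%:R * wt z ys * hE (nth z ys i))).
apply: eq_ESum => ys; rewrite -(ESum_nth z ys (fun y => toE (h y))) -ESum_mull.
by apply: eq_ESum => i; rewrite -mulrA mulrCA.
Qed.

Definition mR z : R := fine (mean d z).

Lemma mR_ge0 z : 0 <= mR z.
Proof. by rewrite /mR -mE_mean fine_ge0 // enn_ge0. Qed.

Lemma toE_mR z : toE (mR z) = mE z.
Proof.
apply: enn_eq; rewrite toE_val ?mR_ge0 // /mR -mE_mean fineK //.
by rewrite ge0_fin_numE ?enn_ge0.
Qed.

(** A vanishing mean would force [h z = 0] through [ph_harm]. Division by the mean in the
    size-biased law is therefore legitimate off [B]. *)
Lemma mR_gt0 z : z \notin B -> 0 < mR z.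
Proof.
move=> zB; rewrite lt_neqAle mR_ge0 andbT; apply/eqP => m0.
have := ph_harm zB; rewrite -toE_mR -m0 toE0.
under eq_ESum do rewrite !mul0r.
rewrite ESum0 => /(congr1 (@enn_val R)); rewrite /hE toE_val ?ltW // enn_val0 => -[].
by move=> e; have := h_gt0 z; rewrite -e ltxx.
Qed.

Lemma ph_ge0 z y : 0 <= ph_kernel p d B h z y.
Proof.
rewrite /ph_kernel; case: ifP => // _; apply: divr_ge0; last exact: ltW.
apply: mulr_ge0; last exact: ltW.
rewrite fine_ge0 // /qk mule_ge0 // ?lee_fin ?p_ge0 //.
by rewrite -mE_mean enn_ge0.
Qed.

Lemma phE z y : z \notin B -> toE (ph_kernel p d B h z y) = mE z * pE z y * hE y * hiE z.
Proof.
move=> zB; rewrite /ph_kernel (negPf zB).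
have -> : fine (qk p d z y) = mR z * p z y.
  rewrite /qk /mR -mE_mean fineM //.
  by rewrite ge0_fin_numE ?enn_ge0.
by rewrite !toEM ?toE_mR ?mulr_ge0 ?mR_ge0 ?p_ge0 ?invr_ge0 ?ltW.
Qed.

Lemma ph_sum z : z \notin B -> ESum (fun y => toE (ph_kernel p d B h z y)) = 1.
Proof.
move=> zB; under eq_ESum do rewrite phE //.
by rewrite ESum_mulr ph_harm // hEK.
Qed.

Lemma ph_le1 z : (enn_val (ESum (fun y => toE (ph_kernel p d B h z y))) <= 1)%E.
Proof.
case: (boolP (z \in B)) => zB; last by rewrite ph_sum.
under eq_ESum do rewrite /ph_kernel zB toE0.
by rewrite ESum0.
Qed.

Lemma sb_ge0 z n : 0 <= sb_law d z n.
Proof. by rewrite /sb_law divr_ge0 ?mulr_ge0 ?d_ge0 ?mR_ge0. Qed.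

Lemma sbE z n : toE (sb_law d z n) = n%:R * dE z n * toE (mR z)^-1.
Proof.
by rewrite /sb_law !toEM ?mulr_ge0 ?d_ge0 ?invr_ge0 ?mR_ge0 // toE_nat.
Qed.

Lemma sb_sum z : z \notin B -> ESum (fun n => toE (sb_law d z n)) = 1.
Proof.
move=> zB; under eq_ESum do rewrite sbE.
rewrite ESum_mulr -/(mE z) -toE_mR -toEM ?invr_ge0 ?mR_ge0 // divff ?toE1 //.
by rewrite gt_eqF // mR_gt0.
Qed.

(* Suffix [d]: the decorated path, whose k-th spine individual has word [:: k], so that the
   subtree above it contains all words whose first letter is at least [k]. *)
Definition pard (v : W) : option W :=
  match v with
  | [::] => None
  | [:: k] => if k is k'.+1 then Some [:: k'] else None
  | _ => Some (take (size v).-1 v)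
  end.
Definition regd (w : W) : set W :=
  [set v | if size w == 1%N then v <> [::] /\ (head 0%N w <= head 0%N v)%N else prefix w v].
Definition vldd (w : W) (s : St) : Prop := w <> [::] /\ s.2 = (size w == 1%N).

Lemma pard_big v : (1 < size v)%N -> pard v = Some (take (size v).-1 v).
Proof. by case: v => // a [|b r]. Qed.

Lemma pard_rcons w j : w <> [::] -> pard (rcons w j) = Some w.
Proof.
move=> w0; rewrite pard_big size_rcons; last by case: w w0.
by rewrite /= -cats1 take_size_cat.
Qed.

Lemma pardP v w : pard v = Some w ->
  (exists k, w = [:: k] /\ v = [:: k.+1]) \/ (w <> [::] /\ exists j, v = rcons w j).
Proof.
have [sv|] := ltnP 1 (size v).
  rewrite pard_big //; case/lastP: v sv => // v j; rewrite size_rcons /= => sv [<-]; right.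
  rewrite -cats1 take_size_cat //; split; last by exists j; rewrite cats1.
  by move=> v0; rewrite v0 in sv.
by case: v => // -[|a] [|//] _ // [<-]; left; exists a.
Qed.

Lemma regd_rcons w j u : w <> [::] -> regd (rcons w j) u -> regd w u /\ prefix (rcons w j) u.
Proof.
move=> w0; have sz : size (rcons w j) == 1%N = false.
  by rewrite size_rcons eqSS size_eq0; apply/eqP.
rewrite /regd /= sz => pu; split => //; have pw := prefix_trans (prefix_rcons w j) pu.
case: ifP => // _; case: w w0 {pu sz} pw => // a w _; case: u => // b u /=.
by case: eqP => // ->.
Qed.

Lemma regd_ok : reg_ok regd pard.
Proof.
split.
- case=> [|a [|b r]]; rewrite /regd //=.
  by rewrite !eqxx prefix_refl.
- move=> v w /pardP[[k [-> ->]]|[w0 [j ->]]]; first by split => // -[] /esym /n_Sn.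
  split; last exact: rcons_neq.
  have rr : regd (rcons w j) (rcons w j).
    rewrite /regd /= size_rcons eqSS size_eq0; case: eqP => // _; exact: prefix_refl.
  by have [] := regd_rcons w0 rr.
- move=> v w u /pardP[[k [-> ->]]|[w0 [j ->]]].
    rewrite /regd /= => -[u0 ku]; split; first by split => //; exact: ltnW.
    by move=> uk; rewrite uk ltnn in ku.
  move=> /(regd_rcons w0)[rw pu]; split => // uw.
  by move/size_prefix: pu; rewrite uw size_rcons ltnn.
- move=> v v' w u /pardP[[k [-> ->]]|[w0 [j ->]]] /pardP[[k' [e ->]]|[w0' [j' ->]]].
  + by case: e => ->.
  + move=> [_ /= ku] /(regd_rcons w0')[_]; case: u ku => // a u /= ku.
    by case: eqP => // ka; rewrite -ka ltnn in ku.
  + subst w; move=> /(regd_rcons w0)[_] pu [_ /= ku]; case: u ku pu => // a u /= ku.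
    by case: eqP => // ka; rewrite -ka ltnn in ku.
  + move=> /(regd_rcons w0)[_ pu] /(regd_rcons w0)[_ pu'].
    by rewrite (prefix_rcons_inj pu pu').
Qed.

(** The next spine individual is an extra child listed last; its location is read from variable 3 of
    its parent, so that it is independent of the white siblings. *)
Definition kidd (w : W) (s : St) om : seq (W * St) :=
  if s.2 then
    [seq (rcons w j, (child_loc p U w j s.1 om, false)) |
      j <- iota 0 (spine_nkids d B U (head 0%N w) s.1 om)] ++
    (if dsample (ph_kernel p d B h s.1) (U w 3 om) is Some z' then
       [:: ([:: (head 0%N w).+1], (z', true))] else [::])
  else wkid w s.1 om.

(** On [B] all weights of the kernel vanish, so the sampling intervals are empty and the spine stops
    for every sample point, not just almost surely. *)
Lemma kidd_blueB k z om : z \in B -> kidd [:: k] (z, true) om = wkid [:: k] z om.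
Proof.
move=> zB; rewrite /kidd /= /spine_nkids zB.
case e : (dsample (ph_kernel p d B h z) _) => [z'|]; last by rewrite cats0.
move/(dsampleE (ph_ge0 z)): e; rewrite (dcumS _) /dweight pickleK_inv /ph_kernel zB addr0.
by move=> /andP[a b]; have := le_lt_trans a b; rewrite ltxx.
Qed.

Definition Kd (w : W) : set idx := [set i | Kw w i \/ i = (w, 3)].

Lemma Kd_Kxd w : w <> [::] -> Kd w `<=` Kx pard w.
Proof.
move=> w0 i [[->|[j ->]]|->]; [by left| |by left].
by right => /=; split => //; exact: pard_rcons.
Qed.

Lemma dm_spineN k z : z \notin B -> dm [set ([:: k], 1)] (spine_nkids d B U k z).
Proof.
move=> zB; rewrite /spine_nkids (negPf zB).
apply: (dm_comp (fun o => (odflt 1%N o).-1) (X := fun om => dsample (sb_law d z) (U [:: k] 1 om))).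
exact: (@dm_dsample _ _ (sb_ge0 z) ([:: k], 1)).
Qed.

(** The size-biased law does not charge 0, so removing the spine child from the count is a plain
    shift of the index. *)
Lemma Ex_spineN k z f : z \notin B -> Ex (spine_nkids d B U k z) f =
  ESum (fun n => toE (sb_law d z n.+1) * f n).
Proof.
move=> zB.
pose G o := (odflt 1%N o).-1.
transitivity (Ex (fun om => G (dsample (sb_law d z) (U [:: k] 1 om))) f).
  by apply: Ex_ext => om; rewrite /spine_nkids (negPf zB).
rewrite (Ex_comp G _ (@dm_dsample _ _ (sb_ge0 z) ([:: k], 1))).
have le1 : (enn_val (ESum (fun t => toE (sb_law d z t))) <= 1)%E by rewrite sb_sum.
rewrite (Ex_dsample (sb_ge0 z) le1 ([:: k], 1)) //; last by right; rewrite sb_sum.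
by rewrite [LHS]ESum_nat sbE !mul0r add0r.
Qed.

Definition kdf k (q : seq S * option S) : seq (W * St) :=
  [seq (rcons [:: k] x.1, (x.2, false)) | x <- zip (iota 0 (size q.1)) q.1] ++
    (if q.2 is Some z' then [:: ([:: k.+1], (z', true))] else [::]).

Lemma kidd_blue k z om : kidd [:: k] (z, true) om =
  kdf k (locs [:: k] z 0 (spine_nkids d B U k z om) om, dsample (ph_kernel p d B h z) (U [:: k] 3 om)).
Proof.
rewrite /kidd /kdf /=; congr (_ ++ _); rewrite /locs size_map size_iota.
by elim: (iota 0 _) => //= j s ->.
Qed.

Lemma dm_kidd w s : vldd w s -> dm (Kd w) (kidd w s).
Proof.
case: s => z b [w0 /= ->]; case: eqP => [|_]; last first.
  have -> : kidd w (z, false) = wkid w z by [].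
  by apply: dmS (@dm_wkid w z) => i; left.
case: w w0 => // k [|//] _ _; case: (boolP (z \in B)) => zB.
  have -> : kidd [:: k] (z, true) = wkid [:: k] z by apply/funext => om; exact: kidd_blueB.
  by apply: dmS (@dm_wkid [:: k] z) => i; left.
have -> : kidd [:: k] (z, true) = fun om => kdf k (locs [:: k] z 0 (spine_nkids d B U k z om) om,
    dsample (ph_kernel p d B h z) (U [:: k] 3 om)).
  by apply/funext => om; exact: kidd_blue.
apply: (dm_comp (kdf k)).
have [dl _] := @Ex_Nlocs _ [:: k] z (fun=> 0) _ (dm_spineN zB) (fun f => @Ex_spineN k z f zB).
apply: dm_pair; first by apply: dmS dl => i; left.
by apply: dmS (@dm_dsample _ _ (ph_ge0 z) ([:: k], 3)) => i ->; right.
Qed.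

Definition offd (s : St) (g : seq St -> ennr R) : ennr R :=
  if s.2 && (s.1 \notin B) then
    ESum (fun ys => toE (sb_law d s.1 (size ys).+1) * pathE s.1 ys *
      ESum (fun y => toE (ph_kernel p d B h s.1 y) * g ([seq (y, false) | y <- ys] ++ [:: (y, true)])))
  else offw s.1 g.

Lemma kidd_off w s g : vldd w s -> Ex (fun om => map snd (kidd w s om)) g = offd s g.
Proof.
case: s => z b [w0 /= ->]; rewrite /offd; case: eqP => [|_] /=; last first.
  by rewrite -(Ex_wkid w); apply: Ex_ext.
case: w w0 => // k [|//] _ _; case: (boolP (z \in B)) => zB /=.
  by rewrite -(Ex_wkid [:: k]); apply: Ex_ext => om; rewrite kidd_blueB.
have [dl el] := @Ex_Nlocs _ [:: k] z (fun ys => ESum (fun y => toE (ph_kernel p d B h z y) *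
    g ([seq (y, false) | y <- ys] ++ [:: (y, true)]))) _ (dm_spineN zB) (fun f => @Ex_spineN k z f zB).
rewrite -el {el}.
pose Y q := [seq (y, false) | y <- q.1] ++ (if q.2 is Some z' then [:: (z', true)] else [::] : seq St).
transitivity (Ex (fun om => Y (locs [:: k] z 0 (spine_nkids d B U k z om) om,
   dsample (ph_kernel p d B h z) (U [:: k] 3 om))) g).
  apply: Ex_ext => om; rewrite /kidd /Y /= map_cat /locs -!map_comp; congr (_ ++ _).
  by case: dsample.
have dp := @dm_dsample _ _ (ph_ge0 z) ([:: k], 3).
rewrite (Ex_comp Y _ (I := setT)); last first.
  by apply: dm_pair; [apply: dmS dl|apply: dmS dp].
rewrite (Ex_pair _ _ dl dp); last by move=> i [->|[j ->]] //= [] /eqP.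
apply: eq_Ex => om.
rewrite (Ex_dsample (ph_ge0 z) (ph_le1 z) ([:: k], 3)) //.
by right; rewrite ph_sum.
Qed.

Lemma kidd_mem w s om c : vldd w s -> c \in kidd w s om ->
  (exists j, c.1 = rcons w j /\ c.2.2 = false) \/
  (exists k, w = [:: k] /\ c.1 = [:: k.+1] /\ c.2.2 = true).
Proof.
move=> [w0 sw]; rewrite /kidd; case: ifP => s2.
  rewrite mem_cat => /orP[/mapP[j _ ->]|]; first by left; exists j.
  move: sw; rewrite s2; case: w w0 => // k [|//] _ _.
  by case: dsample => // z'; rewrite inE => /eqP ->; right; exists k.
by move=> /mapP[j _ ->]; left; exists j.
Qed.

Lemma kidd_ok : kid_ok kidd pard vldd.
Proof.
split.
- move=> w s om c v cin; have [w0 sw] := v.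
  have [[j [e1 e2]]|[k [_ [e1 e2]]]] := kidd_mem v cin; rewrite /vldd e1 e2 //.
  split; first by case: (w).
  by rewrite size_rcons eqSS size_eq0; case: eqP.
- move=> w s om c v cin; have [w0 sw] := v.
  have [[j [-> _]]|[k [-> [-> _]]]] := kidd_mem v cin; last by [].
  exact: pard_rcons.
- move=> w s om [w0 sw].
  have uq n : uniq [seq rcons w j | j <- iota 0 n].
    by rewrite map_inj_uniq ?iota_uniq // => i j /rcons_inj [].
  rewrite /kidd; case: ifP => s2; last by rewrite /unzip1 -map_comp; exact: uq.
  rewrite /unzip1 map_cat -map_comp cat_uniq uq /=.
  case: dsample => //= z'; rewrite orbF andbT; apply/mapP => -[j _].
  by case: w w0 {sw uq} => // a w _ /(congr1 size); rewrite /= size_rcons.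
- by move=> w s v; apply: dmS (dm_kidd v); apply: Kd_Kxd; have [] := v.
Qed.

Lemma slot_perm (A C : eqType) (F G : A -> C) i x0 (s : seq A) : (i < size s)%N ->
  perm_eq (slot F G i s) (map G (take i s ++ drop i.+1 s) ++ [:: F (nth x0 s i)]).
Proof.
rewrite cats1 perm_sym perm_rcons; elim: s i => // x s IH [|i] /= si.
  by rewrite drop0 perm_refl.
apply: (@perm_trans _ (G x :: F (nth x0 s i) :: map G (take i s ++ drop i.+1 s))).
  exact: permEl (perm_catCA [:: _] [:: _] _).
by rewrite perm_cons; exact: IH.
Qed.

(* The blue child has a random position in [offb] and is listed last in [offd]: forgetting the
   order, a size-biased number of children with one of them marked is the same as an unbiased
   family weighted by its size. *)
Lemma offb_offd s g : (forall l l', perm_eq l l' -> g l = g l') -> offb s g = offd s g.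
Proof.
move=> gp; rewrite /offb /offd; case e : (s.2 && _) => //.
have /andP[_ zB] := e; set z := s.1.
pose F ys y := hE y * hiE z * g ([seq (y, false) | y <- ys] ++ [:: (y, true)]).
transitivity (ESum (fun q : seq S * nat => (q.2 < size q.1)%N%:R * wt z q.1 *
     F (take q.2 q.1 ++ drop q.2.+1 q.1) (nth z q.1 q.2))).
  apply: eq_ESum => -[ys i]; rewrite blue_weightE /= /F.
  have [si|_] := ltnP i (size ys); last by rewrite !mul0r.
  by rewrite (gp _ _ (slot_perm _ _ z si)) -!mulrA.
rewrite ESum_insert; apply: eq_ESum => ys; rewrite -ESum_mull; apply: eq_ESum => y.
rewrite sbE phE // /F.
(* The mean is a factor of [ph_kernel] and a divisor in [sb_law]; the two cancel. *)
have mi : mE z * toE (mR z)^-1 = 1.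
  by rewrite -toE_mR -toEM ?invr_ge0 ?mR_ge0 // divff ?toE1 // gt_eqF // mR_gt0.
set a := (size ys).+1%:R * _; set b := pathE z ys; set c := pE z y; set e1 := hE y.
set e2 := hiE z; set e3 := g _; set mm := mE z; set im := toE _.
transitivity ((mm * im) * (a * b * c * (e1 * e2 * e3))); first by rewrite mi mul1r.
by ring.
Qed.

Lemma gen_law_biased_deco (K : countType) (kap : R -> K) n a m s f :
  (forall l l', perm_eq l l' -> f l = f l') ->
  gen_law kap offb n a m s f = gen_law kap offd n a m s f.
Proof. by move=> fp; apply: gen_law_pinv => //; [exact: sum_linear_offb|exact: offb_offd]. Qed.

(** * Size biasing one tree *)

(** The search for the individual [w ++ u]: it must exist, lie in [B], and have no predecessor from
    [w] onwards in [B]. *)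
Fixpoint hit (u w : W) (z : S) om : bool :=
  match u with
  | [::] => z \in B
  | i :: u' => (z \notin B) &&
      (if onth (wkid w z om) i is Some c then hit u' c.1 c.2.1 om else false)
  end.

(* The white tree recoloured: blue means being an ancestor of the individual [T]. *)
Definition kidT (T : W) (w : W) (s : St) om : seq (W * St) :=
  [seq (c.1, (c.2.1, prefix c.1 T)) | c <- wkid w s.1 om].

Lemma wkid_mem w z om c : c \in wkid w z om -> exists j, c.1 = rcons w j /\ c.2.2 = false.
Proof. by case/mapP => j _ ->; exists j. Qed.

Lemma prefix_child (w u : W) i j : prefix (rcons w j) (w ++ i :: u) = (j == i).
Proof.
apply/idP/eqP => [pj|->]; last by rewrite -cat_rcons prefix_prefix.
apply: (prefix_rcons_inj pj); by rewrite -cat_rcons prefix_prefix.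
Qed.

Lemma wkid_fst w z om : unzip1 (wkid w z om) =
  [seq rcons w j | j <- iota 0 (size (wkid w z om))].
Proof. by rewrite /wkid /unzip1 -map_comp size_map size_iota. Qed.

Lemma wkid_nth x0 w z om i : (i < size (wkid w z om))%N ->
  (nth x0 (wkid w z om) i).1 = rcons w i.
Proof.
move=> si; rewrite -(nth_map _ [::]) // -/(unzip1 _) wkid_fst (nth_map 0%N) ?size_iota //.
by rewrite nth_iota.
Qed.

Lemma wkid_eq_nth x0 w z om i c : (i < size (wkid w z om))%N -> c \in wkid w z om ->
  forall j, c.1 = rcons w j -> (c == nth x0 (wkid w z om) i) = (j == i).
Proof.
move=> si cin j c1; apply/eqP/eqP => [e|ji].
  by move: c1; rewrite e wkid_nth // => /rcons_inj [].
have sj : (index c (wkid w z om) < size (wkid w z om))%N by rewrite index_mem.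
have e := nth_index x0 cin; rewrite -e.
have := wkid_nth x0 sj; rewrite e c1 => /rcons_inj [e'].
by rewrite -ji e' e.
Qed.

Lemma oflat_None (A : countType) (s : seq (option (seq A))) : None \in s -> oflat s = None.
Proof.
elim: s => // x s IH; rewrite inE => /orP[/eqP <- //|/IH /= ->].
by case: x.
Qed.

Lemma uniq_wkid w z om : uniq (wkid w z om).
Proof.
apply: (@map_uniq _ _ fst); rewrite -/(unzip1 _) wkid_fst map_inj_uniq ?iota_uniq //.
by move=> i j /rcons_inj [].
Qed.

Section Marks.
Variables (K : countType) (kap : R -> K).
Hypothesis mkap : forall k, measurable (kap @^-1` [set k]).
Local Notation ityp := (option K * K * St)%type.
Local Notation label_law := (label_law kap).
Local Notation gen_law := (gen_law kap).
Local Notation typed_gen kid := (typed_gen kid kap).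

(** With no generation left to record the root disappears from the list, although the search for the
    target continues below it. *)
Definition rt n (c : ityp) : seq ityp := if n is _.+1 then [:: c] else [::].

(* The white tree above [w] together with the choice of [w ++ u] as an element of H_B. *)
Definition typed_target n (u w : W) a m z om : option (seq ityp) :=
  if hit u w z om then Some (typed_gen (kidT (w ++ u)) n w a m (z, true) om) else None.

(** Once a word is not a prefix of [T], no extension of it is, so the whole subtree stays white. *)
Lemma typed_gen_kidT_off T n w a m z om : ~~ prefix w T ->
  typed_gen (kidT T) n w a m (z, false) om = typed_gen kidb n w a m (z, false) om.
Proof.
elim: n w a m z => //= n IH w a m z pw; congr (_ :: _).
rewrite kidb_white //= /kidT -map_comp; congr flatten; apply/eq_in_map => c /wkid_mem[j [c1 c2]] /=.
have nj : ~~ prefix c.1 T.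
  by apply: contraNN pw => pj; apply: prefix_trans pj; rewrite c1 prefix_rcons.
by rewrite (negPf nj) IH // [c.2]surjective_pairing c2.
Qed.

(** The target is blue but lies in [B], where blue individuals reproduce like white ones with white
    children; this is how the two colourings meet. *)
Lemma typed_gen_kidT_end n w a m z om : z \in B ->
  typed_gen (kidT w) n w a m (z, true) om = typed_gen kidb n w a m (z, true) om.
Proof.
case: n => // n zB /=; congr (_ :: _); rewrite kidb_white /= ?zB //.
rewrite /kidT -map_comp; congr flatten; apply/eq_in_map => c /wkid_mem[j [c1 c2]] /=.
have nj : ~~ prefix c.1 w.
  by rewrite c1; apply/negP => /size_prefix; rewrite size_rcons ltnn.
by rewrite (negPf nj) typed_gen_kidT_off // [c.2]surjective_pairing c2.
Qed.

Definition Ychild n u m (i : nat) x0 cs (c : W * St) om : option (seq ityp) :=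
  if c == nth x0 cs i then typed_target n u c.1 (Some m) (kap (U c.1 0 om)) c.2.1 om
  else Some (typed_gen kidb n c.1 (Some m) (kap (U c.1 0 om)) c.2 om).

(** Only child [i] carries the search on; its siblings root white trees. The recursive form is what
    conditioning on the children requires. *)
Lemma typed_target_rec n i u w a m z om x0 : z \notin B ->
  typed_target n (i :: u) w a m z om =
  if (i < size (wkid w z om))%N then
    omap (cat (rt n (a, m, (z, true))))
      (oflat [seq Ychild n.-1 u m i x0 (wkid w z om) c om | c <- wkid w z om])
  else None.
Proof.
move=> zB; rewrite /typed_target /= zB /=; set cs := wkid w z om.
have [si|si] := ltnP i (size cs); last by rewrite onth_default.
rewrite (onthE cs i) (nth_map x0) //=; set ci := nth x0 cs i.
have ci_in : ci \in cs by exact: mem_nth.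
have ci1 : ci.1 = rcons w i by exact: wkid_nth.
have eT : ci.1 ++ u = w ++ i :: u by rewrite ci1 cat_rcons.
case: ifPn => hu; last first.
  rewrite oflat_None //; apply/mapP; exists ci => //.
  by rewrite /Ychild eqxx /typed_target (negPf hu).
pose Fl (c : W * St) := typed_gen (kidT (w ++ i :: u)) n.-1 c.1 (Some m) (kap (U c.1 0 om)) (c.2.1, prefix c.1 (w ++ i :: u)) om.
have -> : [seq Ychild n.-1 u m i x0 cs c om | c <- cs] = [seq Some (Fl c) | c <- cs].
  apply/eq_in_map => c cin; rewrite /Ychild /Fl.
  have [j [c1 c2]] := wkid_mem cin.
  rewrite (wkid_eq_nth x0 si cin c1) c1 prefix_child; case: eqP => ji.
    have -> : c = ci by apply/eqP; rewrite (wkid_eq_nth x0 si cin c1) ji.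
    by rewrite /typed_target ji -ci1 hu eT ci1.
  rewrite typed_gen_kidT_off ?c1 ?prefix_child; last by apply/eqP.
  by rewrite -c2 -surjective_pairing.
rewrite oflat_Some /=; congr Some.
case: n @Fl => [|n] Fl /=.
  by rewrite /Fl /=; elim: (cs).
by congr (_ :: _); rewrite /kidT -map_comp.
Qed.

(** The recursion is on the address, while [n.-1] stays at 0 once the recorded generations are
    exhausted. *)
Fixpoint target_law n (u : W) a m z (f : seq ityp -> ennr R) : ennr R :=
  match u with
  | [::] => if z \in B then gen_law offb n a m (z, true) f else 0
  | i :: u' => if z \in B then 0 else
     offw z (fun ks => if (i < size ks)%N then
       convl (slot (fun k g => label_law (fun m' => target_law n.-1 u' (Some m) m' k.1 g))
                   (fun k g => label_law (fun m' => gen_law offb n.-1 (Some m) m' k g)) i ks)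
         (fun l => f (rt n (a, m, (z, true)) ++ l))
       else 0)
  end.

Lemma Ex_None (A : countType) (f : A -> ennr R) : Ex (fun=> None) (oapp f 0) = 0.
Proof. by rewrite Ex_cst. Qed.

(** The conditioning is that of [Ex_typed_gen]. Measurability and formula are proved together
    because the inductive step uses both for the child that carries on the search. *)
Lemma typed_target_law u : forall n w a m z, w <> [::] ->
  dm (Ix regb w) (typed_target n u w a m z) /\
  forall f, Ex (typed_target n u w a m z) (oapp f 0) = target_law n u a m z f.
Proof.
have dTL := dm_typed_gen regb_ok kidb_ok mkap.
elim: u => [|i u IH] n w a m z w0.
  case: (boolP (z \in B)) => zB; last first.
    have -> : typed_target n [::] w a m z = fun=> None by apply/funext => om; rewrite /typed_target /= (negPf zB).
    split; first exact: dm_cst.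
    by move=> f; rewrite Ex_None /= (negPf zB).
  have -> : typed_target n [::] w a m z = fun om => Some (typed_gen kidb n w a m (z, true) om).
    by apply/funext => om; rewrite /typed_target /= zB cats0 typed_gen_kidT_end.
  have dT := dTL n w a m (z, true) w0.
  split; first exact: dm_comp dT.
  move=> f; rewrite (Ex_comp (@Some _) _ dT) /= zB.
  exact: (Ex_typed_gen regb_ok kidb_ok mkap (fun w s g _ => kidb_off w s g)).
case: (boolP (z \in B)) => zB.
  have -> : typed_target n (i :: u) w a m z = fun=> None by apply/funext => om; rewrite /typed_target /= zB.
  split; first exact: dm_cst.
  by move=> f; rewrite Ex_None /= zB.
pose x0 : W * St := (w, (z, false)).
pose Y cs om := if (i < size cs)%N then
    omap (cat (rt n (a, m, (z, true)))) (oflat [seq Ychild n.-1 u m i x0 cs c om | c <- cs])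
  else None.
have -> : typed_target n (i :: u) w a m z = fun om => Y (wkid w z om) om.
  by apply/funext => om; rewrite (typed_target_rec _ _ _ _ _ _ _ x0).
have dw := dmS (Kw_Kxb w0) (@dm_wkid w z).
have ekid om : wkid w z om = kidb w (z, false) om by rewrite kidb_white.
have vc c om : c \in wkid w z om -> c.1 <> [::] /\ parb c.1 = Some w.
  by move=> /wkid_mem[j [-> _]]; split; [case: (w)|exact: parb_rcons].
have dch om c : c \in wkid w z om -> dm (Cx regb c.1) (Ychild n.-1 u m i x0 (wkid w z om) c).
  move=> /vc[c0 _]; rewrite /Ychild; case: (c == _).
    apply: (dm_childx regb_ok mkap (Y := fun k => typed_target n.-1 u c.1 (Some m) k c.2.1)) => k.
    by have [] := IH n.-1 c.1 (Some m) k c.2.1 c0.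
  apply: (dm_childx regb_ok mkap (Y := fun k om => Some (typed_gen kidb n.-1 c.1 (Some m) k c.2 om))) => k.
  by apply: dm_comp; exact: dTL.
have dY J om : (forall c, c \in wkid w z om -> Cx regb c.1 `<=` J) -> dm J (Y (wkid w z om)).
  move=> hJ; rewrite /Y; case: (i < size (wkid w z om))%N; last exact: dm_cst.
  by apply: dm_comp; apply: dm_oflat => c cin; apply: dmS (hJ _ cin) (dch _ _ cin).
split.
  apply: (dm_bind (X := wkid w z) (Y := Y)).
    by apply: dmS dw; exact: (Kx_Ix regb_ok).
  move=> cs [om <-]; apply: dY => c /vc[_ pc]; exact: (Cx_Ix regb_ok pc).
move=> f; rewrite (Ex_bind (J := ~` Kx parb w) (I := Kx parb w)); last first.
- move=> cs [om <-]; apply: dY => c /vc[_ pc] x cx kx; exact: (Kx_Cx regb_ok pc kx cx).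
- exact: dw.
- by move=> x kx; apply.
rewrite /= (negPf zB) -(Ex_wkid w) (Ex_comp _ _ dw).
apply: eq_Ex => om; rewrite size_map /Y; case: ltnP => si; last by rewrite Ex_None.
set cs := wkid w z om in si *.
have dZ : dm setT (fun om' => oflat [seq Ychild n.-1 u m i x0 cs c om' | c <- cs]).
  by apply: dm_oflat => c cin; apply: dmS (dch _ _ cin).
rewrite (Ex_comp (omap (cat (rt n (a, m, (z, true))))) _ dZ).
have -> : (fun t => oapp f 0 (omap (cat (rt n (a, m, (z, true)))) t)) =
    oapp (fun l => f (rt n (a, m, (z, true)) ++ l)) 0 by apply/funext => -[].
rewrite slot_map (slot_uniq _ _ x0) ?uniq_wkid //.
apply: (Ex_kids regb_ok kidb_ok (w := w) (s := (z, false)) (om := om)) => //.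
- by rewrite /cs ekid.
- by move=> c g cin; exact: dch.
move=> c g cin; have [c0 _] := vc _ _ cin; rewrite /Ychild; case: (c == _) => /=.
  have I1 k := IH n.-1 c.1 (Some m) k c.2.1 c0.
  apply: (Ex_child mkap (reg := regb) (Y := fun k => typed_target n.-1 u c.1 (Some m) k c.2.1)) => k.
    by have [] := I1 k.
  by have [_ ->] := I1 k.
apply: (Ex_TLchild regb_ok kidb_ok mkap) => // m' f'.
exact: (Ex_typed_gen regb_ok kidb_ok mkap (fun w s g _ => kidb_off w s g)).
Qed.

Lemma PK1 c : label_law (fun=> c) = c.
Proof.
have := Ex1 (@dm_kap K kap mkap [::] 0); rewrite -/(label_law _) => e1.
rewrite /label_law /Ex ESum_mulr -[RHS]mul1r -[in RHS]e1; congr (_ * _).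
by apply: eq_ESum => k; rewrite mulr1.
Qed.

Lemma convl_eval (A : countType) (C : Type) (cs : seq C) (f : seq A -> ennr R) :
  convl [seq (fun g => g [::]) | c <- cs] f = f [::].
Proof. by elim: cs f. Qed.

Lemma convl_slot_eval (A : countType) (C : Type) i (cs : seq C) (f : seq A -> ennr R) :
  convl (slot (fun (_ : C) g => g [::]) (fun _ g => g [::]) i cs) f = f [::].
Proof. elim: cs i f => // c cs IH [|i] f /=; [exact: convl_eval|exact: IH]. Qed.

(** Nothing is recorded, so all that remains of the tree is the probability that the search
    succeeds. *)
Lemma target_law0 u a m z f : target_law 0 u a m z f = hu u z * f [::].
Proof.
elim: u a m z f => [|i u IH] a m z f /=; first by case: (z \in B); rewrite ?mul1r ?mul0r.
case: (z \in B); first by rewrite mul0r.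
rewrite -ESum_mulr; apply: eq_ESum => ys; rewrite -!mulrA; congr (_ * _).
rewrite size_map; case: ltnP => si; last by rewrite !mul0r.
rewrite mul1r slot_map.
have -> : (fun k g => label_law (fun m' => target_law 0 u (Some m) m' k.1 g)) \o (fun y : S => (y, false)) =
  (fun y g => hu u y * g [::]).
  apply/funext => y; apply/funext => g /=; rewrite -[RHS]PK1; congr label_law.
  by apply/funext => m'; rewrite IH.
have -> : (fun k (g : seq ityp -> ennr R) => label_law (fun=> g [::])) \o (fun y : S => (y, false)) =
  (fun y g => g [::]).
  by apply/funext => y; apply/funext => g /=; exact: PK1.
by rewrite (convl_slot_mul _ _ z) // convl_slot_eval.
Qed.

Lemma hE_B z : z \in B -> hE z = 1.
Proof. by move=> zB; rewrite /hE h_hu hu_B. Qed.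

(* Summing over all possible choices of an element of H_B turns the white tree into [h z] times
   the biased tree. *)
Theorem target_law_sum n a m z f :
  ESum (fun u => target_law n u a m z f) = hE z * gen_law offb n a m (z, true) f.
Proof.
elim: n a m z f => [|n IH] a m z f.
  by rewrite /hE h_hu -ESum_mulr; apply: eq_ESum => u; rewrite target_law0.
case: (boolP (z \in B)) => zB.
  rewrite hE_B // mul1r (@ESum_single _ _ [::]) //; first by rewrite [LHS]/= zB.
  by case=> // i u _; rewrite [LHS]/= zB.
rewrite [LHS]ESum_seq [target_law _ [::] _ _ _ _]/= (negPf zB) add0r.
set F := fun l => f ([:: (a, m, (z, true))] ++ l).
pose G1 u (k : St) g := label_law (fun m' => target_law n u (Some m) m' k.1 g).
pose G0 (k : St) g := label_law (fun m' => gen_law offb n (Some m) m' k g).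
have hG0 k : sum_linear (G0 k).
  by apply: sum_linear_bind => [|m']; [exact: sum_linear_label_law|apply: sum_linear_gen_law => s; exact: sum_linear_offb].
(* For a fixed first letter [i], multilinearity moves the sum over the rest of the address into slot
   [i], where the induction hypothesis produces [h] of that child. *)
transitivity (ESum (fun i => ESum (fun ys => wt z ys *
    ((i < size ys)%N%:R * (hE (nth z ys i) *
     convl (slot (fun y => G0 (y, true)) (fun y => G0 (y, false)) i ys) F))))).
  apply: eq_ESum => i.
  transitivity (ESum (fun u => ESum (fun ys => wt z ys * ((i < size ys)%N%:R *
      convl (slot (G1 u) G0 i [seq (y, false) | y <- ys]) F)))).
    apply: eq_ESum => u; rewrite [LHS]/= (negPf zB); apply: eq_ESum => ys.
    by rewrite size_map; case: ltnP => si; rewrite ?mul1r ?mul0r.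
  rewrite ESum_swap; apply: eq_ESum => ys; rewrite ESum_mull ESum_mull; congr (_ * _).
  have [si|_] := ltnP i (size ys); last by rewrite !mul0r.
  rewrite !mul1r.
  have := convl_slot_ESum (fun=> 1) G1 F hG0 (cs := [seq (y, false) | y <- ys]) (i := i).
  rewrite size_map => /(_ si).
  under [RHS]eq_ESum do rewrite mul1r.
  move=> <-; rewrite slot_map -(convl_slot_mul _ _ z) //.
  congr (convl (slot _ _ _ _) _); apply/funext => y; apply/funext => g /=.
  under eq_ESum do rewrite mul1r.
  have := sum_linear_label_law kap (fun=> 1) (fun u m' => target_law n u (Some m) m' y g).
  under [RHS]eq_ESum do rewrite mul1r.
  move=> <-; rewrite /G0.
  have := sum_linear_label_law kap (T := unit) (fun=> hE y) (fun _ m' => gen_law offb n (Some m) m' (y, true) g).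
  have E1 (v : unit -> ennr R) : ESum v = v tt by rewrite (ESum_single (t0 := tt)) //; case.
  rewrite E1 => <-; congr label_law; apply/funext => m'; rewrite E1 -IH.
  by apply: eq_ESum => u; rewrite mul1r.
rewrite [gen_law _ _ _ _ _ _]/= /offb /= zB ESum_swap -ESum_mull.
rewrite -(ESum_pair (fun ys i => hE z * (toE (blue_weight p d h z (ys, i)) *
  convl [seq G0 k | k <- slot (fun y => (y, true)) (fun y => (y, false)) i ys] F))).
apply: eq_ESum => ys; apply: eq_ESum => i; rewrite blue_weightE /=.
have -> : [seq G0 k | k <- slot (fun y => (y, true)) (fun y => (y, false)) i ys] =
  slot (fun y => G0 (y, true)) (fun y => G0 (y, false)) i ys by exact: map_slot.
(* The factor [h z] and its inverse are inserted; the inverse is the normalisation in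
   [blue_weight]. *)
transitivity ((hE z * hiE z) * (wt z ys * ((i < size ys)%N%:R * (hE (nth z ys i) *
     convl (slot (fun y => G0 (y, true)) (fun y => G0 (y, false)) i ys) F)))).
  by rewrite hEK mul1r.
set x1 := hE z; set x2 := hiE z; set x3 := wt z ys; set x4 := _%:R; set x5 := hE _; set x6 := convl _ _.
by ring.
Qed.

End Marks.

End Hfun.

(** * Finiteness and positivity of [h] from the Green's function *)

Definition qE z y : ennr R := mE z * pE z y.

(** The many-to-one formula for one generation and a general function [phi]. *)
Lemma mean_sum z (phi : S -> ennr R) :
  ESum (fun ys => wt z ys * \sum_(y <- ys) phi y) = ESum (fun y => qE z y * phi y).
Proof.
transitivity (ESum (fun ys => ESum (fun y => (size ys).+1%:R * dE z (size ys).+1 * pathE z ys * pE z y * phi y))).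
  rewrite -(ESum_insert z (fun _ y => phi y)).
  rewrite -(ESum_pair (fun ys i => (i < size ys)%N%:R * wt z ys * phi (nth z ys i))).
  apply: eq_ESum => ys; rewrite -(ESum_nth z ys phi) -ESum_mull.
  by apply: eq_ESum => i; rewrite -mulrA mulrCA.
rewrite ESum_swap; apply: eq_ESum => y.
transitivity (ESum (fun ys => (size ys).+1%:R * dE z (size ys).+1 * pathE z ys) * (pE z y * phi y)).
  by rewrite -ESum_mulr; apply: eq_ESum => ys; rewrite mulrA.
rewrite (ESum_path z (fun n => n.+1%:R * dE z n.+1)) /qE mulrA; congr (_ * _ * _).
by rewrite /mE [RHS]ESum_nat mul0r add0r.
Qed.

Fixpoint QE n x y : ennr R :=
  if n is n'.+1 then ESum (fun z => QE n' x z * qE z y) else (x == y)%:R.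

Lemma QE_Qpow n x y : enn_val (QE n x y) = Qpow p d n x y.
Proof.
elim: n x y => [|n IH] x y /=; first by rewrite enn_natr.
apply: eq_esum => z _; rewrite IH /qk -mE_mean; congr (_ * (_ * _))%E.
by rewrite max_l // p_ge0.
Qed.

(** Powers are built by multiplication on the right, whereas a decomposition at the first generation
    needs it on the left. *)
Lemma QE_left n x y : QE n.+1 x y = ESum (fun z => qE x z * QE n z y).
Proof.
elim: n x y => [|n IH] x y.
  rewrite /= (@ESum_single _ _ x).
    rewrite eqxx mul1r (@ESum_single _ _ y) ?eqxx ?mulr1 // => z /negPf ->.
    by rewrite mulr0.
  by move=> z; rewrite eq_sym => /negPf ->; rewrite mul0r.
transitivity (ESum (fun z => QE n.+1 x z * qE z y)) => //.
under eq_ESum => z do rewrite IH -ESum_mulr.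
rewrite ESum_swap; apply: eq_ESum => z; rewrite /= -ESum_mull.
by apply: eq_ESum => v; rewrite mulrA.
Qed.

(** The expected number of elements of H_B in generation [n]. *)
Definition hl n z : ennr R := ESum (fun u : W => (size u == n)%:R * hu u z).

Lemma hl0 z : hl 0 z = (z \in B)%:R.
Proof. by rewrite /hl (@ESum_single _ _ [::]) ?mul1r //; case=> // a u _; rewrite mul0r. Qed.

Lemma hlS n z : hl n.+1 z = if z \in B then 0 else ESum (fun y => qE z y * hl n y).
Proof.
rewrite /hl [LHS]ESum_seq /= mul0r add0r.
case: ifPn => zB.
  rewrite -[RHS](ESum0 _ nat); apply: eq_ESum => i; rewrite -[RHS](ESum0 _ W).
  by apply: eq_ESum => u; rewrite mulr0.
rewrite -(mean_sum z (fun y => ESum (fun u => (size u == n)%:R * hu u y))).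
transitivity (ESum (fun i => ESum (fun ys => ESum (fun u : W => wt z ys * ((i < size ys)%N%:R *
    ((size u == n)%:R * hu u (nth z ys i))))))).
  apply: eq_ESum => i; rewrite ESum_swap; apply: eq_ESum => u; rewrite eqSS -ESum_mull.
  apply: eq_ESum => ys; set a := (_ == _)%:R; set b := (_ < _)%N%:R; by ring.
rewrite ESum_swap; apply: eq_ESum => ys; rewrite -(ESum_nth z) -ESum_mull.
by apply: eq_ESum => i; rewrite ESum_mull ESum_mull.
Qed.

Definition enn_le (x y : ennr R) : bool := (enn_val x <= enn_val y)%E.

Lemma ESum_le (T : choiceType) (F G : T -> ennr R) :
  (forall t, enn_le (F t) (G t)) -> enn_le (ESum F) (ESum G).
Proof. by move=> h; apply: le_esum => t _; exact: h. Qed.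

Lemma enn_le_mull c x y : enn_le x y -> enn_le (c * x) (c * y).
Proof. by move=> h; rewrite /enn_le !enn_valM lee_wpmul2l // enn_ge0. Qed.

(* An element of H_B in generation [n] is in particular an individual of generation [n] in [B]. *)
Lemma hl_le n z : enn_le (hl n z) (\sum_(b <- undup B) QE n z b).
Proof.
elim: n z => [|n IH] z.
  rewrite hl0; case: (boolP (z \in B)) => zB; last by exact: enn_ge0.
  rewrite -mem_undup in zB; rewrite (big_rem z) //= eqxx /enn_le enn_valD leeDl //.
  exact: enn_ge0.
rewrite hlS; case: ifP => _; first exact: enn_ge0.
have -> : \sum_(b <- undup B) QE n.+1 z b = ESum (fun y => qE z y * \sum_(b <- undup B) QE n y b).
  under eq_bigr => b _ do rewrite QE_left.
  by rewrite -ESum_sum; apply: eq_ESum => y; rewrite big_distrr.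
by apply: ESum_le => y; apply: enn_le_mull; exact: IH.
Qed.

Definition HE z : ennr R := ESum (fun u => hu u z).

Lemma HE_hl z : HE z = ESum (fun n => hl n z).
Proof.
rewrite /HE /hl ESum_swap; apply: eq_ESum => u.
rewrite (@ESum_single _ _ (size u)) ?eqxx ?mul1r // => n; rewrite eq_sym => /negPf ->.
by rewrite mul0r.
Qed.

Lemma green_QE x y : green p d x y = enn_val (ESum (fun n => QE n x y)).
Proof. by apply: eq_esum => n _; rewrite QE_Qpow. Qed.

Section Green.
Hypotheses (green_fin : forall x y, (green p d x y < +oo)%E)
  (norming : norming_region p d B).

Lemma HE_lty z : (enn_val (HE z) < +oo)%E.
Proof.
have : enn_le (HE z) (\sum_(b <- undup B) ESum (fun n => QE n z b)).
  rewrite HE_hl -ESum_sum; apply: ESum_le => n; exact: hl_le.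
move/le_lt_trans; apply; rewrite enn_val_sum.
by apply: lte_sum_pinfty => b _; rewrite -green_QE.
Qed.

Lemma enn_mul_eq0 (x y : ennr R) : x * y = 0 -> x = 0 \/ y = 0.
Proof.
move/(congr1 (@enn_val R)); rewrite enn_valM enn_val0 => /eqP.
by rewrite mule_eq0 => /orP[] /eqP e; [left|right]; apply: enn_eq.
Qed.

Lemma ESum_eq0 (T : choiceType) (F : T -> ennr R) t : ESum F = 0 -> F t = 0.
Proof.
move=> e; apply: enn_eq; apply/eqP; rewrite eq_le enn_ge0 andbT.
by have := ESum_ge F t; rewrite e.
Qed.

Lemma HE_harm z : z \notin B -> HE z = ESum (fun y => qE z y * HE y).
Proof. by move=> zB; rewrite /HE hu_harm // mean_sum. Qed.

(* If h(z) = 0 then, by harmonicity, no path from [z] reaches [B]. *)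
Lemma HE_neq0 z : HE z <> 0.
Proof.
suff pos n : forall x b, b \in B -> HE x = 0 -> QE n x b = 0.
  move=> h0; have := norming z; rewrite big_seq big1 ?ltxx // => b.
  rewrite mem_undup => bB; rewrite green_QE.
  have -> : ESum (fun n => QE n z b) = 0.
    by rewrite -[RHS](ESum0 _ nat); apply: eq_ESum => n; exact: pos.
  by [].
elim: n => [|n IH] x b bB h0.
  rewrite /=; case: eqP => // xb; exfalso; move: h0; rewrite xb /HE hu_B //.
  by move/(congr1 (@enn_val R)) => -[] /eqP; rewrite oner_eq0.
case: (boolP (x \in B)) => xB.
  exfalso; move: h0; rewrite /HE hu_B //.
  by move/(congr1 (@enn_val R)) => -[] /eqP; rewrite oner_eq0.
rewrite QE_left -[RHS](ESum0 _ S); apply: eq_ESum => y.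
rewrite HE_harm // in h0; have /= := ESum_eq0 y h0.
by case/enn_mul_eq0 => [->|/(IH y b bB) ->]; rewrite ?mul0r ?mulr0.
Qed.

(** Some [y] has [p z y] nonzero, and the mean times [p z y] is one term of [green p d z y], which
    is finite. *)
Lemma mE_lty z : (enn_val (mE z) < +oo)%E.
Proof.
have [y py] : exists y, pE z y <> 0.
  apply: contrapT => h.
  have := pE_sum z; rewrite (eq_ESum (G := fun=> 0)) ?ESum0.
    by move/(congr1 (@enn_val R)) => -[] /esym /eqP; rewrite oner_eq0.
  by move=> y; apply: contrapT => py; apply: h; exists y.
have q1 : QE 1 z y = mE z * pE z y.
  by rewrite /= (@ESum_single _ _ z) ?eqxx ?mul1r // => x; rewrite eq_sym => /negPf ->; rewrite mul0r.
have := ESum_ge (fun n => QE n z y) 1%N; rewrite q1 -green_QE => /le_lt_trans /(_ (green_fin z y)).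
rewrite enn_valM; case: (enn_val (mE z)) (enn_ge0 (mE z)) => [r _ _| |//]; first by rewrite ltry.
have py0 : (0 < enn_val (pE z y))%E.
  by rewrite lt_neqAle enn_ge0 andbT eq_sym; apply/eqP => e; apply: py; exact: enn_eq.
by rewrite gt0_mulye.
Qed.

Definition hh z : R := fine (enn_val (HE z)).

Lemma hh_HE z : toE (hh z) = HE z.
Proof.
apply: enn_eq; rewrite toE_val ?fine_ge0 ?enn_ge0 // fineK //.
by rewrite ge0_fin_numE ?enn_ge0 // HE_lty.
Qed.

Lemma hh_gt0 z : 0 < hh z.
Proof.
rewrite fine_gt0 // HE_lty andbT lt_neqAle enn_ge0 andbT eq_sym.
by apply/eqP => e; apply: (@HE_neq0 z); exact: enn_eq.
Qed.

End Green.

End Model.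
End Tree.

(** * Laws of random forests *)

Lemma measurable_ex (T : countType) (F : T -> set O) :
  (forall t, measurable (F t)) -> measurable [set w | exists t, F t w].
Proof.
move=> mF.
have -> : [set w | exists t, F t w] =
    \bigcup_n (if @pickle_inv T n is Some t then F t else set0).
  apply/seteqP; split => [w [t Ft]|w [n _]].
    by exists (pickle t) => //=; rewrite pickleK_inv.
  by case: pickle_inv => // t; exists t.
by apply: bigcupT_measurable => n; case: pickle_inv.
Qed.

Lemma measurable_prop (Q : Prop) : measurable [set _ : O | Q].
Proof. by apply: (@sig_measurable setT); exact: sig_prop. Qed.

Lemma measurable_dm_pred I (T : countType) (X : O -> T) (Q : T -> Prop) :
  dm I X -> measurable [set w | Q (X w)].
Proof. by move=> h; apply: (@sig_measurable I); exact: dm_prop. Qed.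

Lemma measurable_eqR (f g : O -> R) : measurable_fun setT f -> measurable_fun setT g ->
  measurable [set w | f w = g w].
Proof.
move=> mf mg; have := measurable_funB mf mg measurableT (measurable_set1 0).
rewrite setTI; congr (measurable _).
by apply/seteqP; split => w /=; [move/eqP; rewrite subr_eq0 => /eqP|move=> ->; rewrite subrr].
Qed.

Lemma Ex_ESum (T T' : countType) (X : O -> T) (F : T -> T' -> ennr R) :
  Ex X (fun t => ESum (F t)) = ESum (fun u => Ex X (F^~ u)).
Proof.
rewrite /Ex; under eq_ESum => t do rewrite -ESum_mull.
exact: ESum_swap.
Qed.

Lemma measurable_preim (f : O -> R) (A : set R) : measurable_fun setT f -> measurable A ->
  measurable [set w | A (f w)].
Proof. by move=> mf mA; rewrite -[X in measurable X]setTI; exact: mf. Qed.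

Section Forest.
Variable S : countType.
Local Notation W := (seq nat).
Local Notation St := (S * bool)%type.

(* The data of one generator of the sigma-algebra on forests. *)
Record spec := Spec { sOp : set (option R); sL : set R; sy : S; sb : bool; sk : nat }.

Definition spec_ok c := measurable (Some @^-1` sOp c) /\ measurable (sL c).

Definition spec_set c : set (CInd R S) :=
  [set x | sOp c x.1.1.1 /\ sL c x.1.1.2 /\ x.1.2 = sy c /\ x.2 = sb c].

Definition spec_gen c : set (set (CInd R S)) := [set t | atleast (sk c) (t `&` spec_set c)].

Fixpoint inter (cs : seq spec) : set (set (CInd R S)) :=
  if cs is c :: cs' then spec_gen c `&` inter cs' else setT.

Fixpoint specs_ok (cs : seq spec) : Prop :=
  if cs is c :: cs' then spec_ok c /\ specs_ok cs' else True.

Definition inter_gen : set (set (set (CInd R S))) :=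
  [set A | exists cs, specs_ok cs /\ A = inter cs].

Lemma inter_cat cs cs' : inter (cs ++ cs') = inter cs `&` inter cs'.
Proof. by elim: cs => [|c cs IH] /=; rewrite ?setTI // IH setIA. Qed.

Lemma inter_gen_setI : setI_closed inter_gen.
Proof.
move=> _ _ [cs [ok ->]] [cs' [ok' ->]]; exists (cs ++ cs'); split; last by rewrite inter_cat.
by elim: cs ok => //= c cs IH [? /IH].
Qed.

Lemma forest_gen_inter (E : set (set (CInd R S))) : forest_gen E -> inter_gen E.
Proof.
move=> [Op [L [y [b [k [mO [mL ->]]]]]]]; exists [:: Spec Op L y b k]; split => //=.
by rewrite setIT.
Qed.

Lemma forest_measurable_inter (A : set (set (CInd R S))) :
  forest_measurable A -> <<s inter_gen >> A.
Proof.
apply: smallest_sub; first exact: smallest_sigma_algebra.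
by move=> E /forest_gen_inter; exact: sub_sigma_algebra.
Qed.

Lemma measurable_preimage_forest (F : O -> set (CInd R S)) :
  (forall c, spec_ok c -> measurable (F @^-1` (spec_gen c))) ->
  forall A, <<s inter_gen >> A -> measurable (F @^-1` A).
Proof.
move=> mF; apply: smallest_sub.
  split; first by rewrite /= preimage_set0.
  - by move=> A /= mA; rewrite setTD preimage_setC; exact: measurableC.
  - by move=> A /= mA; rewrite preimage_bigcup; apply: bigcupT_measurable.
move=> _ [cs [ok ->]] /=; elim: cs ok => [|c cs IH] /=; first by rewrite preimage_setT.
by move=> [okc okcs]; rewrite preimage_setI; apply: measurableI; [exact: mF|exact: IH].
Qed.

Section WForest.
Variables (lb : W -> O -> R) (par : W -> option W) (G : W -> St -> O -> Prop).

Definition ind om (q : W * St) : CInd R S :=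
  ((omap (fun v => lb v om) (par q.1), lb q.1 om, q.2.1), q.2.2).

Definition wforest om : set (CInd R S) := [set c | exists q, G q.1 q.2 om /\ c = ind om q].

(** Two words may carry the same individual when labels coincide; distinctness therefore has to be
    required of the images under [ind], not of the words. *)
Lemma wforest_atleast om k (C : set (CInd R S)) :
  atleast k (wforest om `&` C) <->
  exists l : seq (W * St), [/\ size l = k, uniq [seq ind om q | q <- l] &
    forall q, q \in l -> G q.1 q.2 om /\ C (ind om q)].
Proof.
split.
  move=> [f [fi fC]].
  have /choice[q hq] : forall i, exists q, G q.1 q.2 om /\ f i = ind om q.
    by move=> i; have [[q [Gq e]] _] := fC i; exists q.
  exists [seq q i | i <- enum 'I_k]; split.
  - by rewrite size_map size_enum_ord.
  - rewrite -map_comp map_inj_uniq ?enum_uniq // => i j /=.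
    by rewrite -(hq i).2 -(hq j).2 => /fi.
  - move=> _ /mapP[i _ ->]; have [Gq e] := hq i; split => //.
    by rewrite -e; have [] := fC i.
move=> [l [<- ul hl]]; case: l ul hl => [|q0 l] ul hl.
  by exists (fun i : 'I_0 => False_rect _ (notF (ltn_ord i))); split => -[].
exists (fun i : 'I_(size (q0 :: l)) => ind om (nth q0 (q0 :: l) i)); split.
  move=> i j; rewrite -!(nth_map q0 (ind om q0)) // => e.
  by apply/val_inj/eqP; rewrite /= -(nth_uniq (ind om q0) _ _ ul) ?size_map // e.
move=> i; have [Gq Cq] := hl _ (mem_nth q0 (ltn_ord i)).
by split => //; exists (nth q0 (q0 :: l) i).
Qed.

Hypotheses (mlb : forall w, measurable_fun setT (lb w))
  (mG : forall w s, measurable [set om | G w s om]).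

Lemma measurable_ind_eq q q' : measurable [set om | ind om q = ind om q'].
Proof.
have -> : [set om | ind om q = ind om q'] =
  [set om | omap (fun v => lb v om) (par q.1) = omap (fun v => lb v om) (par q'.1)] `&`
  ([set om | lb q.1 om = lb q'.1 om] `&` [set _ | q.2 = q'.2]).
  apply/seteqP; split => om /=.
    by case: q => w [z b]; case: q' => w' [z' b'] /= [-> -> -> ->].
  by move=> [e1 [e2 e3]]; rewrite /ind e1 e2 e3.
apply: measurableI; last first.
  by apply: measurableI; [exact: measurable_eqR|exact: measurable_prop].
case: (par q.1) => [v|]; case: (par q'.1) => [v'|] /=.
- have -> : [set om | Some (lb v om) = Some (lb v' om)] = [set om | lb v om = lb v' om].
    by apply/seteqP; split => om /= [->].
  exact: measurable_eqR.
- by rewrite (_ : [set om | Some (lb v om) = None] = set0) //; apply/seteqP; split.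
- rewrite (_ : [set om | None = Some (lb v' om)] = set0) //.
  by apply/seteqP; split.
- exact: (measurable_prop (None = None)).
Qed.

Lemma measurable_uniq_ind l : measurable [set om | uniq [seq ind om q | q <- l]].
Proof.
elim: l => [|q l IH] /=; first exact: (measurable_prop true).
have -> : [set om | (ind om q \notin [seq ind om q' | q' <- l]) && uniq [seq ind om q' | q' <- l]] =
  ~` [set om | exists q', q' \in l /\ ind om q = ind om q'] `&`
  [set om | uniq [seq ind om q' | q' <- l]].
  apply/seteqP; split => om /=.
    by move=> /andP[h ->]; split => // -[q' [ql e]]; rewrite e map_f in h.
  by move=> [h ->]; rewrite andbT; apply/mapP => -[q' ql e]; apply: h; exists q'.
apply: measurableI => //; apply: measurableC; apply: measurable_ex => q'.
have -> : (fun om => q' \in l /\ ind om q = ind om q') =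
  [set _ | q' \in l] `&` [set om | ind om q = ind om q'] by [].
by apply: measurableI; [exact: measurable_prop|exact: measurable_ind_eq].
Qed.

Lemma measurable_spec_ind c q : spec_ok c -> measurable [set om | spec_set c (ind om q)].
Proof.
move=> [mO mL].
have -> : [set om | spec_set c (ind om q)] =
  [set om | sOp c (omap (fun v => lb v om) (par q.1))] `&` ([set om | sL c (lb q.1 om)] `&`
  [set _ | q.2.1 = sy c /\ q.2.2 = sb c]) by [].
apply: measurableI.
  case: (par q.1) => [v|] /=; last exact: measurable_prop.
  exact: (@measurable_preim (lb v) (Some @^-1` sOp c)).
by apply: measurableI; [exact: measurable_preim|exact: measurable_prop].
Qed.

(** A generator event is a union over the countably many lists of pairs of a word and a state, and
    each list imposes finitely many measurable conditions. *)
Lemma wforest_measurable A : <<s inter_gen >> A -> measurable (wforest @^-1` A).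
Proof.
apply: measurable_preimage_forest => c okc.
have -> : wforest @^-1` spec_gen c = [set om | exists l : seq (W * St),
    (([set _ | size l = sk c] `&` [set om | uniq [seq ind om q | q <- l]]) `&`
    [set om | forall q, q \in l -> G q.1 q.2 om /\ spec_set c (ind om q)]) om].
  apply/seteqP; split => om /=.
    by move=> /wforest_atleast[l [h1 h2 h3]]; exists l.
  by move=> [l [[h1 h2] h3]]; apply/wforest_atleast; exists l.
apply: measurable_ex => l; apply: measurableI.
  by apply: measurableI; [exact: measurable_prop|exact: measurable_uniq_ind].
elim: l => [|q l IH].
  rewrite (_ : [set om | _] = setT) //; by apply/seteqP; split.
have -> : [set om | forall q', q' \in q :: l -> G q'.1 q'.2 om /\ spec_set c (ind om q')] =
  ([set om | G q.1 q.2 om] `&` [set om | spec_set c (ind om q)]) `&`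
  [set om | forall q', q' \in l -> G q'.1 q'.2 om /\ spec_set c (ind om q')].
  apply/seteqP; split => om /=.
    move=> h; split; first by apply: h; rewrite mem_head.
    by move=> q' ql; apply: h; rewrite inE ql orbT.
  by move=> [h1 h2] q'; rewrite inE => /orP[/eqP ->//|/h2].
by apply: measurableI => //; apply: measurableI => //; exact: measurable_spec_ind.
Qed.

End WForest.

Local Notation K := (seq (bool * bool)).
Local Notation ityp := (option K * K * St)%type.

(** Two bits per generator: whether the label is admissible as a predecessor label and whether it is
    admissible as the individual's own label. *)
Definition label_class (cs : seq spec) (l : R) : K :=
  [seq (`[< sOp c (Some l) >], `[< sL c l >]) | c <- cs].

Definition tst (c : spec) (i : nat) (t : ityp) : bool :=
  [&& (if t.1.1 is Some k then (nth (false, false) k i).1 else `[< sOp c None >]),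
      (nth (false, false) t.1.2 i).2 & t.2 == (sy c, sb c)].

(** [i] is the position of the current generator in the full list from which the label classes were
    computed. *)
Fixpoint profile (cs : seq spec) (i : nat) (l : seq ityp) : bool :=
  if cs is c :: cs' then (sk c <= count (tst c i) l)%N && profile cs' i.+1 l else true.

Lemma profile_perm cs i l l' : perm_eq l l' -> profile cs i l = profile cs i l'.
Proof. by move=> /permP e; elim: cs i => //= c cs IH i; rewrite e IH. Qed.

Lemma measurable_label_class cs : specs_ok cs -> forall k, measurable (label_class cs @^-1` [set k]).
Proof.
elim: cs => [|c cs IH] /=.
  move=> _ k; rewrite (_ : _ @^-1` _ = [set _ | [::] = k]) //.
  have [<-|ne] := eqVneq [::] k.
    by rewrite (_ : [set _ | _] = setT) //; apply/seteqP; split.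
  by rewrite (_ : [set _ | _] = set0) //; apply/seteqP; split => //= x /eqP; rewrite (negPf ne).
have mb (A : set R) b : measurable A -> measurable [set l | `[< A l >] = b].
  move=> mA; case: b.
    by rewrite (_ : [set l | _] = A) //; apply/seteqP; split => l /=; case: asboolP.
  rewrite (_ : [set l | _] = ~` A); first exact: measurableC.
  by apply/seteqP; split => l /=; case: asboolP.
move=> [[mO mL] ok] [|[b1 b2] k].
  by rewrite (_ : _ @^-1` _ = set0) //; apply/seteqP; split.
rewrite (_ : _ @^-1` _ = ([set l | `[< (Some @^-1` sOp c) l >] = b1] `&` [set l | `[< sL c l >] = b2])
   `&` (label_class cs @^-1` [set k])).
  by apply: measurableI; [apply: measurableI; exact: mb|exact: IH].
apply/seteqP; split => l /=; first by move=> [-> -> ->].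
by move=> [[-> ->] ->].
Qed.

(** * Counting individuals through their words *)

Section Counting.
Variables (lb : W -> R) (par : W -> option W) (Ln : nat -> seq (W * St)).
Hypotheses (Ln_sub : forall n, {subset Ln n <= Ln n.+1})
  (Ln_uniq : forall n, uniq (unzip1 (Ln n)))
  (lb_inj : forall n q q', q \in Ln n -> q' \in Ln n -> lb q.1 = lb q'.1 -> q.1 = q'.1).

Definition typ (kap : R -> K) (q : W * St) : ityp :=
  (omap (fun v => kap (lb v)) (par q.1), kap (lb q.1), q.2).

Let ind' (q : W * St) : CInd R S := ((omap lb (par q.1), lb q.1, q.2.1), q.2.2).
Let Gn (q : W * St) := exists n, q \in Ln n.

Lemma Ln_le m n : (m <= n)%N -> {subset Ln m <= Ln n}.
Proof.
move=> /subnK <-; elim: (n - m)%N => // k IH q /IH; rewrite addSn; exact: Ln_sub.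
Qed.

Lemma Ln_all (l : seq (W * St)) : (forall q, q \in l -> Gn q) -> exists n, {subset l <= Ln n}.
Proof.
elim: l => [|q l IH] h; first by exists 0%N.
have [n1 h1] : Gn q by apply: h; rewrite mem_head.
have [n2 h2] : exists n, {subset l <= Ln n}.
  by apply: IH => q' ql; apply: h; rewrite inE ql orbT.
exists (maxn n1 n2) => q'; rewrite inE => /orP[/eqP ->|/h2].
  by apply: Ln_le h1; exact: leq_maxl.
by apply: Ln_le; exact: leq_maxr.
Qed.

Lemma Ln_uniq' n : uniq (Ln n).
Proof. exact: map_uniq (Ln_uniq n). Qed.

Lemma Ln_inj n q q' : q \in Ln n -> q' \in Ln n -> q.1 = q'.1 -> q = q'.
Proof.
move=> h1 h2 e; have := Ln_uniq n; move: h1 h2.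
elim: (Ln n) => // x r IH; rewrite !inE /= => h1 h2 /andP[h3 h4].
case/orP: h1 => [/eqP h1|h1]; case/orP: h2 => [/eqP h2|h2].
- by rewrite h1 h2.
- by exfalso; move/negP: h3; apply; rewrite -h1 e; exact: map_f.
- by exfalso; move/negP: h3; apply; rewrite -h2 -e; exact: map_f.
- exact: IH.
Qed.

(** Finitely many individuals all appear by some finite stage. Conversely, injectivity of the labels
    turns distinct words into distinct individuals. *)
Lemma count_Ln (a : pred (W * St)) k :
  (exists l : seq (W * St), [/\ size l = k, uniq [seq ind' q | q <- l] &
    forall q, q \in l -> Gn q /\ a q]) <->
  exists n, (k <= count a (Ln n))%N.
Proof.
split.
  move=> [l [<- ul hl]].
  have [n hn] : exists n, {subset l <= Ln n} by apply: Ln_all => q /hl [].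
  exists n; rewrite -size_filter; apply: uniq_leq_size; first exact: map_uniq ul.
  by move=> q ql; rewrite mem_filter (hn _ ql) andbT; have [] := hl _ ql.
move=> [n kn]; exists (take k (seq.filter a (Ln n))).
have sub q : q \in take k (seq.filter a (Ln n)) -> a q /\ q \in Ln n.
  by move=> /mem_take; rewrite mem_filter => /andP[].
split.
- by rewrite size_takel // size_filter.
- rewrite map_inj_in_uniq; first by apply: take_uniq; apply: filter_uniq; exact: Ln_uniq'.
  move=> q q' /sub[_ qn] /sub[_ qn'] [_ e _ _].
  by apply: (Ln_inj qn qn'); exact: (lb_inj qn qn' e).
- by move=> q /sub[aq qn]; split => //; exists n.
Qed.

Lemma count_mono (a : pred (W * St)) m n : (m <= n)%N -> (count a (Ln m) <= count a (Ln n))%N.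
Proof.
move=> mn; rewrite -!size_filter; apply: uniq_leq_size.
  by apply: filter_uniq; exact: Ln_uniq'.
by move=> q; rewrite !mem_filter => /andP[-> /(Ln_le mn) ->].
Qed.

Lemma profile_mono kap cs i m n : (m <= n)%N ->
  profile cs i (map (typ kap) (Ln m)) -> profile cs i (map (typ kap) (Ln n)).
Proof.
move=> mn; elim: cs i => //= c cs IH i /andP[h1 /IH ->]; rewrite andbT.
rewrite !count_map in h1 *; exact: leq_trans h1 (count_mono _ mn).
Qed.

(** Each of the finitely many counts is reached at some stage; as counts only grow, the largest of
    these stages serves all of them. *)
Lemma inter_profile cs0 (t : set (CInd R S)) :
  (forall c k, atleast k (t `&` spec_set c) <->
     exists l : seq (W * St), [/\ size l = k, uniq [seq ind' q | q <- l] &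
       forall q, q \in l -> Gn q /\ spec_set c (ind' q)]) ->
  inter cs0 t <-> exists n, profile cs0 0 (map (typ (label_class cs0)) (Ln n)).
Proof.
move=> ht.
(* The induction runs over the suffixes of [cs0], because the classes always refer to the whole
   list. *)
have key cs i : drop i cs0 = cs -> inter cs t <-> exists n, profile cs i (map (typ (label_class cs0)) (Ln n)).
  elim: cs i => [|c cs IH] i /= di; first by split => // _; exists 0%N.
  have si : (i < size cs0)%N.
    by rewrite ltnNge; apply/negP => /drop_oversize; rewrite di.
  have ci : nth c cs0 i = c by have := drop_nth c si; rewrite di => -[].
  have dS : drop i.+1 cs0 = cs by have := drop_nth c si; rewrite di => -[].
  have e1 q : tst c i (typ (label_class cs0) q) = `[< spec_set c (ind' q) >].
    rewrite /tst /typ /= !(nth_map c) // ci /=.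
    have e2 : (if omap (fun v => label_class cs0 (lb v)) (par q.1) is Some k
       then (nth (false, false) k i).1 else `[< sOp c None >]) = `[< sOp c (omap lb (par q.1)) >].
      by case: (par q.1) => [v|] //=; rewrite (nth_map c) // ci.
    rewrite e2; apply/idP/asboolP.
      by move=> /and3P[/asboolP h1 /asboolP h2 /eqP h3]; rewrite /spec_set /= h3.
    move=> [h1 [h2 [h3 h4]]]; apply/and3P; split; try exact/asboolP.
    by rewrite [q.2]surjective_pairing; apply/eqP; congr (_, _).
  have e3 n : count (tst c i) (map (typ (label_class cs0)) (Ln n)) =
      count (fun q => `[< spec_set c (ind' q) >]) (Ln n).
    by rewrite count_map; apply: eq_count => q /=; exact: e1.
  have h1 : spec_gen c t <-> exists n, (sk c <= count (tst c i) (map (typ (label_class cs0)) (Ln n)))%N.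
    rewrite /spec_gen /= ht.
    under [X in _ <-> X]eq_exists => n do rewrite e3.
    rewrite -count_Ln; split => -[l [s1 s2 s3]]; exists l; split => // q /s3 [Gq sq]; split => //.
      exact/asboolP.
    exact/asboolP.
  split.
    move=> [/h1[n1 hn1] /(IH _ dS)[n2 hn2]]; exists (maxn n1 n2); apply/andP; split.
      apply: leq_trans hn1 _; rewrite !e3; apply: count_mono; exact: leq_maxl.
    by apply: profile_mono hn2; exact: leq_maxr.
  move=> [n /andP[hn1 hn2]]; split; first by apply/h1; exists n.
  by apply/(IH _ dS); exists n.
by apply: key; rewrite drop0.
Qed.

End Counting.

End Forest.

(** * Forests with several roots *)

Section Roots.
Variables (S : countType) (p : S -> S -> R) (d : S -> nat -> R) (B : seq S).
Hypotheses (hp : stochastic p) (hd : offspring_laws d)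
  (green_fin : forall x y, (green p d x y < +oo)%E) (norming : norming_region p d B).
Local Notation W := (seq nat).
Local Notation St := (S * bool)%type.
Local Notation h := (hh p d B).
Local Notation kidb := (kidb p d B h).

Let h_gt0 := hh_gt0 hp hd green_fin norming.
Let h_hu z : toE (h z) = ESum (fun u => hu p d B u z).
Proof. exact: (hh_HE B hp hd green_fin z). Qed.
Let kok := kidb_ok B hp hd h_gt0.

Variable xs : seq S.

Definition ixs := zip (iota 0 (size xs)) xs.

Lemma ixs_fst : unzip1 ixs = iota 0 (size xs).
Proof. by rewrite unzip1_zip // size_iota. Qed.

Lemma ixs_uniq : uniq ixs.
Proof. by apply: (@map_uniq _ _ fst); rewrite -/(unzip1 ixs) ixs_fst iota_uniq. Qed.

Lemma ixs_neq c c' : c \in ixs -> c' \in ixs -> c != c' -> c.1 <> c'.1.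
Proof.
move=> h1 h2 /eqP cc' e; apply: cc'.
have := iota_uniq 0 (size xs); rewrite -ixs_fst; move: h1 h2.
elim: ixs => // x r IH; rewrite !inE /= => h1 h2 /andP[h3 h4].
case/orP: h1 => [/eqP h1|h1]; case/orP: h2 => [/eqP h2|h2].
- by rewrite h1 h2.
- by exfalso; move/negP: h3; apply; rewrite -h1 e; exact: map_f.
- by exfalso; move/negP: h3; apply; rewrite -h2 -e; exact: map_f.
- exact: IH.
Qed.

Lemma ixs_lt c : c \in ixs -> (c.1 < size xs)%N.
Proof.
move=> cin; have : c.1 \in unzip1 ixs by exact: map_f.
by rewrite ixs_fst mem_iota.
Qed.

Lemma size_ixs : size ixs = size xs.
Proof. by rewrite size_zip size_iota minnn. Qed.

Section Marks.
Variables (K : countType) (kap : R -> K).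
Hypothesis mkap : forall k, measurable (kap @^-1` [set k]).
Local Notation ityp := (option K * K * St)%type.
Local Notation gen_law := (gen_law kap (offb p d B h)).
Local Notation typed_gen kid := (typed_gen kid kap).
Local Notation typed_target := (typed_target p d B kap).
Local Notation target_law := (target_law p d B h kap).

Definition mk (ms : seq K) i : K := nth (kap 0) ms i.

Lemma Ex_roots (Y : nat * S -> O -> option (seq ityp)) G f :
  (forall c, c \in ixs -> dm (Ix regb [:: c.1]) (Y c)) ->
  (forall c g, c \in ixs -> Ex (Y c) (oapp g 0) = G c g) ->
  Ex (fun om => oflat [seq Y c om | c <- ixs]) (oapp f 0) = convl [seq G c | c <- ixs] f.
Proof.
move=> dY hG; apply: (Ex_oflat (I := fun c => Ix regb [:: c.1])) => //; first exact: ixs_uniq.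
move=> c c' cin c'in cc' i [[/= r1 _] _] [[/= r2 _] _].
have := prefix_rcons_inj (w := [::]) r1 r2; exact: ixs_neq cc'.
Qed.

Lemma dm_root n a m i (s : St) : dm (Ix regb [:: i]) (typed_gen kidb n [:: i] a m s).
Proof. by apply: (dm_typed_gen regb_ok kok mkap). Qed.

Lemma Ex_root n a m i (s : St) g : Ex (typed_gen kidb n [:: i] a m s) g = gen_law n a m s g.
Proof.
apply: (Ex_typed_gen regb_ok kok mkap) => // w s' g' _.
exact: (kidb_off hp hd h_gt0 h_hu).
Qed.

Definition typed_rgen n (ms : seq K) (col : nat -> bool) om : seq ityp :=
  flatten [seq typed_gen kidb n [:: c.1] None (mk ms c.1) (c.2, col c.1) om | c <- ixs].

Definition Iroots : set idx := [set i | exists j, Ix regb [:: j] i].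

Lemma Iroots_disj l : ~ Iroots ([::], l).
Proof. by move=> [j [[/=]]]. Qed.

Lemma dm_typed_rgen n ms col : dm Iroots (typed_rgen n ms col).
Proof.
apply: dm_flatten => c _; apply: dmS (@dm_root n None (mk ms c.1) c.1 (c.2, col c.1)).
by move=> i ?; exists c.1.
Qed.

Lemma Ex_typed_rgen n ms col f : Ex (typed_rgen n ms col) f =
  convl [seq gen_law n None (mk ms c.1) (c.2, col c.1) | c <- ixs] f.
Proof.
rewrite -(Ex_roots (Y := fun c om => Some (typed_gen kidb n [:: c.1] None (mk ms c.1) (c.2, col c.1) om))).
- transitivity (Ex (fun om => Some (typed_rgen n ms col om)) (oapp f 0)).
    by rewrite (Ex_comp (@Some _) _ (@dm_typed_rgen n ms col)).
  by apply: Ex_ext => om; rewrite oflat_Some.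
- by move=> c _; apply: dm_comp; exact: dm_root.
- move=> c g _; rewrite -(Ex_root _ _ _ c.1).
  by rewrite (Ex_comp (@Some _) _ (@dm_root n None (mk ms c.1) c.1 (c.2, col c.1))).
Qed.

Definition typed_rtarget n (ms : seq K) i u om : option (seq ityp) :=
  oflat [seq (if c.1 == i then typed_target n u [:: c.1] None (mk ms c.1) c.2 om
    else Some (typed_gen kidb n [:: c.1] None (mk ms c.1) (c.2, false) om)) | c <- ixs].

Lemma dm_typed_rtarget n ms i u : dm Iroots (typed_rtarget n ms i u).
Proof.
apply: dm_oflat => c _; case: (c.1 == i).
  have [dX _] := typed_target_law hp hd h_gt0 h_hu mkap u n None (mk ms c.1) c.2 (w := [:: c.1]) ltac:(by []).
  by apply: dmS dX => x ?; exists c.1.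
by apply: dm_comp; apply: dmS (@dm_root n None (mk ms c.1) c.1 (c.2, false)) => x ?; exists c.1.
Qed.

Lemma slot_zip (C : Type) (F G : nat * S -> C) i a (ys : seq S) :
  slot F G i (zip (iota a (size ys)) ys) =
  [seq (if c.1 == (a + i)%N then F c else G c) | c <- zip (iota a (size ys)) ys].
Proof.
elim: ys i a => //= y ys IH [|i] a /=.
  rewrite addn0 eqxx; congr (_ :: _); apply/eq_in_map => c cin.
  have : c.1 \in unzip1 (zip (iota a.+1 (size ys)) ys) by exact: map_f.
  rewrite unzip1_zip ?size_iota // mem_iota => /andP[ac _].
  by case: eqP => // e; rewrite e ltnn in ac.
rewrite -[X in X == _]addn0 eqn_add2l /=; congr (_ :: _).
by rewrite IH; apply: eq_map => c; rewrite addSnnS.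
Qed.

Lemma ixs_slot (C : Type) (F G : nat * S -> C) i :
  [seq (if c.1 == i then F c else G c) | c <- ixs] = slot F G i ixs.
Proof. by rewrite /ixs slot_zip; apply: eq_map => c; rewrite add0n. Qed.

Lemma Ex_typed_rtarget n ms i u f : Ex (typed_rtarget n ms i u) (oapp f 0) =
  convl (slot (fun c => target_law n u None (mk ms c.1) c.2)
    (fun c => gen_law n None (mk ms c.1) (c.2, false)) i ixs) f.
Proof.
rewrite -ixs_slot; apply: (Ex_roots (G := fun c => if c.1 == i then target_law n u None (mk ms c.1) c.2
  else gen_law n None (mk ms c.1) (c.2, false))) => [c _|c g _]; case: (c.1 == i).
- by have [] := typed_target_law hp hd h_gt0 h_hu mkap u n None (mk ms c.1) c.2 (w := [:: c.1]) ltac:(by []).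
- by apply: dm_comp; exact: dm_root.
- by have [_ ->] := typed_target_law hp hd h_gt0 h_hu mkap u n None (mk ms c.1) c.2 (w := [:: c.1]) ltac:(by []).
- rewrite -(Ex_root _ _ _ c.1).
  by rewrite (Ex_comp (@Some _) _ (@dm_root n None (mk ms c.1) c.1 (c.2, false))).
Qed.

(** The sum over addresses moves into the slot of root [i] by multilinearity, and [target_law_sum]
    applies there. *)
Lemma Ex_typed_rtarget_sum n ms i c0 f : (i < size xs)%N ->
  ESum (fun u => Ex (typed_rtarget n ms i u) (oapp f 0)) =
  hE h (nth c0 ixs i).2 * convl [seq gen_law n None (mk ms c.1) (c.2, c.1 == i) | c <- ixs] f.
Proof.
move=> si; have hV c : sum_linear (gen_law n None (mk ms c.1) (c.2, false)).
  by apply: sum_linear_gen_law => s; exact: sum_linear_offb.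
transitivity (ESum (fun u : W => 1 * convl (slot (fun c => target_law n u None (mk ms c.1) c.2)
    (fun c => gen_law n None (mk ms c.1) (c.2, false)) i ixs) f)).
  by apply: eq_ESum => u; rewrite Ex_typed_rtarget mul1r.
rewrite -(convl_slot_ESum (fun=> 1) (fun (u : W) (c : nat * S) => target_law n u None (mk ms c.1) c.2)) //;
  last by rewrite size_ixs.
have -> : (fun (c : nat * S) g => ESum (fun u : W => 1 * target_law n u None (mk ms c.1) c.2 g)) =
  (fun c g => hE h c.2 * gen_law n None (mk ms c.1) (c.2, true) g).
  apply/funext => c; apply/funext => g; rewrite -(target_law_sum hp hd h_gt0 h_hu mkap).
  by apply: eq_ESum => u; rewrite mul1r.
rewrite (convl_slot_mul (fun c => hE h c.2) (fun c => gen_law n None (mk ms c.1) (c.2, true)) c0) //;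
  last by rewrite size_ixs.
congr (_ * convl _ _); rewrite -ixs_slot; apply/eq_in_map => c _.
by case: (c.1 == i).
Qed.

Variables (rl : nat -> O -> R).
Hypothesis (rl_sig : forall i A, measurable A -> sig [set ([::], 0)] (rl i @^-1` A)).

(** Root labels come from a family [rl] determined by [U [::] 0]; this covers one root with a
    uniform label as well as several roots with prescribed labels. *)
Definition rmk om : seq K := [seq kap (rl c.1 om) | c <- ixs].

Lemma mk_rmk om c : c \in ixs -> mk (rmk om) c.1 = kap (rl c.1 om).
Proof.
move=> cin; rewrite /mk /rmk (nth_map c) ?size_ixs ?ixs_lt //.
congr (kap (rl _ om)).
have sc : (c.1 < size ixs)%N by rewrite size_ixs ixs_lt.
rewrite -(nth_map c 0%N fst sc).
by rewrite -/(unzip1 ixs) ixs_fst nth_iota ?ixs_lt.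
Qed.

Lemma dm_rmk : dm [set ([::], 0)] rmk.
Proof.
rewrite /rmk; elim: ixs => [|c cs IH]; first exact: dm_cst.
apply: (dm_comp (fun q => q.1 :: q.2) (X := fun om => (kap (rl c.1 om), [seq kap (rl c.1 om) | c <- cs]))).
apply: dm_pair => // k; exact: (rl_sig _ (mkap k)).
Qed.

Variable i0 : O -> nat.
Hypothesis (di0 : dm [set ([::], 1)] i0).

Lemma Ex_biased_roots n f :
  Ex (fun om => typed_rgen n (rmk om) (fun j => j == i0 om) om) f =
  Ex i0 (fun i => Ex rmk (fun ms =>
    convl [seq gen_law n None (mk ms c.1) (c.2, c.1 == i) | c <- ixs] f)).
Proof.
have I1 (x : idx) : [set ([::], 1)] x -> ~ (~` [set ([::], 1)]) x by move=> h1 h2; exact: h2.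
rewrite (Ex_bind (X := i0) (Y := fun i om => typed_rgen n (rmk om) (fun j => j == i) om) f I1 di0).
  apply: eq_ESum => i; congr (_ * _).
  have I2 (x : idx) : [set ([::], 0)] x -> ~ Iroots x by move=> ->; exact: Iroots_disj.
  rewrite (Ex_bind (X := rmk) (Y := fun ms => typed_rgen n ms (fun j => j == i)) f I2 dm_rmk).
    by apply: eq_ESum => ms; rewrite Ex_typed_rgen.
  by move=> ms _; exact: dm_typed_rgen.
move=> i _; apply: (dm_bind (X := rmk) (Y := fun ms => typed_rgen n ms (fun j => j == i))).
  by apply: dmS dm_rmk => x -> [].
move=> ms _; apply: dmS (@dm_typed_rgen _ _ _) => x rx e; rewrite e in rx; exact: Iroots_disj rx.
Qed.

Lemma Ex_target_roots n i u f :
  Ex (fun om => typed_rtarget n (rmk om) i u om) (oapp f 0) =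
  Ex rmk (fun ms => Ex (typed_rtarget n ms i u) (oapp f 0)).
Proof.
have I2 (x : idx) : [set ([::], 0)] x -> ~ Iroots x by move=> ->; exact: Iroots_disj.
rewrite (Ex_bind (X := rmk) (Y := fun ms => typed_rtarget n ms i u) _ I2 dm_rmk) //.
by move=> ms _; exact: dm_typed_rtarget.
Qed.

Definition Hs : ennr R := \sum_(x <- xs) hE h x.

Hypothesis (li0 : forall i, (i < size xs)%N ->
  forall c0, pr (i0 @^-1` [set i]) * Hs = hE h (nth c0 ixs i).2).
Hypothesis (ri0 : forall i, (size xs <= i)%N -> pr (i0 @^-1` [set i]) = 0).

(* [i0] is the blue root, and [(i, u)] addresses the element of H_B that colours the forest. *)
Theorem biased_target n f :
  Hs * Ex (fun om => typed_rgen n (rmk om) (fun j => j == i0 om) om) f =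
  ESum (fun i => (i < size xs)%N%:R * ESum (fun u =>
    Ex (fun om => typed_rtarget n (rmk om) i u om) (oapp f 0))).
Proof.
rewrite Ex_biased_roots -ESum_mull; apply: eq_ESum => i; rewrite mulrA.
have [si|si] := ltnP i (size xs); last by rewrite ri0 // mulr0 !mul0r.
rewrite mul1r; have [c0 _] : exists c0 : nat * S, True.
  by rewrite -size_ixs in si; case: ixs si => // c0 r _; exists c0.
rewrite [Hs * _]mulrC (li0 si c0).
transitivity (Ex rmk (fun ms => hE h (nth c0 ixs i).2 *
    convl [seq gen_law n None (mk ms c.1) (c.2, c.1 == i) | c <- ixs] f)); first by rewrite Ex_mull.
transitivity (Ex rmk (fun ms => ESum (fun u => Ex (typed_rtarget n ms i u) (oapp f 0)))).
  by apply: eq_ESum => ms; rewrite (Ex_typed_rtarget_sum n ms c0).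
by rewrite Ex_ESum; apply: eq_ESum => u; rewrite Ex_target_roots.
Qed.

End Marks.
End Roots.

(** * Label collisions and integrals off null sets *)

Lemma ESum_pickle (T : countType) (F : T -> ennr R) :
  enn_val (ESum F) = (\sum_(0 <= n <oo) (if @pickle_inv T n is Some t then enn_val (F t) else 0))%E.
Proof.
rewrite nneseries_esumT; last by move=> n; case: pickle_inv => // t; exact: enn_ge0.
rewrite ESum_val.
transitivity (\esum_(n in (@pickle T) @` setT) (if @pickle_inv T n is Some t then enn_val (F t) else 0)).
  rewrite esum_image; last by move=> s t _ _; exact: (pcan_inj pickleK).
  by apply: eq_esum => t _; rewrite pickleK_inv.
rewrite esum_mkcond; apply: eq_esum => n _; case: ifPn => //.
rewrite notin_setE; case e : pickle_inv => [t|//] h; exfalso; apply: h; exists t => //.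
by have := @pickle_invK T n; rewrite /oapp e.
Qed.

(** Monotone convergence turns the mean of a random count into a sum of probabilities. *)
Lemma integral_ESum_ind (T : countType) (E : T -> set O) : (forall t, measurable (E t)) ->
  let g om := enn_val (ESum (fun t => (`[< E t om >])%:R : ennr R)) in
  measurable_fun setT g /\ (\int[P]_om g om)%E = enn_val (ESum (fun t => pr (E t))).
Proof.
move=> mE g.
pose f n om : \bar R := if @pickle_inv T n is Some t then (\1_(E t) om)%:E else 0%E.
have fE om : g om = (\sum_(0 <= n <oo) f n om)%E.
  rewrite /g ESum_pickle; apply: eq_eseriesr => n _; rewrite /f.
  case: pickle_inv => [t|//]; rewrite enn_natr indicE.
  have [h|h] := pselect (E t om); first by rewrite asboolT // mem_set.
  by rewrite asboolF // memNset.
have mf n : measurable_fun setT (f n).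
  rewrite /f; case: pickle_inv => [t|]; last exact: measurable_cst.
  by apply/measurable_EFinP; exact: measurable_indic.
have f0 n om : (0 <= f n om)%E by rewrite /f; case: pickle_inv => // t; rewrite lee_fin.
have -> : g = fun om => (\sum_(0 <= n <oo) f n om)%E by exact/funext.
split; first by apply: ge0_emeasurable_sum => // n om _ _; exact: f0.
rewrite integral_nneseries // ESum_pickle; apply: eq_eseriesr => n _; rewrite /f.
case: pickle_inv => [t|]; last exact: integral0.
by rewrite integral_indic // setIT.
Qed.

Import HBNNSimple.

(* [f] and [g] need not be measurable: the number of elements of H_B and the colouring kernel are
   controlled only off the null event where two labels coincide. *)
Lemma le_integral_offnull (f g : O -> \bar R) (N : set O) : measurable N -> P N = 0%E ->
  (forall x, 0 <= f x)%E -> (forall x, 0 <= g x)%E -> (forall x, ~ N x -> f x = g x) ->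
  (\int[P]_om f om <= \int[P]_om g om)%E.
Proof.
move=> mN N0 f0 g0 fg; rewrite (ge0_integralTE _ f0) (ge0_integralTE _ g0).
apply: ge_ereal_sup => _ [k kf <-].
have mC : measurable (~` N) by exact: measurableC.
(* A simple function below [f], set to 0 on [N], lies below [g] and keeps its integral. *)
pose k' := proj_nnsfun k mC.
apply: (@le_trans _ _ (sintegral P k' : \bar R)); last first.
  apply: ereal_sup_ubound; exists k' => // x; rewrite (_ : k' x = k x * \1_(~` N) x) // indicE.
  have [Nx|Nx] := pselect (N x).
    by rewrite memNset ?mulr0 // => /(_ Nx).
  by rewrite mem_set // mulr1 -fg.
rewrite -!integralT_nnsfun le_eqVlt; apply/orP; left; apply/eqP.
apply: ge0_ae_eq_integral => //.
- by apply/measurable_EFinP.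
- by apply/measurable_EFinP.
- by move=> x _; rewrite lee_fin.
- by move=> x _; rewrite lee_fin.
exists N; split => // x /= h; apply: contrapT => Nx; apply: h => _.
by rewrite mindicE mem_set // mulr1.
Qed.

Lemma eq_integral_offnull (f g : O -> \bar R) (N : set O) : measurable N -> P N = 0%E ->
  (forall x, 0 <= f x)%E -> (forall x, 0 <= g x)%E -> (forall x, ~ N x -> f x = g x) ->
  (\int[P]_om f om = \int[P]_om g om)%E.
Proof.
move=> mN N0 f0 g0 fg; apply/eqP; rewrite eq_le.
rewrite (le_integral_offnull mN N0 f0 g0 fg) (le_integral_offnull mN N0 g0 f0) //.
by move=> x /fg.
Qed.

Lemma pr_null_ex (T : countType) (F : T -> set O) : (forall t, measurable (F t)) ->
  (forall t, pr (F t) = 0) -> pr [set w | exists t, F t w] = 0.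
Proof.
move=> mF F0; apply: enn_eq; apply/eqP; rewrite eq_le enn_ge0 andbT /=.
have nF : P.-negligible (\bigcup_n (if @pickle_inv T n is Some t then F t else set0)).
  apply: negligible_bigcup => n; case: pickle_inv => [t|]; last exact: negligible_set0.
  by apply/negligibleP => //; have /(congr1 (@enn_val R)) := F0 t.
have : P.-negligible [set w | exists t, F t w].
  apply: negligibleS nF => w [t Ft]; exists (pickle t) => //.
  by rewrite pickleK_inv.
by move/negligibleP => -> //; exact: measurable_ex.
Qed.

Lemma pr_offnull (N E E' : set O) : measurable N -> pr N = 0 -> measurable E -> measurable E' ->
  (forall x, ~ N x -> E x <-> E' x) -> pr E = pr E'.
Proof.
move=> mN N0 mE mE' ee.
have sub (A : set O) : measurable A -> pr A = pr (A `&` ~` N).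
  move=> mA.
  have e : A = (A `&` N) `|` (A `&` ~` N) by rewrite -setIUr setUv setIT.
  have AN : P (A `&` N) = 0%E.
    apply: (subset_measure0 _ _ _ (congr1 (@enn_val R) N0)) => //; first exact: measurableI.
  apply: enn_eq => /=; rewrite [in LHS]e measureU /=.
  - by rewrite AN add0e.
  - exact: measurableI.
  - by apply: measurableI => //; exact: measurableC.
  - by rewrite setIACA setICr setI0.
rewrite (sub _ mE) (sub _ mE'); congr pr; apply/seteqP; split => x [h1 h2]; split => //; exact/ee.
Qed.

(* Sums commute with the disjoint unions of increments, which are obtained by cancellation. *)
Lemma limit_exchange (c : ennr R) (E : (set O)^nat) (T : countType) (D : T -> (set O)^nat) :
  (enn_val c < +oo)%E -> (forall n, measurable (E n)) -> (forall t n, measurable (D t n)) ->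
  nondecreasing_seq E -> (forall t, nondecreasing_seq (D t)) ->
  (forall n, c * pr (E n) = ESum (fun t => pr (D t n))) ->
  c * pr (\bigcup_n E n) = ESum (fun t => pr (\bigcup_n D t n)).
Proof.
move=> cf mE mD ndE ndD H.
have mS (F : (set O)^nat) : (forall n, measurable (F n)) -> forall n, measurable (seqD F n).
  by move=> mF [|n] //=; exact: measurableD.
have S (F : (set O)^nat) : (forall n, measurable (F n)) -> nondecreasing_seq F ->
    pr (\bigcup_n F n) = ESum (fun n => pr (seqD F n)).
  move=> mF ndF; rewrite -eq_bigcup_seqD pr_bigcup //; first exact: mS.
  exact: trivIset_seqD.
have S1 (F : (set O)^nat) n : (forall n, measurable (F n)) -> nondecreasing_seq F ->
    pr (seqD F n.+1) + pr (F n) = pr (F n.+1).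
  move=> mF ndF; apply: enn_eq; rewrite enn_valD /= -measureU //.
  - by congr (P _); rewrite setUC setDUK //; apply/subsetPset; exact: ndF.
  - exact: measurableD.
  - by apply/seteqP; split => // x [[]].
rewrite S // -ESum_mull.
under [RHS]eq_ESum => t do rewrite (S _ (mD t) (ndD t)).
rewrite ESum_swap; apply: eq_ESum => -[|n]; first exact: H.
(* The increments are compared by adding the previous stage, whose value is finite, and cancelling
   it. *)
apply: (@enn_addIr _ (c * pr (E n))).
  rewrite enn_valM lte_mul_pinfty ?enn_ge0 ?ge0_fin_numE ?enn_ge0 //.
  exact: pr_lty.
rewrite -mulrDr S1 // H [in RHS]H -ESumD; apply: eq_ESum => t.
by rewrite S1.
Qed.

Lemma measurable_U w l : measurable_fun setT (U w l).
Proof. exact: iid.1. Qed.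

Lemma pr_U_point w l (a : R) : pr [set om | U w l om = a] = 0.
Proof.
apply: enn_eq; rewrite enn_val0.
have -> : [set om | U w l om = a] = U (w, l).1 (w, l).2 @^-1` [set a] by [].
rewrite pr_U; last exact: measurable_set1.
apply: (@subset_measure0 _ _ _ lebesgue_measure _ [set a]) => //.
- by apply: measurableI; [exact: measurable_set1|exact: measurable_itv].
- exact: lebesgue_measure_set1.
Qed.

(* Two independent uniforms fall into the same of [n.+1] subintervals of [0, 1] with probability
   at most [n.+1%:R^-1]. *)
Lemma pr_U_eq w l w' l' : (w, l) <> (w', l') -> pr [set om | U w l om = U w' l' om] = 0.
Proof.
move=> ne.
have mq : measurable [set om | U w l om = U w' l' om].
  by apply: measurable_eqR; exact: measurable_U.
have le n : (enn_val (pr [set om | U w l om = U w' l' om]) <= (n.+1%:R^-1)%:E)%E.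
  pose a i : R := i%:R / n.+1%:R.
  pose A i : set R := `[a i, a i.+1]%classic.
  pose F i := [set om | A i (U w l om)] `&` [set om | A i (U w' l' om)].
  have mA i : measurable (A i) by exact: measurable_itv.
  have mF i : measurable (F i).
    by apply: measurableI; apply: measurable_preim => //; exact: measurable_U.
  have n0 : (0 : R) < n.+1%:R by rewrite ltr0n.
  have lA i : (lebesgue_measure (A i `&` `[0%R, 1%R]) <= (n.+1%:R^-1)%:E)%E.
    apply: (@le_trans _ _ (lebesgue_measure (A i))).
      have mA' : measurable (A i `&` `[0%R, 1%R]) by apply: measurableI => //; exact: measurable_itv.
      by apply: le_measure; rewrite ?inE //; exact: mA.
    rewrite lebesgue_measure_itv /= lte_fin; case: ifP => _; last by rewrite lee_fin invr_ge0 ltW.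
    by rewrite -EFinB lee_fin /a -mulrBl -natrB // subSnn mul1r.
  have pF i : (P (F i) <= (n.+1%:R^-1 * n.+1%:R^-1)%:E)%E.
    have := @sig_indep [set (w, l)] [set (w', l')] (U w l @^-1` A i) (U w' l' @^-1` A i).
    move=> /(_ _ _ _)/(congr1 (@enn_val R)); rewrite enn_valM => e.
    have -> : P (F i) = enn_val (pr (U w l @^-1` A i `&` U w' l' @^-1` A i)) by [].
    rewrite e.
    - rewrite (@pr_U (w, l)) // (@pr_U (w', l')) // EFinM.
      by apply: lee_pmul.
    - by move=> x -> e'; apply: ne.
    - exact: (@sig_U _ (w, l)).
    - exact: (@sig_U _ (w', l')).
  (* The uniforms take values in [0, 1] only almost surely. *)
  have bad : pr (U w l @^-1` (~` `[0%R, 1%R])) = 0.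
    apply: enn_eq; rewrite (@pr_U (w, l) (~` `[0%R, 1%R])) ?setICl ?measure0 //.
    by apply: measurableC; exact: measurable_itv.
  have -> : pr [set om | U w l om = U w' l' om] =
      pr ([set om | U w l om = U w' l' om] `&` \big[setU/set0]_(i < n.+1) F i).
    apply: (@pr_offnull (U w l @^-1` (~` `[0%R, 1%R]))) => //.
    - rewrite -[X in measurable X]setTI; apply: measurable_U => //.
      by apply: measurableC; exact: measurable_itv.
    - by apply: measurableI => //; exact: bigsetU_measurable.
    move=> om /= h; have {h} : `[0%R, 1%R]%classic (U w l om) by apply: contrapT.
    rewrite /= in_itv /= => /andP[u0 u1]; split; last by case.
    move=> e; split => //; rewrite -bigcup_mkord.
    pose j := Num.truncn (U w l om * n.+1%:R).
    have x0 : 0 <= U w l om * n.+1%:R by rewrite mulr_ge0 // ltW.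
    have /andP[j1 j2] := truncn_itv x0.
    have key i : i%:R <= U w l om * n.+1%:R -> U w l om * n.+1%:R <= i.+1%:R -> F i om.
      move=> i1 i2; have Ai : A i (U w l om) by rewrite /A /= in_itv /= /a ler_pdivrMr // i1 ler_pdivlMr.
      by split => //=; rewrite -e.
    have [jn|jn] := ltnP j n.+1; first by exists j => //; apply: key => //; exact: ltW.
    (* When the uniform equals 1 the truncation gives [n.+1]; the point then belongs to the last
       interval, which is closed. *)
    suff Fn : F n om by exists n => /=.
    apply: key.
      apply: le_trans j1; rewrite ler_nat; exact: ltnW.
    by rewrite -[leRHS]mul1r ler_wpM2r // ltW.
  apply: (@le_trans _ _ (P (\big[setU/set0]_(i < n.+1) F i))).
    have mU : measurable (\big[setU/set0]_(i < n.+1) F i) by exact: bigsetU_measurable.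
    by apply: le_measure; rewrite ?inE //; exact: measurableI.
  apply: le_trans (@le_mu_bigsetU _ _ _ P F n.+1 (fun i _ => mF i)) _.
  apply: (@le_trans _ _ (\sum_(i < n.+1) (n.+1%:R^-1 * n.+1%:R^-1)%:E)%E).
    by apply: lee_sum => i _; exact: pF.
  rewrite sumEFin lee_fin sumr_const card_ord -[leLHS]mulr_natl mulrA divff ?mul1r //.
apply: enn_eq; apply/eqP; rewrite eq_le enn_ge0 andbT enn_val0.
apply/lee_addgt0Pr => e e0; rewrite add0e.
have [n] : exists n, n.+1%:R^-1 < e.
  exists (Num.truncn e^-1); rewrite invf_plt ?posrE ?ltr0n //.
  exact: truncnS_gt.
by move=> /ltW ne'; apply: le_trans (le n) _; rewrite lee_fin.
Qed.

(** * Enumerating a forest generation by generation *)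

Section Enumeration.
Variable S : countType.
Local Notation W := (seq nat).
Local Notation St := (S * bool)%type.

Lemma uniq_flatten_map (C T : eqType) (F : C -> seq T) (cs : seq C) : uniq cs ->
  (forall c, c \in cs -> uniq (F c)) ->
  (forall c c' x, c \in cs -> c' \in cs -> x \in F c -> x \in F c' -> c = c') ->
  uniq (flatten [seq F c | c <- cs]).
Proof.
elim: cs => //= c cs IH /andP[cn uc] uF dF; rewrite cat_uniq uF ?mem_head //=.
rewrite IH //; last first.
- by move=> c1 c2 x h1 h2; apply: dF; rewrite inE ?h1 ?h2 orbT.
- by move=> c1 h1; apply: uF; rewrite inE h1 orbT.
rewrite andbT; apply/hasPn => x /flattenP[_ /mapP[c' c'in ->] xc']; apply/negP => xc.
have e : c = c' by apply: (dF c c' x); rewrite ?mem_head // inE c'in orbT.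
by rewrite e c'in in cn.
Qed.

Section Generations.
Variables (kid : W -> St -> O -> seq (W * St)) (reg : W -> set W) (par : W -> option W)
  (vld : W -> St -> Prop).
Hypotheses (rok : reg_ok reg par) (kok : kid_ok kid par vld).

Lemma gen_sub n w s om : {subset gen kid n w s om <= gen kid n.+1 w s om}.
Proof.
elim: n w s => [//|n IH] w s q; rewrite [gen kid n.+1 _ _ _]/= inE => /orP[/eqP ->|].
  by rewrite /= mem_head.
move=> /flattenP[_ /mapP[c cin ->] qc]; rewrite [gen kid n.+2 _ _ _]/= inE; apply/orP; right.
by apply/flattenP; exists (gen kid n.+1 c.1 c.2 om); [exact: map_f|exact: IH].
Qed.

Lemma gen_reg n w s om q : vld w s -> q \in gen kid n w s om -> reg w q.1.
Proof.
elim: n w s => [//|n IH] w s v; rewrite /= inE => /orP[/eqP ->|]; first exact: (reg_refl rok).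
move=> /flattenP[_ /mapP[c cin ->] qc].
have h := IH _ _ (kid_vld kok v cin) qc.
by have [] := reg_sub rok (kid_par kok v cin) h.
Qed.

Lemma uniq_gen n w s om : vld w s -> uniq (unzip1 (gen kid n w s om)).
Proof.
elim: n w s => [//|n IH] w s v /=; rewrite /unzip1 map_flatten -map_comp.
apply/andP; split.
  apply/flattenP => -[_ /mapP[c cin ->] /mapP[q qc e]].
  have h := gen_reg (kid_vld kok v cin) qc.
  by have [_] := reg_sub rok (kid_par kok v cin) h; rewrite e.
apply: uniq_flatten_map; first exact: (kid_uniq' kok).
- by move=> c cin; apply: IH; exact: (kid_vld kok v cin).
- move=> c c' x cin c'in /= /mapP[q qc e] /mapP[q' qc' e'].
  have h := gen_reg (kid_vld kok v cin) qc; have h' := gen_reg (kid_vld kok v c'in) qc'.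
  rewrite -e in h; rewrite -e' in h'.
  apply/eqP; apply: contrapT => /negP ne; apply: (kid_neq kok v cin c'in ne).
  exact: (reg_disj rok (kid_par kok v cin) (kid_par kok v c'in) h h').
Qed.

Lemma dm_gen n w s : vld w s -> dm setT (gen kid n w s).
Proof.
elim: n w s => [|n IH] w s v; first exact: dm_cst.
apply: (dm_bind (X := kid w s) (Y := fun cs om => (w, s) :: flatten [seq gen kid n c.1 c.2 om | c <- cs])).
  by apply: dmS (kid_dm kok v).
move=> cs [om ocs]; apply: (dm_comp (cons (w, s))); apply: dm_flatten => c.
by rewrite -ocs => cin; apply: IH; exact: (kid_vld kok v cin).
Qed.

Lemma typed_gen_typ (K : countType) (kap : R -> K) (lb : W -> R) om n w s : vld w s ->
  (forall v v', par v = Some v' -> lb v = U v 0 om) ->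
  typed_gen kid kap n w (omap (fun v => kap (lb v)) (par w)) (kap (lb w)) s om =
  [seq (omap (fun v => kap (lb v)) (par q.1), kap (lb q.1), q.2) | q <- gen kid n w s om].
Proof.
move=> v hl; elim: n w s v => [//|n IH] w s v /=; congr (_ :: _).
rewrite map_flatten -map_comp; congr flatten; apply/eq_in_map => c cin /=.
have pc := kid_par kok v cin.
by rewrite -IH ?pc /= ?(hl _ _ pc) //; exact: (kid_vld kok v cin).
Qed.

End Generations.

(* A random forest given by increasing finite lists of labelled individuals. *)
Section EnumForest.
Variables (lb : W -> O -> R) (par : W -> option W) (D : pred W) (Ln : nat -> O -> seq (W * St)).
Hypotheses (lb_sig : forall w A, measurable A -> sig setT (lb w @^-1` A))
  (lb_null : forall w w', D w -> D w' -> w != w' -> pr [set om | lb w om = lb w' om] = 0)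
  (dLn : forall n, dm setT (Ln n))
  (Ln_sub : forall n om, {subset Ln n om <= Ln n.+1 om})
  (Ln_uniq : forall n om, uniq (unzip1 (Ln n om)))
  (Ln_D : forall n om q, q \in Ln n om -> D q.1).

Lemma measurable_lb w : measurable_fun setT (lb w).
Proof. by move=> _ A mA; rewrite setTI; exact: sig_measurable (lb_sig w mA). Qed.

(** Restricted to words in [D], because words that never occur may share a default label (see
    [lbr]). *)
Definition collision : set O :=
  [set om | exists ww : W * W, [/\ D ww.1, D ww.2, ww.1 != ww.2 & lb ww.1 om = lb ww.2 om]].

Let collE : collision = [set om | exists ww : W * W,
  (if [&& D ww.1, D ww.2 & ww.1 != ww.2] then [set om | lb ww.1 om = lb ww.2 om] else set0) om].
Proof.
apply/seteqP; split => om [ww].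
  by move=> [h1 h2 h3 h4]; exists ww; rewrite h1 h2 h3.
by case: ifP => // /and3P[h1 h2 h3] h4; exists ww.
Qed.

Lemma measurable_collision : measurable collision.
Proof.
rewrite collE; apply: measurable_ex => ww; case: ifP => // _.
by apply: measurable_eqR; exact: measurable_lb.
Qed.

Lemma pr_collision : pr collision = 0.
Proof.
rewrite collE; apply: pr_null_ex => ww; case: ifP => //.
- by move=> _; apply: measurable_eqR; exact: measurable_lb.
- by move=> /and3P[h1 h2 h3]; exact: lb_null.
- by move=> _; exact: pr0.
Qed.

Lemma lb_inj om w w' : ~ collision om -> D w -> D w' -> lb w om = lb w' om -> w = w'.
Proof.
by move=> nc h1 h2 e; apply: contrapT => /eqP ne; apply: nc; exists (w, w').
Qed.

Definition eforest : O -> set (CInd R S) :=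
  wforest lb par (fun w s om => exists n, (w, s) \in Ln n om).

Lemma eforest_measurable A : <<s @inter_gen S >> A -> measurable (eforest @^-1` A).
Proof.
apply: wforest_measurable; first exact: measurable_lb.
move=> w s; apply: measurable_ex => n.
by have := @measurable_dm_pred setT _ (Ln n) (fun l => (w, s) \in l) (dLn n).
Qed.

Definition eprofile cs n om := profile cs 0 (map (typ (lb^~ om) par (label_class cs)) (Ln n om)).

Lemma dm_eprofile (cs : seq (spec S)) n : specs_ok cs ->
  dm setT (fun om => map (typ (lb^~ om) par (label_class cs)) (Ln n om)).
Proof.
move=> ok; have mk := measurable_label_class ok.
apply: (dm_bind (X := Ln n) (Y := fun l om => map (typ (lb^~ om) par (label_class cs)) l)) => // l _.
have dk w : dm setT (fun om => label_class cs (lb w om)) by move=> k; exact: (lb_sig w (mk k)).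
elim: l => [|q l IH]; first exact: dm_cst.
apply: (dm_comp (fun q => q.1 :: q.2) (X := fun om => (typ (lb^~ om) par (label_class cs) q,
  map (typ (lb^~ om) par (label_class cs)) l))).
apply: dm_pair => //; rewrite /typ.
case: (par q.1) => [v|] /=.
  apply: (dm_comp (fun x => (Some x.1, x.2, q.2)) (X := fun om => (label_class cs (lb v om), label_class cs (lb q.1 om)))).
  exact: dm_pair.
exact: (dm_comp (fun x => (None, x, q.2)) (X := fun om => label_class cs (lb q.1 om))).
Qed.

Lemma measurable_eprofile cs n : specs_ok cs -> measurable [set om | eprofile cs n om].
Proof. by move=> ok; exact: (measurable_dm_pred (fun l => profile cs 0 l) (dm_eprofile n ok)). Qed.

Lemma pr_eprofile cs n : specs_ok cs -> pr [set om | eprofile cs n om] =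
  Ex (fun om => map (typ (lb^~ om) par (label_class cs)) (Ln n om)) (fun l => (profile cs 0 l)%:R).
Proof.
move=> ok; rewrite (pr_dm (fun l => profile cs 0 l) (dm_eprofile n ok)).
by apply: eq_ESum => l; congr (_ * _%:R); rewrite asboolb.
Qed.

Lemma eprofile_mono cs om : ~ collision om ->
  forall m n, (m <= n)%N -> eprofile cs m om -> eprofile cs n om.
Proof.
move=> nc m n mn; rewrite /eprofile; exact: (@profile_mono S (lb^~ om) par (fun n => Ln n om)).
Qed.

Lemma eforest_inter cs om : ~ collision om ->
  inter cs (eforest om) <-> exists n, eprofile cs n om.
Proof.
move=> nc; rewrite /eprofile.
apply: (@inter_profile S (lb^~ om) par (fun n => Ln n om)) => //.
  by move=> k q q' h1 h2; apply: (lb_inj nc); exact: Ln_D h1 || exact: Ln_D h2.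
move=> c k; rewrite wforest_atleast.
by split => -[l [h1 h2 h3]]; exists l; split => // -[w s] /h3.
Qed.

(** Removing the collisions from each stage changes no probability and makes the events increase
    with [n], as [limit_exchange] requires. *)
Lemma pr_eforest cs (Q : set O) : specs_ok cs -> measurable Q ->
  pr (Q `&` eforest @^-1` (inter cs)) =
  pr (\bigcup_n (Q `&` ([set om | eprofile cs n om] `\` collision))).
Proof.
move=> ok mQ; have mc := measurable_collision.
apply: (pr_offnull mc pr_collision).
- apply: measurableI => //; apply: eforest_measurable; apply: sub_sigma_algebra.
  by exists cs.
- apply: bigcupT_measurable => n; apply: measurableI => //; apply: measurableD => //.
  exact: measurable_eprofile.
move=> om nc; split.
  by move=> [Qo /(eforest_inter cs nc)[n hn]]; exists n.
by move=> [n _ [Qo [hn _]]]; split => //; apply/(eforest_inter cs nc); exists n.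
Qed.

Lemma pr_eprofileD cs n (Q : set O) : specs_ok cs -> measurable Q ->
  pr (Q `&` ([set om | eprofile cs n om] `\` collision)) = pr (Q `&` [set om | eprofile cs n om]).
Proof.
move=> ok mQ; have mc := measurable_collision; have me := measurable_eprofile n ok.
apply: (pr_offnull mc pr_collision).
- by apply: measurableI => //; exact: measurableD.
- exact: measurableI.
by move=> om nc; split => [[Qo []]|[Qo ho]].
Qed.

Lemma eprofileD_mono cs (Q : set O) :
  nondecreasing_seq (fun n => Q `&` ([set om | eprofile cs n om] `\` collision)).
Proof.
move=> m n mn; apply/subsetPset => om [Qo [hm nc]]; split => //; split => //.
exact: eprofile_mono hm.
Qed.

End EnumForest.
End Enumeration.

(** * Words and addresses in the white forest *)

Section WhiteForest.
Variables (S : countType) (p : S -> S -> R) (d : S -> nat -> R) (B : seq S).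
Hypotheses (hp : stochastic p) (hd : offspring_laws d).
Local Notation W := (seq nat).
Local Notation St := (S * bool)%type.
Local Notation hit := (hit p d B).
Local Notation kidT := (kidT p d).
Local Notation wkid := (wkid p d).

Definition kidw (w : W) (s : St) om : seq (W * St) := wkid w s.1 om.

Fixpoint wnode (u w : W) (z : S) om : option S :=
  match u with
  | [::] => Some z
  | i :: u' => if onth (wkid w z om) i is Some c then wnode u' c.1 c.2.1 om else None
  end.

Lemma wkid_onth w z om i c : onth (wkid w z om) i = Some c -> c = (rcons w i, (c.2.1, false)).
Proof.
rewrite /wkid onth_map; set N := odflt _ _ => e.
have iN : (i < N)%N.
  rewrite ltnNge; apply/negP => Ni; move: e; rewrite onth_default //.
  by rewrite size_iota.
by move: e; rewrite (onthE (iota 0 N)) (nth_map 0%N) ?size_iota // nth_iota //= => -[<-].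
Qed.

Lemma node_white h u w z om :
  node p d B h U w (z, false) u om = omap (fun z' => (z', false)) (wnode u w z om).
Proof.
elim: u w z => [//|i u IH] w z.
rewrite [LHS]/= [wnode _ _ _ _]/= -(kidb_snd p d B h w (z, false) om) kidb_white // onth_map.
case e : (onth (wkid w z om) i) => [c|//].
by rewrite (wkid_onth e) /= IH.
Qed.

(** Translates the recursion along an address, used by [bmc_forest], into the enumeration by
    generations, used for the laws. *)
Lemma mem_gen_node h n w s om q : q \in gen (kidb p d B h) n w s om <->
  exists u, [/\ q.1 = w ++ u, (size u < n)%N & node p d B h U w s u om = Some q.2].
Proof.
elim: n w s => [|n IH] w s; first by split => // -[u []].
rewrite [gen _ _ _ _ _]/= inE; split.
  move=> /orP[/eqP ->|]; first by exists [::]; rewrite cats0.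
  move=> /flattenP[_ /mapP[c /kidb_onth[j [c1 c2]] ->] /IH [u [q1 su nu]]].
  by exists (j :: u); rewrite q1 c1 cat_rcons; split => //=; rewrite c2 -c1.
move=> [[|i u] [q1 su]] /=.
  by move=> [e]; rewrite [q]surjective_pairing q1 -e cats0 eqxx.
case e : onth => [s'|//] nu; apply/orP; right; apply/flattenP.
exists (gen (kidb p d B h) n (rcons w i) s' om).
  apply/mapP; exists (rcons w i, s') => //; apply/kidb_onth; exists i; split => //.
by apply/IH; exists u; rewrite q1 cat_rcons.
Qed.

Lemma gen_white h n w z om : gen (kidb p d B h) n w (z, false) om = gen kidw n w (z, false) om.
Proof.
elim: n w z => [//|n IH] w z /=; rewrite kidb_white // /kidw; congr (_ :: flatten _).
by apply/eq_in_map => c /wkid_mem[j [_ c2]]; rewrite [c.2]surjective_pairing c2 IH.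
Qed.

Lemma gen_kidT T n w z b om : gen (kidT T) n w (z, prefix w T) om =
  [seq (q.1, (q.2.1, prefix q.1 T)) | q <- gen kidw n w (z, b) om].
Proof.
elim: n w z b => [//|n IH] w z b /=; congr (_ :: _).
rewrite map_flatten /kidT /kidw -!map_comp; congr flatten; apply/eq_in_map => c cin /=.
by rewrite (IH _ _ false).
Qed.

Lemma kidT_ok T : kid_ok (kidT T) parb (@vldb S).
Proof.
split.
- move=> w s om c w0 /mapP[c' /wkid_mem[j [-> _]] ->]; rewrite /vldb /=; by case: (w).
- by move=> w s om c w0 /mapP[c' /wkid_mem[j [-> _]] ->]; exact: parb_rcons.
- move=> w s om _; rewrite /unzip1 -map_comp (eq_map (g := fst)) //.
  rewrite -/(unzip1 _) wkid_fst map_inj_uniq ?iota_uniq // => i j.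
  by move/rcons_inj => [].
- move=> w s w0; apply: (@dmS (Kw w)); first exact: Kw_Kxb.
  apply: (dm_comp (fun l : seq (W * St) => [seq (c.1, (c.2.1, prefix c.1 T)) | c <- l]) (X := wkid w s.1)).
  exact: dm_wkid.
Qed.

Lemma hitP u w z om : hit u w z om <-> exists z', [/\ wnode u w z om = Some z', z' \in B &
  forall u1 z1, prefix u1 u -> u1 <> u -> wnode u1 w z om = Some z1 -> z1 \notin B].
Proof.
elim: u w z => [|i u IH] w z /=.
  split; last by move=> [z' [[->]]].
  by move=> zB; exists z; split => // -[].
case e : onth => [c|]; last first.
  by rewrite andbF; split => // -[z' []].
split.
  move=> /andP[zB /IH [z' [h1 h2 h3]]]; exists z'; split => // -[|i1 u1] z1 /=; first by move=> _ _ [<-].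
  move=> /andP[/eqP -> pu] ne; rewrite e; apply: h3 => // e1; apply: ne; by rewrite e1.
move=> [z' [h1 h2 h3]]; apply/andP; split; first by apply: (h3 [::] z).
apply/IH; exists z'; split => // u1 z1 pu ne h4; apply: (h3 (i :: u1)) => /=.
- by rewrite eqxx.
- by move=> [].
- by rewrite e.
Qed.

Lemma wnode_rcons u w z om i z' : wnode (rcons u i) w z om = Some z' ->
  exists z1, wnode u w z om = Some z1.
Proof.
elim: u w z => [|j u IH] w z /=; first by exists z.
by case: onth => [c|//]; exact: IH.
Qed.

Section Roots.
Variable xs : seq S.
Local Notation ixs := (ixs xs).

Lemma mem_ixs c : c \in ixs <-> onth xs c.1 = Some c.2.
Proof.
split.
  move=> cin; have [i si e] := nthP c cin; rewrite size_ixs in si.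
  move: e; rewrite /ixs [c in nth c]surjective_pairing nth_zip ?size_iota // nth_iota // add0n => e.
  rewrite -e /= (onthE xs i) (nth_map c.2) //.
move=> e; have sj : (c.1 < size xs)%N by rewrite ltnNge; apply/negP => /onth_default; rewrite e.
apply/(nthP c); exists c.1; rewrite ?size_ixs //.
rewrite /ixs [c in nth c]surjective_pairing nth_zip ?size_iota // nth_iota // add0n.
rewrite [RHS]surjective_pairing; congr (_, _).
by move: e; rewrite (onthE xs c.1) (nth_map c.2) // => -[].
Qed.

Definition rgen (kid : W -> St -> O -> seq (W * St)) n (bc : nat -> bool) om : seq (W * St) :=
  flatten [seq gen kid n [:: c.1] (c.2, bc c.1) om | c <- ixs].

Definition wordb : pred W := fun w => if w is i :: _ then (i < size xs)%N else false.

Lemma rgen_sub kid n bc om : {subset rgen kid n bc om <= rgen kid n.+1 bc om}.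
Proof.
move=> q /flattenP[_ /mapP[c cin ->] qc]; apply/flattenP.
exists (gen kid n.+1 [:: c.1] (c.2, bc c.1) om); first exact: map_f.
exact: gen_sub.
Qed.

Section KidOk.
Variable kid : W -> St -> O -> seq (W * St).
Hypothesis kok : kid_ok kid parb (@vldb S).

Lemma rgen_wordb n bc om q : q \in rgen kid n bc om -> wordb q.1.
Proof.
move=> /flattenP[_ /mapP[c cin ->] qc].
have := gen_reg regb_ok kok (w := [:: c.1]) (s := (c.2, bc c.1)) ltac:(by []) qc.
by rewrite /regb /=; case: q.1 => //= a u /andP[/eqP <- _]; exact: ixs_lt.
Qed.

Lemma rgen_uniq n bc om : uniq (unzip1 (rgen kid n bc om)).
Proof.
rewrite /unzip1 map_flatten -map_comp; apply: uniq_flatten_map; first exact: ixs_uniq.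
  by move=> c _; exact: (uniq_gen regb_ok kok).
move=> c c' w cin c'in /= /mapP[q qc ->] /mapP[q' qc' e].
have := gen_reg regb_ok kok (w := [:: c.1]) (s := (c.2, bc c.1)) ltac:(by []) qc.
have := gen_reg regb_ok kok (w := [:: c'.1]) (s := (c'.2, bc c'.1)) ltac:(by []) qc'.
rewrite -e /regb /=; case: q.1 => //= a u /andP[/eqP h1 _] /andP[/eqP h2 _].
by apply/eqP; apply: contrapT => /negP ne; apply: (ixs_neq cin c'in ne); rewrite h1 h2.
Qed.

Lemma dm_rgen n (bc : O -> nat -> bool) (T : countType) (X : O -> T) (f : T -> nat -> bool) :
  dm setT X -> (forall om, bc om = f (X om)) -> dm setT (fun om => rgen kid n (bc om) om).
Proof.
move=> dX hbc.
have -> : (fun om => rgen kid n (bc om) om) = (fun om => (fun t om => rgen kid n (f t) om) (X om) om).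
  by apply/funext => om; rewrite hbc.
apply: (dm_bind (Y := fun t om => rgen kid n (f t) om)) => // t _.
by apply: dm_flatten => c _; exact: (dm_gen kok).
Qed.

Variable rl : nat -> O -> R.

(** The value 0 for a root word beyond the list repeats the default in [bmc_forest]. *)
Definition lbr (w : W) om : R :=
  if w is [:: i] then (if (i < size xs)%N then rl i om else 0) else U w 0 om.

Lemma lbr_big w om : (1 < size w)%N -> lbr w om = U w 0 om.
Proof. by case: w => [//|i [|]]. Qed.

Lemma typed_rgen_typ (K : countType) (kap : R -> K) n bc om :
  flatten [seq typed_gen kid kap n [:: c.1] None (mk kap (rmk xs kap rl om) c.1) (c.2, bc c.1) om | c <- ixs] =
  [seq (omap (fun v => kap (lbr v om)) (parb q.1), kap (lbr q.1 om), q.2) | q <- rgen kid n bc om].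
Proof.
rewrite /rgen map_flatten -map_comp; congr flatten; apply/eq_in_map => c cin /=.
rewrite (mk_rmk _ _ _ cin) -(typed_gen_typ kok) //; last first.
  by move=> v v' /parbP[v0 [j ->]]; rewrite lbr_big // size_rcons; case: v' v0.
by rewrite /lbr /= ixs_lt.
Qed.

End KidOk.

Lemma bmc_wforest h rl bc om :
  bmc_forest p d B h U [seq (rl c.1 om, (c.2, bc c.1)) | c <- ixs] om =
  wforest (lbr rl) parb (fun w s om => exists n, (w, s) \in rgen (kidb p d B h) n bc om) om.
Proof.
have on i : onth [seq (rl c.1 om, (c.2, bc c.1)) | c <- ixs] i =
    omap (fun x => (rl i om, (x, bc i))) (onth xs i).
  rewrite onth_map; case e : (onth xs i) => [x|] /=.
    have si : (i < size xs)%N by rewrite ltnNge; apply/negP => /onth_default; rewrite e.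
    rewrite (onthE ixs i) (nth_map (i, x)) ?size_ixs // /ixs nth_zip ?size_iota // nth_iota //=.
    by rewrite add0n; move: e; rewrite (onthE xs i) (nth_map x) // => -[->].
  by rewrite onth_default // size_ixs -onthNE e.
have lab i u x : onth xs i = Some x ->
   match i :: u with
   | [:: i] => if onth [seq (rl c.1 om, (c.2, bc c.1)) | c <- ixs] i is Some r then r.1 else 0
   | _ => U (i :: u) 0 om end = lbr rl (i :: u) om.
  move=> e; case: u => [|//]; rewrite on e /=.
  by rewrite ifT // ltnNge; apply/negP => /onth_default; rewrite e.
apply/seteqP; split.
- move=> [[[pa l] z] b] [i [u [r]]]; rewrite on; case e : (onth xs i) => [x|] /= [er [nd [h1 h2]]]; last by [].
  move: er => [er]; subst r; simpl in nd.
  have hl : l = lbr rl (i :: u) om by rewrite h1 -(lab i u x e) on e.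
  exists (i :: u, (z, b)); split.
    exists (size u).+1; apply/flattenP.
    exists (gen (kidb p d B h) (size u).+1 [:: i] (x, bc i) om).
      by apply/mapP; exists (i, x) => //; apply/mem_ixs.
    by apply/mem_gen_node; exists u.
  rewrite /ind -hl; congr (_, _, _, _).
  case: u nd h2 {hl h1} => [|j u] nd h2; first exact: h2.
  exact: (etrans h2 (congr1 Some (lab i (take (size u) (j :: u)) x e))).
- move=> _ [[w [z b]] [[n /flattenP[_ /mapP[[i x] /mem_ixs /= e ->] /mem_gen_node[u [/= -> su nd]]]]]] ->.
  have si : (i < size xs)%N by rewrite ltnNge; apply/negP => /onth_default; rewrite e.
  exists i, u, (rl i om, (x, bc i)); rewrite on e; split => //; split => //=; split.
    by case: u {su nd} => [|//]; rewrite si.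
  case: u su nd => [//|j u] su nd; rewrite /parb /=; congr Some.
  by case: take => [|//]; rewrite si on e.
Qed.

End Roots.
End WhiteForest.

(** * Colouring the white forest *)

Section Target.
Variables (S : countType) (p : S -> S -> R) (d : S -> nat -> R) (B : seq S) (xs : seq S)
  (rl : nat -> O -> R).
Local Notation W := (seq nat).
Local Notation hit := (hit p d B).
Local Notation wnode := (wnode p d).
Local Notation kidw := (kidw p d).
Local Notation kidT := (kidT p d).
Local Notation lb := (lbr xs rl).
Local Notation rgen := (rgen xs).

Definition loc (T : W) om : option S :=
  if T is i :: u then obind (fun x => wnode u [:: i] x om) (onth xs i) else None.

(* [hitT T] says that the individual with word [T] belongs to H_B. *)
Definition hitT (T : W) om : bool :=
  if T is i :: u then (if onth xs i is Some x then hit u [:: i] x om else false) else false.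

Definition whiteF : O -> set (CInd R S) :=
  eforest lb parb (fun n om => rgen kidw n (fun=> false) om).

Definition targetF (T : W) : O -> set (CInd R S) :=
  eforest lb parb (fun n om => rgen (kidT T) n (fun j => j == head 0%N T) om).

Lemma mem_rgen_white n om q : q \in rgen kidw n (fun=> false) om <->
  [/\ loc q.1 om = Some q.2.1, q.2.2 = false & (size q.1 <= n)%N].
Proof.
split.
  move=> /flattenP[_ /mapP[c /mem_ixs ec ->]].
  rewrite -(gen_white p d B (fun=> 0)) => /mem_gen_node[u [-> su]].
  rewrite node_white /= ec /=; case: wnode => [z|//] /= [<-].
  by split.
case: q => [[|i u] [z b]] /= []; first by [].
case e : (onth xs i) => [x|//] /= ex -> su; apply/flattenP.
exists (gen kidw n [:: i] (x, false) om); first by apply/mapP; exists (i, x) => //; exact/mem_ixs.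
rewrite -(gen_white p d B (fun=> 0)); apply/mem_gen_node; exists u; split => //.
by rewrite node_white ex.
Qed.

Lemma loc_wordb w om z : loc w om = Some z -> wordb xs w.
Proof.
case: w => //= i u; case e : (onth xs i) => [x|//] _.
by rewrite ltnNge; apply/negP => /onth_default; rewrite e.
Qed.

Lemma loc_rcons w j om z : w <> [::] -> loc (rcons w j) om = Some z -> exists z', loc w om = Some z'.
Proof. by case: w => //= i u _; case: (onth xs i) => //= x; exact: wnode_rcons. Qed.

Lemma rgen_kidT T n om : T <> [::] ->
  rgen (kidT T) n (fun j => j == head 0%N T) om =
  [seq (q.1, (q.2.1, prefix q.1 T)) | q <- rgen kidw n (fun=> false) om].
Proof.
move=> T0; rewrite /rgen map_flatten -map_comp; congr flatten; apply/eq_in_map => c _ /=.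
rewrite -gen_kidT; congr (gen _ _ _ (_, _) _).
by case: T T0 => //= a T _; rewrite prefix0s andbT.
Qed.

Lemma hitTP T om : hitT T om <-> exists z, [/\ loc T om = Some z, z \in B &
  forall w1 z1, prefix w1 T -> w1 <> T -> loc w1 om = Some z1 -> z1 \notin B].
Proof.
case: T => [|i u] /=; first by split => // -[z []].
case e : (onth xs i) => [x|] /=; last by split => // -[z []].
rewrite hitP; split => -[z [h1 h2 h3]]; exists z; split => //.
  move=> [|i1 u1] z1 //= /andP[/eqP -> pu] ne; rewrite e /=; apply: h3 => // eu.
  by apply: ne; rewrite eu.
move=> u1 z1 pu ne h4; apply: (h3 (i :: u1)) => /=.
- by rewrite eqxx.
- by move=> [].
- by rewrite e.
Qed.

Lemma proper_prefix_size (w1 w : W) : prefix w1 w -> w1 <> w -> (size w1 < size w)%N.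
Proof.
move=> /prefixP[s ->] ne; rewrite size_cat -[ltnLHS]addn0 ltn_add2l.
by case: s ne => //; rewrite cats0.
Qed.

Section Good.
Variable om : O.
Hypothesis nc : ~ collision lb (wordb xs) om.
Let t : set (Ind R S) := uncolour (whiteF om).
Let vt (w : W) (z : S) : Ind R S := (omap (lb^~ om) (parb w), lb w om, z).

Lemma treeP v : t v <-> exists w z, loc w om = Some z /\ v = vt w z.
Proof.
split.
  move=> [c [[w [z b]] [[n /mem_rgen_white[/= h1 h2 h3]] ->]] <-].
  by exists w, z.
move=> [w [z [h ->]]]; exists (ind lb parb om (w, (z, false))) => //.
by exists (w, (z, false)); split => //; exists (size w); apply/mem_rgen_white.
Qed.

Lemma vt_inj w z w' z' : loc w om = Some z -> loc w' om = Some z' ->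
  vt w z = vt w' z' -> w = w'.
Proof. by move=> h h' [_ e _]; apply: (lb_inj nc (loc_wordb h) (loc_wordb h') e). Qed.

Lemma strict_ancP w z a : loc w om = Some z ->
  strict_anc t (vt w z) a <->
  exists w1 z1, [/\ loc w1 om = Some z1, a = vt w1 z1, prefix w1 w & w1 <> w].
Proof.
move=> lw; split.
  have H x y : clos_trans _ (pred_of t) x y -> forall w z, loc w om = Some z -> x = vt w z ->
      exists w1 z1, [/\ loc w1 om = Some z1, y = vt w1 z1, prefix w1 w & w1 <> w].
    move=> c; elim: c => {x y} [x y [/treeP[w1 [z1 [l1 ->]]] e]|x y1 y _ IH1 _ IH2] {lw}w {}z lw ex.
      move: e; rewrite ex /=; case e : (parb w) => [w'|//] /= [e1].
      have [w'0 [j ew]] := parbP e.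
      have [z' lw'] : exists z', loc w' om = Some z' by move: lw; rewrite ew; exact: loc_rcons.
      have ww : w' = w1 by apply: (lb_inj nc (loc_wordb lw') (loc_wordb l1) e1).
      exists w1, z1; split => //; rewrite ew -ww; first exact: prefix_rcons.
      by move=> /esym; exact: rcons_neq.
    have [w1 [z1 [l1 e1 p1 n1]]] := IH1 w z lw ex.
    have [w2 [z2 [l2 e2 p2 n2]]] := IH2 w1 z1 l1 e1.
    exists w2, z2; split => //; first exact: prefix_trans p1.
    move=> e; have := proper_prefix_size p1 n1; have := proper_prefix_size p2 n2.
    by rewrite e => h1 h2; have := ltn_trans h1 h2; rewrite ltnn.
  by move=> h; exact: H h w z lw erefl.
move=> [w1 [z1 [l1 -> pw ne]]]; elim/last_ind: w z lw pw ne => [|w j IH] z lw pw ne.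
  by case: w1 pw ne {l1}.
have w0 : w <> [::].
  move=> e; move: (proper_prefix_size pw ne); rewrite e /= ltnS leqn0 size_eq0 => /eqP e1.
  by rewrite e1 in l1.
have [z' lw'] := loc_rcons w0 lw.
have st : pred_of t (vt (rcons w j) z) (vt w z').
  by split; [apply/treeP; exists w, z'|rewrite /= parb_rcons].
have [ee|ne'] := eqVneq w1 w.
  apply: t_step; split; first by apply/treeP; exists w1, z1.
  by rewrite /= parb_rcons // ee.
apply: (t_trans _ _ _ _ _ (t_step _ _ _ _ st)); apply: (IH z' lw'); last exact/eqP.
have [s es] := prefixP pw; case/lastP: s es => [|s j'] es; first by rewrite cats0 in es; case: ne.
by move: es; rewrite -rcons_cat => /rcons_inj[-> _]; exact: prefix_prefix.
Qed.

Lemma HBP v : HB B t v <-> exists T z, [/\ loc T om = Some z, v = vt T z & hitT T om].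
Proof.
split.
  move=> [/treeP[T [z [lT ev]]] [vB nB]]; exists T, z; split => //; apply/hitTP.
  exists z; split => //; first by move: vB; rewrite ev.
  move=> w1 z1 pw ne l1; apply/negP => zB; apply: nB; exists (vt w1 z1); split => //.
  by rewrite ev; apply/(strict_ancP _ lT); exists w1, z1.
move=> [T [z [lT -> /hitTP[z' [lT' zB h]]]]].
have e : z' = z by move: lT'; rewrite lT => -[].
split; first by apply/treeP; exists T, z.
split; first by rewrite /= -e.
move=> [a [/(strict_ancP _ lT)[w1 [z1 [l1 -> pw ne]]] /= aB]].
by have := h _ _ pw ne l1; rewrite aB.
Qed.

(** By [strict_ancP], the individual with word [T] and its ancestors are those whose words are
    prefixes of [T], and these are the words that [kidT] colours blue. *)
Lemma colour_at_target T z : loc T om = Some z -> colour_at t (vt T z) = targetF T om.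
Proof.
move=> lT; have T0 : T <> [::] by move=> e; rewrite e in lT.
have key w z1 : loc w om = Some z1 ->
    `[< vt w z1 = vt T z \/ strict_anc t (vt T z) (vt w z1) >] = prefix w T.
  move=> lw; apply/asboolP/idP.
    move=> [/(vt_inj lw lT) ->|/(strict_ancP _ lT)[w1 [z2 [l1 e pw _]]]]; first exact: prefix_refl.
    by rewrite (vt_inj lw l1 e).
  move=> pw; have [e|/eqP ne] := eqVneq w T.
    by left; move: lw; rewrite e lT => -[->].
  by right; apply/(strict_ancP _ lT); exists w, z1.
apply/seteqP; split.
- move=> [c1 c2] [/= /treeP[w [z1 [lw e1]]] e2]; subst c1 c2; exists (w, (z1, prefix w T)); split.
    exists (size w); rewrite rgen_kidT //=; apply/mapP; exists (w, (z1, false)) => //.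
    by apply/mem_rgen_white.
  by rewrite /ind /= key.
- move=> _ [[w [z1 b]] [[n]]] + ->; rewrite rgen_kidT //=.
  move=> /mapP[[w' [z' b']] /mem_rgen_white[/= lw _ _] [-> -> ->]].
  split; first by apply/treeP; exists w', z'.
  by rewrite /= key.
Qed.

Variable x0 : S.

Lemma esum_HB (f : Ind R S -> \bar R) :
  \esum_(v in HB B t) f v =
  \esum_(T in [set: W]) (if hitT T om then f (vt T (odflt x0 (loc T om))) else 0)%E.
Proof.
have -> : HB B t = [set vt T (odflt x0 (loc T om)) | T in [set T | hitT T om]].
  apply/seteqP; split => v.
    by move=> /HBP[T [z [lT -> hT]]]; exists T => //; rewrite lT.
  move=> [T /= hT <-]; have /hitTP[z [lT _ _]] := hT.
  by apply/HBP; exists T, z; rewrite lT.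
rewrite esum_image; last first.
  move=> T T'; rewrite !inE /= => /hitTP[z [lT _ _]] /hitTP[z' [lT' _ _]].
  by rewrite lT lT' /=; exact: vt_inj.
rewrite esum_mkcond; apply: eq_esum => T _.
by rewrite (_ : (T \in _) = hitT T om) //; apply/idP/idP; rewrite inE.
Qed.

Lemma card_HB : card_e R (HB B t) = enn_val (ESum (fun T => (hitT T om)%:R : ennr R)).
Proof.
rewrite /card_e esum_HB; apply: eq_esum => T _; rewrite enn_natr.
by case: hitT.
Qed.

(** The cardinality cancels the uniform choice, leaving one indicator for each target. If H_B is
    empty, both sides are 0. *)
Lemma card_Gamma_col A : (card_e R (HB B t) < +oo)%E ->
  (card_e R (HB B t) * Gamma_col B t A)%E =
  enn_val (ESum (fun T => (`[< hitT T om /\ A (targetF T om) >])%:R : ennr R)).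
Proof.
move=> cf.
have indTE T : hitT T om -> (\1_A (colour_at t (vt T (odflt x0 (loc T om)))))%:E =
    (`[< hitT T om /\ A (targetF T om) >])%:R%:E :> \bar R.
  move=> hT; have /hitTP[z [lT _ _]] := hT; rewrite lT /= (colour_at_target lT) indicE.
  have [a|a] := pselect (A (targetF T om)); first by rewrite mem_set // asboolT.
  by rewrite memNset // asboolF // => -[].
rewrite /Gamma_col; case: asboolP => [[c0 _]|nc0].
  set c := card_e R (HB B t) in cf c0 *.
  have ci0 : (0 <= c^-1)%E by rewrite inve_ge0 ltW.
  have -> : \esum_(v in HB B t) ((\1_A (colour_at t v))%:E / c)%E =
      enn_val (Ennr ci0 * ESum (fun T => (`[< hitT T om /\ A (targetF T om) >])%:R : ennr R)).
    rewrite -ESum_mull esum_HB; apply: eq_esum => T _; rewrite enn_valM /= enn_natr muleC.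
    case: ifPn => [hT|/negP hT]; first by have := indTE T hT; rewrite hT => ->.
    rewrite (_ : `[< _ >] = false) ?mulr0n ?mule0 //.
    by apply: asboolF => -[].
  by rewrite enn_valM /= muleA divee ?mul1e //; [rewrite ge0_fin_numE // ltW|rewrite gt_eqF].
have -> : ESum (fun T => (`[< hitT T om /\ A (targetF T om) >])%:R : ennr R) = 0.
  rewrite -[RHS](ESum0 R W); apply: eq_ESum => T.
  case: asboolP => [[hT _]|//]; exfalso; apply: nc0; split => //.
  rewrite card_HB; apply: lt_le_trans (ESum_ge _ T).
  by rewrite hT enn_natr lte_fin ltr01.
by rewrite mule0.
Qed.

End Good.
End Target.

(** * The size-biased law *)

Section SizeBias.
Variables (S : countType) (p : S -> S -> R) (d : S -> nat -> R) (B : seq S).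
Hypotheses (hp : stochastic p) (hd : offspring_laws d)
  (green_fin : forall x y, (green p d x y < +oo)%E) (norming : norming_region p d B).
Local Notation W := (seq nat).
Local Notation h := (hh p d B).
Local Notation kidb := (kidb p d B h).
Local Notation kidT := (kidT p d).

Let h_gt0 := hh_gt0 hp hd green_fin norming.
Let kok := kidb_ok B hp hd h_gt0.
Let kokT := kidT_ok hp hd.

Variables (xs : seq S) (rl : nat -> O -> R) (i0 : O -> nat).
Hypotheses (xs0 : xs != [::])
  (rl_sig : forall i A, measurable A -> sig [set ([::], 0)] (rl i @^-1` A))
  (rl_null : forall i j, (i < size xs)%N -> (j < size xs)%N -> i != j ->
    pr [set om | rl i om = rl j om] = 0)
  (rl_U_null : forall i w, (i < size xs)%N -> (1 < size w)%N ->
    pr [set om | rl i om = U w 0 om] = 0)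
  (di0 : dm [set ([::], 1)] i0)
  (li0 : forall i, (i < size xs)%N ->
    forall c0, pr (i0 @^-1` [set i]) * Hs p d B xs = hE h (nth c0 (ixs xs) i).2)
  (ri0 : forall i, (size xs <= i)%N -> pr (i0 @^-1` [set i]) = 0).
Local Notation lb := (lbr xs rl).
Local Notation hitT := (hitT p d B xs).
Local Notation rgen := (rgen xs).
Local Notation targetF := (targetF p d xs rl).
Local Notation whiteF := (whiteF p d xs rl).
Local Notation Hs := (Hs p d B xs).
Local Notation Db := (wordb xs).

Lemma lbr_sig w A : measurable A -> sig setT (lb w @^-1` A).
Proof.
move=> mA; case: w => [|i [|j w]].
- exact: (@sig_U _ ([::], 0)).
- rewrite /lbr; case: (i < size xs)%N; last exact: sig_prop.
  by apply: sigS (rl_sig i mA).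
- exact: (@sig_U _ (i :: j :: w, 0)).
Qed.

Lemma lbr_null w w' : Db w -> Db w' -> w != w' -> pr [set om | lb w om = lb w' om] = 0.
Proof.
case: w => // i w; case: w' => // j w' /= hi hj.
case: w => [|i1 w]; case: w' => [|j1 w'] ne; rewrite /lbr ?hi ?hj.
- apply: rl_null => //; by apply: contraNneq ne => ->.
- exact: rl_U_null.
- rewrite (_ : [set om | _] = [set om | rl j om = U [:: i, i1 & w] 0 om]); first exact: rl_U_null.
  by apply/seteqP; split => om /= ->.
- by apply: pr_U_eq => -[e1 e2 e3]; rewrite e1 e2 e3 eqxx in ne.
Qed.

Definition biasedF : O -> set (CInd R S) :=
  eforest lb parb (fun n om => rgen kidb n (fun j => j == i0 om) om).

Lemma dm_biased n : dm setT (fun om => rgen kidb n (fun j => j == i0 om) om).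
Proof.
apply: (@dm_rgen _ _ _ kok n _ _ i0 (fun i j => j == i)) => //.
by apply: dmS di0.
Qed.

Lemma dm_target n T : dm setT (fun om => rgen (kidT T) n (fun j => j == head 0%N T) om).
Proof.
apply: (@dm_rgen _ _ _ (kokT T) n _ _ (fun=> tt) (fun _ j => j == head 0%N T)) => //.
exact: dm_cst.
Qed.

Section Marks.
Variables (K : countType) (kap : R -> K).
Hypothesis mkap : forall k, measurable (kap @^-1` [set k]).

Lemma typed_rtarget_hit n ms i u om : (i < size xs)%N ->
  typed_rtarget p d B xs kap n ms i u om =
  if hitT (i :: u) om then
    Some (flatten [seq typed_gen (kidT (i :: u)) kap n [:: c.1] None (mk kap ms c.1) (c.2, c.1 == i) om
      | c <- ixs xs])
  else None.
Proof.
move=> si; rewrite /typed_rtarget /hitT.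
have hc c : c \in ixs xs -> c.1 = i -> onth xs i = Some c.2 by move=> /mem_ixs + <-.
case: ifP => hT.
  rewrite -oflat_Some; congr oflat; apply/eq_in_map => c cin.
  have [ci|ci] := eqVneq c.1 i.
    by move: hT; rewrite (hc c cin ci) /typed_target -ci => ->.
  rewrite (@typed_gen_kidT_off _ _ _ B h) //=; by apply: contraNN ci => /andP[/eqP ->].
apply: oflat_None.
case e : (onth xs i) hT => [x|]; last first.
  by have := onthTE xs i; rewrite e si.
move=> hT; apply/mapP; exists (i, x); first exact/mem_ixs.
by rewrite /= eqxx /typed_target hT.
Qed.

Lemma dm_typed_rtarget_setT n ms i u : dm setT (typed_rtarget p d B xs kap n ms i u).
Proof. by apply: dmS (@dm_typed_rtarget _ p d B hp hd green_fin norming xs K kap mkap n ms i u). Qed.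

End Marks.

(** The success of the search is read off [typed_rtarget] with a single label class and no recorded
    generation. *)
Lemma dm_hitT T : dm setT (hitT T).
Proof.
case: T => [|i u]; first exact: dm_cst.
have [si|si] := ltnP i (size xs); last first.
  have -> : hitT (i :: u) = fun=> false.
    by apply/funext => om; rewrite /hitT onth_default.
  exact: dm_cst.
have mkap (k : unit) : measurable ((fun _ : R => tt) @^-1` [set k]).
  by rewrite (_ : _ @^-1` _ = setT) //; apply/seteqP; split => // r _; case: k.
have -> : hitT (i :: u) = fun om => isSome (typed_rtarget p d B xs (fun=> tt) 0 [::] i u om).
  by apply/funext => om; rewrite (typed_rtarget_hit _ _ _ _ _ si); case: ifP.
by apply: dm_comp; exact: dm_typed_rtarget_setT.
Qed.

Lemma measurable_hitT T : measurable [set om | hitT T om].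
Proof. exact: (measurable_dm_pred (fun b => is_true b) (dm_hitT T)). Qed.

Lemma biased_measurable A : <<s @inter_gen S >> A -> measurable (biasedF @^-1` A).
Proof. by apply: eforest_measurable; [exact: lbr_sig|exact: dm_biased]. Qed.

Lemma target_measurable T A : <<s @inter_gen S >> A -> measurable (targetF T @^-1` A).
Proof. by apply: eforest_measurable; [exact: lbr_sig|move=> n; exact: dm_target]. Qed.

Lemma Hs_lty : (enn_val Hs < +oo)%E.
Proof.
rewrite /Hs enn_val_sum; apply: lte_sum_pinfty => x _.
by rewrite toE_val ?ltry // ltW.
Qed.

(** This is [biased_target] for the indicator of the profile. On the right a failed search
    contributes 0, and a successful one contributes the profile of the recoloured tree. *)
Lemma profile_step cs n : specs_ok cs ->
  Hs * pr [set om | eprofile lb parb (fun n om => rgen kidb n (fun j => j == i0 om) om) cs n om] =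
  ESum (fun T => pr ([set om | hitT T om] `&`
    [set om | eprofile lb parb (fun n om => rgen (kidT T) n (fun j => j == head 0%N T) om) cs n om])).
Proof.
move=> ok; have mkap := measurable_label_class ok.
rewrite (pr_eprofile parb (@lbr_sig) (@dm_biased) n ok).
transitivity (Hs * Ex (fun om => typed_rgen p d B xs (label_class cs) n (rmk xs (label_class cs) rl om) (fun j => j == i0 om) om)
    (fun l => (profile cs 0 l)%:R)).
  congr (_ * _); apply: Ex_ext => om.
  exact: esym (@typed_rgen_typ _ xs _ kok rl _ (label_class cs) n (fun j => j == i0 om) om).
rewrite (biased_target hp hd green_fin norming mkap rl_sig di0 li0 ri0).
rewrite [RHS]ESum_seq.
have e0 T (Q : set O) : (forall om, ~ hitT T om) -> pr ([set om | hitT T om] `&` Q) = 0.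
  by move=> nh; rewrite -[RHS]pr0; congr pr; apply/seteqP; split => om // -[/nh].
rewrite e0 // add0r.
apply: eq_ESum => i; rewrite -ESum_mull; apply: eq_ESum => u.
have [si|si] := ltnP i (size xs); last first.
  by rewrite mul0r e0 // => om; rewrite /hitT onth_default.
rewrite mul1r.
pose X om := typed_rtarget p d B xs (label_class cs) n (rmk xs (label_class cs) rl om) i u om.
have dX : dm setT X.
  apply: (dm_bind (X := rmk xs (label_class cs) rl) (Y := fun ms => typed_rtarget p d B xs (label_class cs) n ms i u)).
    by apply: dmS (@dm_rmk _ xs _ _ mkap rl rl_sig).
  by move=> ms _; exact: dm_typed_rtarget_setT.
transitivity (pr [set om | oapp (profile cs 0) false (X om)]).
  rewrite (pr_dm (fun o => oapp (profile cs 0) false o) dX); apply: eq_ESum => o; congr (_ * _).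
  by case: o => [l|] /=; rewrite asboolb.
congr pr; apply/seteqP; split => om /=; rewrite /X typed_rtarget_hit //.
  by case: ifP => //= hT; rewrite (@typed_rgen_typ _ xs _ (kokT (i :: u)) rl _ (label_class cs) n (fun j => j == i) om).
move=> [hT]; have {}hT : hitT (i :: u) om := hT.
by rewrite hT /= (@typed_rgen_typ _ xs _ (kokT (i :: u)) rl _ (label_class cs) n (fun j => j == i) om).
Qed.

(** The identity holds in every generation by [profile_step], and [limit_exchange] carries it to the
    whole forest. Each target has its own recoloured forest, so the limit is taken inside the sum
    over targets. *)
Lemma biased_inter cs : specs_ok cs -> Hs * pr (biasedF @^-1` inter cs) =
  ESum (fun T => pr ([set om | hitT T om] `&` targetF T @^-1` inter cs)).
Proof.
move=> ok.
rewrite -[biasedF @^-1` _]setTI (@pr_eforest _ lb parb Db _ (@lbr_sig) (@lbr_null) (@dm_biased)) //; first last.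
- by move=> n om q; exact: (rgen_wordb kok).
- by move=> n om; exact: (@rgen_uniq _ xs _ kok n _ om).
- by move=> n om q; exact: rgen_sub.
under [RHS]eq_ESum => T.
  rewrite (@pr_eforest _ lb parb Db _ (@lbr_sig) (@lbr_null) (fun n => @dm_target n T)) //; first last.
  + exact: measurable_hitT.
  + by move=> n om q; exact: (rgen_wordb (kokT T)).
  + by move=> n om; exact: (@rgen_uniq _ xs _ (kokT T) n _ om).
  + by move=> n om q; exact: rgen_sub.
  over.
have mC : measurable (collision lb Db) by apply: measurable_collision; exact: lbr_sig.
have mb n := measurable_eprofile parb (@lbr_sig) (@dm_biased) n ok.
have mt T n := measurable_eprofile parb (@lbr_sig) (fun n => @dm_target n T) n ok.
apply: limit_exchange.
- exact: Hs_lty.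
- by move=> n; apply: measurableI => //; exact: measurableD.
- move=> T n; apply: measurableI; first exact: measurable_hitT.
  exact: measurableD.
- apply: eprofileD_mono; first by move=> n om q; exact: rgen_sub.
  by move=> n om; exact: (@rgen_uniq _ xs _ kok n _ om).
- move=> T; apply: eprofileD_mono; first by move=> n om q; exact: rgen_sub.
  by move=> n om; exact: (@rgen_uniq _ xs _ (kokT T) n _ om).
- move=> n; rewrite (@pr_eprofileD _ lb parb Db _ (@lbr_sig) (@lbr_null) (@dm_biased)) // setTI profile_step //.
  apply: eq_ESum => T.
  rewrite (@pr_eprofileD _ lb parb Db _ (@lbr_sig) (@lbr_null) (fun n => @dm_target n T)) //.
  exact: measurable_hitT.
Qed.

(** The empty family of generators gives the sure event, on which [biased_inter] reads off the
    expected number of targets. *)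
Lemma sum_hitT : Hs = ESum (fun T => pr [set om | hitT T om]).
Proof.
rewrite -[LHS]mulr1 -prT -(preimage_setT biasedF) (@biased_inter [::]) //.
by apply: eq_ESum => T; rewrite /= preimage_setT setIT.
Qed.

Lemma sigma_additive_preim (F : O -> set (CInd R S)) (E : set O) : measurable E ->
  (forall A, <<s @inter_gen S >> A -> measurable (F @^-1` A)) ->
  sigma_additive_on (@inter_gen S) (fun A => pr (E `&` F @^-1` A)).
Proof.
move=> mE mF; split; first by rewrite preimage_set0 setI0 pr0.
move=> A mA tA; rewrite preimage_bigcup setI_bigcupr pr_bigcup //.
- by move=> n; apply: measurableI => //; exact: mF.
- apply: trivIset_setIl; apply/trivIsetP => i j _ _ ij.
  by have /trivIsetP/(_ i j I I ij) := tA; rewrite -preimage_setI => ->; exact: preimage_set0.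
Qed.

(* Both sides are finite measures that agree on the generating pi-system. *)
Theorem biased_target_law A : forest_measurable A -> Hs * pr (biasedF @^-1` A) =
  ESum (fun T => pr ([set om | hitT T om] `&` targetF T @^-1` A)).
Proof.
move/forest_measurable_inter; move: A.
apply: (@pi_lambda_unique R _ (@inter_gen S) (fun A => Hs * pr (biasedF @^-1` A))
  (fun A => ESum (fun T => pr ([set om | hitT T om] `&` targetF T @^-1` A)))).
- exact: inter_gen_setI.
- have [a0 aU] := sigma_additive_preim (@measurableT _ O) biased_measurable.
  split; first by rewrite preimage_set0 pr0 mulr0.
  move=> F mF tF; have := aU F mF tF; rewrite setTI => ->; rewrite -ESum_mull.
  by apply: eq_ESum => n; rewrite setTI.
- have aT T := sigma_additive_preim (measurable_hitT T) (@target_measurable T).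
  split.
    by rewrite -[RHS](ESum0 R W); apply: eq_ESum => T; have [] := aT T.
  move=> F mF tF; rewrite ESum_swap; apply: eq_ESum => T; have [_ ->] := aT T => //.
- by rewrite preimage_setT prT mulr1 Hs_lty.
- by have := @biased_inter [::] I; rewrite /=.
- by move=> _ [cs [ok ->]]; exact: biased_inter.
Qed.

Let N := collision lb Db.
Let mN : measurable N. Proof. by apply: measurable_collision; exact: lbr_sig. Qed.
Let N0 : P N = 0%E.
Proof. by have /(congr1 (@enn_val R)) := pr_collision (@lbr_sig) (@lbr_null). Qed.

Let ex_root : exists x0 : S, True.
Proof. by case: xs xs0 => // x0; exists x0. Qed.

Let g om := enn_val (ESum (fun T => (`[< [set om | hitT T om] om >])%:R : ennr R)).

Let gE om : ~ N om -> card_e R (HB B (uncolour (whiteF om))) = g om.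
Proof.
move=> nc; have [x0 _] := ex_root; rewrite (card_HB p d B nc x0) /g; congr enn_val.
by apply: eq_ESum => T; rewrite asboolb.
Qed.

Let card_ge0 (t : set (Ind R S)) : (0 <= card_e R (HB B t))%E.
Proof. exact: esum_ge0. Qed.

Lemma integral_card_HB : (\int[P]_om card_e R (HB B (uncolour (whiteF om))))%E = enn_val Hs.
Proof.
rewrite (eq_integral_offnull (g := g) mN N0 (fun om => card_ge0 _) (fun om => enn_ge0 _) gE).
by have [_ ->] := integral_ESum_ind measurable_hitT; rewrite -sum_hitT.
Qed.

Lemma Gamma_col_ge0 (t : set (Ind R S)) A : (0 <= Gamma_col B t A)%E.
Proof.
rewrite /Gamma_col; case: ifP => // _; apply: esum_ge0 => v _.
by rewrite mule_ge0 ?inve_ge0 // lee_fin.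
Qed.

Lemma integral_card_Gamma_col A : forest_measurable A ->
  (\int[P]_om (card_e R (HB B (uncolour (whiteF om))) * Gamma_col B (uncolour (whiteF om)) A))%E =
  enn_val (ESum (fun T => pr ([set om | hitT T om] `&` targetF T @^-1` A))).
Proof.
move=> mA; have [mg ig] := integral_ESum_ind measurable_hitT.
have g0 om : (0 <= g om)%E by exact: enn_ge0.
have gi : P.-integrable setT g.
  apply/integrableP; split => //.
  under eq_integral => om _ do rewrite gee0_abs //.
  by rewrite ig -sum_hitT Hs_lty.
(* Outside this null set H_B is finite, which excludes the case where [Gamma_col] is 0 although
   targets exist. *)
have [N' [mN' N'0 N'g]] := integrable_ae measurableT gi.
have mNN : measurable (N `|` N') by exact: measurableU.
have NN0 : P (N `|` N') = 0%E by apply: null_set_setU.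
have mE T : measurable ([set om | hitT T om] `&` targetF T @^-1` A).
  apply: measurableI; first exact: measurable_hitT.
  by apply: target_measurable; exact: forest_measurable_inter.
have [_ <-] := integral_ESum_ind mE.
apply: (eq_integral_offnull mNN NN0).
- by move=> om; rewrite mule_ge0 // Gamma_col_ge0.
- by move=> om; exact: enn_ge0.
move=> om nn; have nc : ~ N om by move=> c; apply: nn; left.
have [x0 _] := ex_root; apply: (@card_Gamma_col _ p d B xs rl om nc x0 A).
have /= gf : g om \is a fin_num.
  by apply: contrapT => gn; apply: nn; right; apply: N'g => /= h; apply: gn; exact: h.
by rewrite (gE nc) -ge0_fin_numE.
Qed.

Lemma Hs_neq0 : enn_val Hs != 0%E.
Proof.
rewrite /Hs enn_val_sum; case: xs xs0 => // x r _; rewrite big_cons gt_eqF //.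
apply: (@lt_le_trans _ _ (enn_val (hE h x))).
  by rewrite toE_val ?lte_fin // ltW.
by rewrite leeDl // -enn_val_sum enn_ge0.
Qed.

Theorem biased_sizebiased A : forest_measurable A ->
  P (biasedF @^-1` A) = sizebiased_col B P (fun om => uncolour (whiteF om)) A.
Proof.
move=> mA; rewrite /sizebiased_col integral_card_HB integral_card_Gamma_col //.
rewrite -biased_target_law // enn_valM muleAC divee ?mul1e //.
- by rewrite ge0_fin_numE ?enn_ge0 ?Hs_lty.
- exact: Hs_neq0.
Qed.

End SizeBias.

(** * One root and the decorated spine *)

Section SingleRoot.
Variables (S : countType) (p : S -> S -> R) (d : S -> nat -> R) (B : seq S).
Hypotheses (hp : stochastic p) (hd : offspring_laws d)
  (green_fin : forall x y, (green p d x y < +oo)%E) (norming : norming_region p d B).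
Local Notation W := (seq nat).
Local Notation St := (S * bool)%type.
Local Notation h := (hh p d B).
Local Notation kidb := (kidb p d B h).
Local Notation kidd := (kidd p d B h).

Let h_gt0 := hh_gt0 hp hd green_fin norming.
Let h_hu z : toE (h z) = ESum (fun u => hu p d B u z).
Proof. exact: (hh_HE B hp hd green_fin z). Qed.
Let mE_fin := mE_lty hp hd green_fin.
Let kok := kidb_ok B hp hd h_gt0.
Let kokd := kidd_ok hp hd h_gt0 h_hu mE_fin.

Lemma rgen_white xs h' n om : rgen xs (Law.kidb p d B h') n (fun=> false) om =
  rgen xs (kidw p d) n (fun=> false) om.
Proof. by congr flatten; apply: eq_map => c; exact: gen_white. Qed.

Lemma bmc_whiteF xs rl om :
  bmc_forest p d B (fun=> 0) U [seq (rl c.1 om, (c.2, false)) | c <- ixs xs] om =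
  whiteF p d xs rl om.
Proof.
rewrite (bmc_wforest p d B xs (fun=> 0) rl (fun=> false) om) /whiteF /eforest /wforest.
apply/seteqP; split => c [q [[n qn] ->]]; exists q; split => //; exists n.
  by rewrite -(rgen_white xs (fun=> 0)).
by rewrite (rgen_white xs (fun=> 0)).
Qed.

Definition rl1 (i : nat) om : R := U [::] 0 om.

Lemma rl1_sig i A : measurable A -> sig [set ([::], 0)] (rl1 i @^-1` A).
Proof. by move=> mA; apply: (@sig_U _ ([::], 0)). Qed.

Lemma rl1_null (x : S) i j : (i < size [:: x])%N -> (j < size [:: x])%N -> i != j ->
  pr [set om | rl1 i om = rl1 j om] = 0.
Proof. by case: i j => [|i] [|j]. Qed.

Lemma rl1_U_null (x : S) i w : (i < size [:: x])%N -> (1 < size w)%N ->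
  pr [set om | rl1 i om = U w 0 om] = 0.
Proof. by move=> _ sw; apply: pr_U_eq => -[e]; rewrite -e in sw. Qed.

Lemma zero_root (x : S) : (forall i, (i < size [:: x])%N ->
    forall c0, pr ((fun _ : O => 0%N) @^-1` [set i]) * Hs p d B [:: x] =
      hE h (nth c0 (ixs [:: x]) i).2) /\
  (forall i, (size [:: x] <= i)%N -> pr ((fun _ : O => 0%N) @^-1` [set i]) = 0).
Proof.
split => -[|i] // _.
  move=> c0; rewrite (_ : _ @^-1` _ = setT); last by apply/seteqP; split.
  by rewrite prT mul1r /Hs big_seq1.
by rewrite (_ : _ @^-1` _ = set0) ?pr0 //; apply/seteqP; split.
Qed.

(** For a single root the expected cardinality of H_B is [h z], by [integral_card_HB] for the forest
    biased with [hh]. Only now may [hh] replace the integral in the definition of the biased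
    process. *)
Lemma hR_hh : hR p d B P U = h.
Proof.
apply/funext => z; rewrite /hR /hfun; have [z1 z2] := zero_root z.
have /= := @integral_card_HB _ p d B hp hd green_fin norming [:: z] rl1 (fun=> 0%N) isT
  rl1_sig (@rl1_null z) (@rl1_U_null z) (@dm_cst _ _ _) z1 z2.
rewrite {1}/Hs big_seq1 toE_val; last exact: ltW.
move=> e; rewrite (_ : (\int[P]_om _)%E = (h z)%:E) // -e; congr (integral _ _ _).
apply/funext => om; congr (card_e R (HB B (uncolour _))).
by rewrite -bmc_whiteF.
Qed.

Definition biased1 (x : S) : O -> set (CInd R S) := biasedF p d B [:: x] rl1 (fun=> 0%N).

Lemma biased_xE x : biased_x p d B P U x = biased1 x.
Proof.
apply/funext => om; rewrite /biased_x hR_hh.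
exact: (bmc_wforest p d B [:: x] h rl1 (fun j => j == 0%N) om).
Qed.

Lemma biased_x_sizebiased x A : forest_measurable A ->
  claw P (biased_x p d B P U x) A = sizebiased_col B P (bmc_x p d B U x) A.
Proof.
move=> mA; have [z1 z2] := zero_root x; rewrite /claw biased_xE /biased1.
apply: (etrans (@biased_sizebiased _ p d B hp hd green_fin norming [:: x] rl1 (fun=> 0%N) isT
  rl1_sig (@rl1_null x) (@rl1_U_null x) (@dm_cst _ _ _) z1 z2 A mA)).
congr (sizebiased_col B P _ A); apply/funext => om; congr uncolour.
by rewrite -bmc_whiteF.
Qed.

(** * The decorated path as an enumerated forest *)

Section Deco.
Variable x : S.

Definition lbd (w : W) om : R := U w 0 om.

Lemma lbd_sig w A : measurable A -> sig setT (lbd w @^-1` A).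
Proof. by move=> mA; apply: (@sig_U _ (w, 0)). Qed.

Lemma lbd_null w w' : predT w -> predT w' -> w != w' -> pr [set om | lbd w om = lbd w' om] = 0.
Proof. by move=> _ _ /eqP ne; apply: pr_U_eq => -[]. Qed.

Definition decoF : O -> set (CInd R S) :=
  eforest lbd pard (fun n om => gen kidd n [:: 0%N] (x, true) om).

Let vx : vldd [:: 0%N] (x, true). Proof. by []. Qed.

Lemma gen_deco_white n w z om : gen kidd n w (z, false) om = gen kidb n w (z, false) om.
Proof.
rewrite gen_white; elim: n w z => [//|n IH] w z /=; rewrite /kidw /Law.kidd /=; congr (_ :: flatten _).
by apply/eq_in_map => c /wkid_mem[j [_ c2]]; rewrite [c.2]surjective_pairing c2 IH.
Qed.

Definition spine_or_branch om (q : W * St) : Prop :=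
  (exists k z, hchain p d B h U x k om = Some z /\ q = ([:: k], (z, true))) \/
  (exists k z j u, [/\ hchain p d B h U x k om = Some z, (j < spine_nkids d B U k z om)%N,
     node p d B h U [:: k; j] (child_loc p U [:: k] j z om, false) u om = Some q.2
     & q.1 = [:: k, j & u]]).

Lemma gen_deco_sound n k z om q : hchain p d B h U x k om = Some z ->
  q \in gen kidd n [:: k] (z, true) om -> spine_or_branch om q.
Proof.
elim: n k z => [//|n IH] k z hk; rewrite [gen _ _ _ _ _]/= inE => /orP[/eqP ->|].
  by left; exists k, z.
move=> /flattenP[_ /mapP[c cin ->]]; move: cin; rewrite /Law.kidd /= mem_cat => /orP[].
  move=> /mapP[j]; rewrite mem_iota => /andP[_ jn] -> /=.
  rewrite gen_deco_white => /mem_gen_node[u [q1 _ nd]].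
  by right; exists k, z, j, u; split => //; rewrite q1.
case e : dsample => [z'|//]; rewrite inE => /eqP -> /=.
by apply: IH; rewrite /= hk.
Qed.

(** The spine individual number [k] sits [k] generations above the root, so its first [m]
    generations appear among the first [m + k] of the whole tree. *)
Lemma gen_deco_shift m k z om q : hchain p d B h U x k om = Some z ->
  q \in gen kidd m [:: k] (z, true) om -> q \in gen kidd (m + k)%N [:: 0%N] (x, true) om.
Proof.
elim: k m z => [|k IH] m z /=; first by move=> [<-]; rewrite addn0.
case hk : (hchain p d B h U x k om) => [z0|//] e qm; rewrite addnS -addSn.
apply: (IH m.+1 z0 hk); rewrite [gen _ _ _ _ _]/= inE; apply/orP; right.
apply/flattenP; exists (gen kidd m [:: k.+1] (z, true) om) => //.
apply/mapP; exists ([:: k.+1], (z, true)) => //.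
by rewrite /Law.kidd /= mem_cat e inE eqxx orbT.
Qed.

Lemma gen_decoP om q : (exists n, q \in gen kidd n [:: 0%N] (x, true) om) <-> spine_or_branch om q.
Proof.
split; first by move=> [n]; exact: gen_deco_sound.
case=> [[k [z [hk ->]]]|[k [z [j [u [hk jn nd q1]]]]]].
  by exists (1 + k)%N; apply: (gen_deco_shift hk); rewrite mem_head.
exists ((size u).+2 + k)%N; apply: (gen_deco_shift hk).
rewrite [gen _ _ _ _ _]/= inE; apply/orP; right; apply/flattenP.
exists (gen kidd (size u).+1 [:: k; j] (child_loc p U [:: k] j z om, false) om).
  apply/mapP; exists ([:: k; j], (child_loc p U [:: k] j z om, false)) => //.
  rewrite /Law.kidd /= mem_cat; apply/orP; left; apply/mapP; exists j => //.
  by rewrite mem_iota.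
by rewrite gen_deco_white; apply/mem_gen_node; exists u.
Qed.

Lemma deco_forestE : deco_forest p d B P U x = decoF.
Proof.
apply/funext => om; rewrite /deco_forest hR_hh; apply/seteqP; split.
- move=> c [[k [z [hk ->]]]|[k [z [j [u [hk [jn [nd [c1 c2]]]]]]]]].
    exists ([:: k], (z, true)); split; first by apply/gen_decoP; left; exists k, z.
    by rewrite /ind /lbd /=; case: k hk.
  exists ([:: k, j & u], (c.1.2, c.2)); split.
    by apply/gen_decoP; right; exists k, z, j, u.
  rewrite /ind /lbd [c]surjective_pairing [c.1]surjective_pairing [c.1.1]surjective_pairing.
  by rewrite c1 c2.
- move=> _ [[w s] [/gen_decoP[[k [z [hk [-> ->]]]]|[k [z [j [u [hk jn nd /= ->]]]]]] ->]].
    by left; exists k, z; split => //; rewrite /ind /lbd /=; case: k hk.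
  by right; exists k, z, j, u; split => //; split => //; rewrite /= -surjective_pairing.
Qed.

Lemma dm_deco n : dm setT (fun om => gen kidd n [:: 0%N] (x, true) om).
Proof. exact: (dm_gen kokd). Qed.

Lemma dm_biased1 n :
  dm setT (fun om => rgen [:: x] kidb n (fun j => j == 0%N) om).
Proof.
by apply: (@dm_rgen _ _ _ kok n _ _ (fun=> tt) (fun _ j => j == 0%N)) => //; exact: dm_cst.
Qed.

Let lb1_sig := @lbr_sig S [:: x] rl1 rl1_sig.
Let lb1_null := @lbr_null S [:: x] rl1 (@rl1_null x) (@rl1_U_null x).

Lemma profile_deco cs n : specs_ok cs ->
  pr [set om | eprofile (lbr [:: x] rl1) parb
    (fun n om => rgen [:: x] kidb n (fun j => j == 0%N) om) cs n om] =
  pr [set om | eprofile lbd pard (fun n om => gen kidd n [:: 0%N] (x, true) om) cs n om].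
Proof.
move=> ok; have mkap := measurable_label_class ok; pose f l : ennr R := (profile cs 0 l)%:R.
rewrite (pr_eprofile parb (@lb1_sig) (@dm_biased1) n ok) (pr_eprofile pard (@lbd_sig) (@dm_deco) n ok).
transitivity (label_law (label_class cs) (fun m => gen_law (label_class cs) (offb p d B h) n None m (x, true) f)).
  transitivity (Ex (fun om => typed_gen kidb (label_class cs) n [:: 0%N] None (label_class cs (U [::] 0 om)) (x, true) om) f).
    apply: Ex_ext => om; rewrite -(@typed_rgen_typ _ [:: x] _ kok rl1) /= cats0.
    by [].
  have I1 (i : idx) : [set ([::], 0)] i -> ~ Ix regb [:: 0%N] i by move=> -> [[]].
  rewrite (Ex_bind (X := fun om => label_class cs (U [::] 0 om))
    (Y := fun m => typed_gen kidb (label_class cs) n [:: 0%N] None m (x, true)) f I1 (@dm_kap _ _ mkap [::] 0)).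
    apply: eq_ESum => m; congr (_ * _); apply: (Ex_typed_gen regb_ok kok mkap) => //.
    by move=> w s g _; exact: (kidb_off hp hd h_gt0 h_hu).
  by move=> m _; apply: (dm_typed_gen regb_ok kok mkap).
(* The only change of mechanism: profiles count and do not see the order of siblings, so
   [gen_law_biased_deco] applies. *)
transitivity (label_law (label_class cs) (fun m => gen_law (label_class cs) (offd p d B h) n None m (x, true) f)).
  congr label_law; apply/funext => m; apply: (@gen_law_biased_deco S p d B hp hd h h_gt0 h_hu mE_fin _ (label_class cs) n None m (x, true) f) => l l' ll.
  by rewrite /f (profile_perm _ _ ll).
rewrite -(Ex_child (reg := regd) mkap (w := [:: 0%N])
  (Y := fun k om => typed_gen kidd (label_class cs) n [:: 0%N] None k (x, true) om) (g := f)).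
- by apply: Ex_ext => om; rewrite -(typed_gen_typ kokd).
- by move=> k; apply: (dm_typed_gen regd_ok kokd mkap).
- move=> k; apply: (Ex_typed_gen regd_ok kokd mkap) => //.
  by move=> w s g v; exact: (kidd_off hp hd h_gt0 h_hu mE_fin).
Qed.

Lemma biased_deco_inter cs : specs_ok cs ->
  pr (biased1 x @^-1` inter cs) = pr (decoF @^-1` inter cs).
Proof.
move=> ok.
have sb n om : {subset rgen [:: x] kidb n (fun j => j == 0%N) om <=
    rgen [:: x] kidb n.+1 (fun j => j == 0%N) om} by move=> q; exact: rgen_sub.
have ub n om := @rgen_uniq _ [:: x] _ kok n (fun j => j == 0%N) om.
have wb n om q : q \in rgen [:: x] kidb n (fun j => j == 0%N) om -> wordb [:: x] q.1.
  exact: (rgen_wordb kok).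
have sd n om : {subset gen kidd n [:: 0%N] (x, true) om <= gen kidd n.+1 [:: 0%N] (x, true) om}.
  by move=> q; exact: gen_sub.
have ud n om := uniq_gen regd_ok kokd n om vx.
rewrite -[biased1 x @^-1` _]setTI -[decoF @^-1` _]setTI.
rewrite (@pr_eforest _ _ parb (wordb [:: x]) _ (@lb1_sig) (@lb1_null) (@dm_biased1) sb ub wb) //.
rewrite (@pr_eforest _ _ pard predT _ (@lbd_sig) (@lbd_null) (@dm_deco) sd ud) //.
have mb n := measurable_eprofile parb (@lb1_sig) (@dm_biased1) n ok.
have md n := measurable_eprofile pard (@lbd_sig) (@dm_deco) n ok.
have mCb := measurable_collision (wordb [:: x]) (@lb1_sig).
have mCd := measurable_collision predT (@lbd_sig).
rewrite -[LHS]mul1r.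
(* Used with factor 1 and a one-point index set, where it says that equality at every stage passes
   to the unions. *)
rewrite (limit_exchange (T := unit) (D := fun _ n => setT `&` ([set om | eprofile lbd pard
   (fun n om => gen kidd n [:: 0%N] (x, true) om) cs n om] `\` collision lbd predT))).
- by rewrite (ESum_single (t0 := tt)) //; case.
- by rewrite enn_val1 ltry.
- by move=> n; apply: measurableI => //; exact: measurableD.
- by move=> _ n; apply: measurableI => //; exact: measurableD.
- exact: eprofileD_mono.
- by move=> _; exact: eprofileD_mono.
move=> n; rewrite mul1r (ESum_single (t0 := tt)); last by case.
rewrite (@pr_eprofileD _ _ parb (wordb [:: x]) _ (@lb1_sig) (@lb1_null) (@dm_biased1)) //.
rewrite (@pr_eprofileD _ _ pard predT _ (@lbd_sig) (@lbd_null) (@dm_deco)) //.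
by rewrite !setTI profile_deco.
Qed.

Theorem biased_deco A : forest_measurable A ->
  claw P (biased_x p d B P U x) A = claw P (deco_forest p d B P U x) A.
Proof.
move/forest_measurable_inter => mA; rewrite /claw biased_xE deco_forestE.
suff : pr (biased1 x @^-1` A) = pr (decoF @^-1` A) by move/(congr1 (@enn_val R)).
have mbF C : <<s @inter_gen S >> C -> measurable (biased1 x @^-1` C).
  by apply: eforest_measurable; [exact: lb1_sig|move=> n; exact: dm_biased1].
have mdF C : <<s @inter_gen S >> C -> measurable (decoF @^-1` C).
  by apply: eforest_measurable; [exact: lbd_sig|move=> n; exact: dm_deco].
move: A mA; apply: (@pi_lambda_unique R _ (@inter_gen S) (fun A => pr (biased1 x @^-1` A))
  (fun A => pr (decoF @^-1` A))).
- exact: inter_gen_setI.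
- have [a0 aU] := sigma_additive_preim measurableT mbF; split; first by rewrite preimage_set0 pr0.
  move=> F mF tF; have := aU F mF tF; rewrite setTI => ->.
  by apply: eq_ESum => n; rewrite setTI.
- have [a0 aU] := sigma_additive_preim measurableT mdF; split; first by rewrite preimage_set0 pr0.
  move=> F mF tF; have := aU F mF tF; rewrite setTI => ->.
  by apply: eq_ESum => n; rewrite setTI.
- by rewrite preimage_setT; exact: pr_lty.
- by rewrite !preimage_setT.
- by move=> _ [cs [ok ->]]; exact: biased_deco_inter.
Qed.

End Deco.
End SingleRoot.

(** * Several roots *)

Section ManyRoots.
Variables (S : countType) (p : S -> S -> R) (d : S -> nat -> R) (B : seq S).
Hypotheses (hp : stochastic p) (hd : offspring_laws d)
  (green_fin : forall x y, (green p d x y < +oo)%E) (norming : norming_region p d B).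
Variable xs : seq (R * S).
Hypotheses (xs0 : xs != [::]) (xs_uniq : uniq [seq r.1 | r <- xs]).
Local Notation h := (hh p d B).
Local Notation ys := (unzip2 xs).

Let h_gt0 := hh_gt0 hp hd green_fin norming.

Definition rlx (i : nat) (om : O) : R := nth 0 (unzip1 xs) i.

Lemma rlx_sig i A : measurable A -> sig [set ([::], 0)] (rlx i @^-1` A).
Proof. by move=> _; exact: (@sig_prop _ (A (nth 0 (unzip1 xs) i))). Qed.

Lemma rlx_null i j : (i < size ys)%N -> (j < size ys)%N -> i != j ->
  pr [set om | rlx i om = rlx j om] = 0.
Proof.
rewrite !size_map => si sj ij; rewrite -[RHS]pr0; congr pr; apply/seteqP; split => // om /=.
move/eqP; rewrite /rlx nth_uniq ?size_map //.
by move: ij => /negP ij /ij.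
Qed.

Lemma rlx_U_null i w : (i < size ys)%N -> (1 < size w)%N -> pr [set om | rlx i om = U w 0 om] = 0.
Proof.
move=> _ _; rewrite -[RHS](pr_U_point w 0 (nth 0 (unzip1 xs) i)); congr pr.
by apply/seteqP; split => om /= e; [rewrite -e|rewrite e].
Qed.

Lemma map_ixs (bc : nat -> bool) om :
  [seq (rlx c.1 om, (c.2, bc c.1)) | c <- ixs ys] =
  [seq (r.2.1, (r.2.2, bc r.1)) | r <- zip (iota 0 (size xs)) xs].
Proof.
rewrite /ixs size_map /rlx.
have H (rs : seq (R * S)) a (f : nat -> R) : (forall i, (i < size rs)%N -> f (a + i)%N = nth 0 (unzip1 rs) i) ->
    [seq (f c.1, (c.2, bc c.1)) | c <- zip (iota a (size rs)) (unzip2 rs)] =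
    [seq (r.2.1, (r.2.2, bc r.1)) | r <- zip (iota a (size rs)) rs].
  elim: rs a => [//|r rs IH] a hf /=; congr ((_, _) :: _).
    by have := hf 0%N isT; rewrite addn0.
  by apply: IH => i si; rewrite addSnnS; exact: (hf i.+1).
by apply: (H xs 0%N (fun i => nth 0 (unzip1 xs) i)) => i _; rewrite add0n.
Qed.

Let w := colh_weight h xs.
Let tot : R := \sum_(r <- xs) h r.2.

Lemma tot_gt0 : 0 < tot.
Proof.
rewrite /tot; case: xs xs0 => // r rs _; rewrite big_cons.
by rewrite ltr_wpDr // sumr_ge0 // => *; exact: ltW.
Qed.

Lemma colh_ge0 i : 0 <= w i.
Proof.
rewrite /w /colh_weight; case: onth => // r; rewrite divr_ge0 // ltW //; exact: tot_gt0.
Qed.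

Lemma colh_nth r0 i : (i < size xs)%N -> w i = h (nth r0 xs i).2 / tot.
Proof. by move=> si; rewrite /w /colh_weight (onthE xs i) (nth_map r0). Qed.

Lemma toE_sum (T : Type) (s : seq T) (f : T -> R) : (forall t, 0 <= f t) ->
  toE (\sum_(t <- s) f t) = \sum_(t <- s) toE (f t).
Proof.
move=> f0; apply: enn_eq; rewrite enn_val_sum toE_val ?sumr_ge0 // -sumEFin.
by apply: eq_bigr => t _; rewrite toE_val.
Qed.

Lemma colh_Hs : Hs p d B ys = toE tot.
Proof. by rewrite /Hs big_map toE_sum // => r; exact: ltW. Qed.

Lemma colh_sum : ESum (fun i => toE (w i)) = 1.
Proof.
have [r0 _] : exists r0 : R * S, True by case: xs xs0 => // r0; exists r0.
transitivity (ESum (fun i => (i < size xs)%N%:R * (toE (h (nth r0 xs i).2) * toE tot^-1))).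
  apply: eq_ESum => i; have [si|si] := ltnP i (size xs).
    by rewrite mul1r (colh_nth r0 si) toEM ?invr_ge0 // ltW //; exact: tot_gt0.
  by rewrite mul0r /w /colh_weight onth_default // toE0.
transitivity (\sum_(r <- xs) (toE (h r.2) * toE tot^-1)); first exact: (ESum_nth r0).
rewrite -big_distrl /= -toE_sum; last by move=> r; exact: ltW.
by rewrite -toEM ?invr_ge0 ?(ltW tot_gt0) // divff ?toE1 // gt_eqF // tot_gt0.
Qed.

Definition root0 om : nat := odflt 0%N (dsample w (U [::] 1 om)).

Lemma dm_root0 : dm [set ([::], 1)] root0.
Proof. apply: (dm_comp (odflt 0%N)); exact: (@dm_dsample _ _ colh_ge0 ([::], 1)). Qed.

Lemma pr_root0 i : pr (root0 @^-1` [set i]) = toE (w i).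
Proof.
have dd := @dm_dsample _ _ colh_ge0 ([::], 1).
have e1 : enn_val (ESum (fun t => toE (w t))) = 1%E by rewrite colh_sum.
rewrite -[LHS]/(pr [set om | (fun o => odflt 0%N o = i) (dsample w (U [::] 1 om))]) (pr_dm _ dd).
rewrite (@Ex_dsample _ w colh_ge0 _ ([::], 1)) ?e1 //; last by right.
rewrite (ESum_single (t0 := i)); first by rewrite asboolT // mulr1.
by move=> j ji; rewrite asboolF ?mulr0 //=; apply/eqP.
Qed.

Theorem biased_colh_sizebiased A : forest_measurable A ->
  claw P (biased_colh p d B P U xs) A = sizebiased_col B P (bmc_xs p d B U xs) A.
Proof.
move=> mA.
have ys0 : ys != [::] by move: xs0; case: xs.
(* The normalisation of [colh_weight] cancels against the total [Hs], so the blue root contributes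
   exactly its own [h]. *)
have li0 i : (i < size ys)%N -> forall c0,
    pr (root0 @^-1` [set i]) * Hs p d B ys = hE h (nth c0 (ixs ys) i).2.
  rewrite size_map => si [c1 c2]; have [r0 _] : exists r0 : R * S, True by exists (0, c2).
  rewrite pr_root0 colh_Hs (colh_nth r0 si) -toEM ?divr_ge0 ?(ltW tot_gt0) ?(ltW (h_gt0 _)) //.
  rewrite divfK ?gt_eqF ?tot_gt0 //.
  by rewrite /ixs size_map nth_zip ?size_iota ?size_map // (nth_map r0).
have ri0 i : (size ys <= i)%N -> pr (root0 @^-1` [set i]) = 0.
  by rewrite size_map => si; rewrite pr_root0 /w /colh_weight onth_default // toE0.
have e1 : biased_colh p d B P U xs = biasedF p d B ys rlx root0.
  apply/funext => om; rewrite /biased_colh (hR_hh hp hd green_fin norming).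
  rewrite -(map_ixs (fun j => j == root0 om) om).
  exact: (bmc_wforest p d B ys h rlx (fun j => j == root0 om) om).
have e2 : bmc_xs p d B U xs = fun om => uncolour (whiteF p d ys rlx om).
  apply/funext => om; rewrite /bmc_xs -(bmc_whiteF p d B) (map_ixs (fun=> false) om).
  congr (uncolour (bmc_forest _ _ _ _ _ _ _)).
  rewrite -[in LHS](@unzip2_zip _ _ (iota 0 (size xs)) xs) ?size_iota // -map_comp.
  by apply: eq_map.
rewrite /claw e1 e2.
exact: (@biased_sizebiased _ p d B hp hd green_fin norming ys rlx root0 ys0
  rlx_sig rlx_null rlx_U_null dm_root0 li0 ri0 A mA).
Qed.

End ManyRoots.
End Law.

Theorem mainTheorem4 (R : realType) (S : countType)
  (p : S -> S -> R) (d : S -> nat -> R) (B : seq S)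
  (dO : measure_display) (O : measurableType dO) (P : probability O R)
  (U : seq nat -> nat -> O -> R) :
  stochastic p ->
  offspring_laws d ->
  (forall x y, (green p d x y < +oo)%E) ->
  norming_region p d B ->
  iid_uniform P U ->
  (forall (x : S) (A : set (set (CInd R S))), forest_measurable A ->
     claw P (biased_x p d B P U x) A = sizebiased_col B P (bmc_x p d B U x) A /\
     sizebiased_col B P (bmc_x p d B U x) A = claw P (deco_forest p d B P U x) A)
  /\
  (forall (xs : seq (R * S)) (A : set (set (CInd R S))),
     xs != [::] -> uniq [seq r.1 | r <- xs] ->
     all (fun r => (0 <= r.1 <= 1)) xs ->
     forest_measurable A ->
     claw P (biased_colh p d B P U xs) A = sizebiased_col B P (bmc_xs p d B U xs) A).
Proof.
move=> hp hd hg hn iid; split.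
  move=> x A mA; have e1 := biased_x_sizebiased iid hp hd hg hn x mA.
  by split => //; rewrite -e1; exact: biased_deco.
by move=> xs A xs0 xu _ mA; exact: biased_colh_sizebiased.
Qed.
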